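(* Let $n\ge1$ and suppose $\alpha_{\boldsymbol N}(a,b)$ and $\beta_{\boldsymbol N}(a,b)$ form a WP Bailey pair with respect to the matrix $\mathbf B^{(2)}$. For complex parameters $\rho_1,\rho_2$ let \begin{align*} \alpha'_{\boldsymbol N}(a,b)&:=\frac{(\rho_1;q,p)_{|\boldsymbol N|}}{(aq/\rho_2;q,p)_{|\boldsymbol N|}}\prod_{r=1}^n\frac{(\rho_2x_r;q,p)_{N_r}}{(ax_rq/\rho_1;q,p)_{N_r}}\cdot\left(\frac{aq}{\rho_1\rho_2}\right)^{|\boldsymbol N|}\alpha_{\boldsymbol N}\big(a,b\rho_1\rho_2/(aq)\big),\\ \beta'_{\boldsymbol N}(a,b)&:=\frac{(b\rho_2/a;q,p)_{|\boldsymbol N|}}{(aq/\rho_2;q,p)_{|\boldsymbol N|}}\prod_{r=1}^n\frac{(b\rho_1q^{|\boldsymbol N|-N_r}/(ax_r);q,p)_{N_r}}{(ax_rq/\rho_1;q,p)_{N_r}}\\ &\quad\times\sum_{\substack{0\le k_r\le N_r\\ r=1,\dots,n}}\Bigg(\frac{(\rho_1;q,p)_{|\boldsymbol k|}}{(b\rho_2/a;q,p)_{|\boldsymbol k|}}\prod_{r=1}^n\frac{(\rho_2x_r;q,p)_{k_r}(b\rho_1q^{|\boldsymbol N|}/(ax_r);q,p)_{|\boldsymbol k|-k_r}}{(b\rho_1q^{|\boldsymbol N|-N_r}/(ax_r);q,p)_{|\boldsymbol k|}}\\ &\qquad\times\frac{\theta(b\rho_1\rho_2q^{2|\boldsymbol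 k|}/(aq);p)}{\theta(b\rho_1\rho_2/(aq);p)}\frac{(b;q,p)_{|\boldsymbol N|+|\boldsymbol k|}}{(b\rho_1\rho_2/a;q,p)_{|\boldsymbol N|+|\boldsymbol k|}}\\ &\qquad\times\frac{(aq/(\rho_1\rho_2);q,p)_{|\boldsymbol N|-|\boldsymbol k|}}{\prod_{r,s=1}^n(q^{1+k_r-k_s}x_r/x_s;q,p)_{N_r-k_r}}\left(\frac{aq}{\rho_1\rho_2}\right)^{|\boldsymbol k|}\beta_{\boldsymbol k}\big(a,b\rho_1\rho_2/(aq)\big)\Bigg). \end{align*} Then $\alpha'_{\boldsymbol N}(a,b)$ and $\beta'_{\boldsymbol N}(a,b)$ also form a WP Bailey pair with respect to $\mathbf B^{(2)}$.
   Context: Let $q,p$ be complex numbers with $q\neq 0$ and $|p|<1$. For $a\ne 0$ put $\theta(a;p)=\prod_{j\ge 0}(1-ap^j)(1-p^{j+1}/a)$. For an integer $k$ the $q,p$-shifted factorial is $(a;q,p)_k=\prod_{j=0}^{k-1}\theta(aq^j;p)$ if $k\ge 0$ (empty product $=1$), and $(a;q,p)_{k}=\big(\prod_{j=k}^{-1}\theta(aq^{j};p)\big)^{-1}$ if $k<0$. Write $(a_1,\dots,a_m;q,p)_k=(a_1;q,p)_k\cdots(a_m;q,p)_k$. For a tuple $\boldsymbol k=(k_1,\dots,k_n)$, $|\boldsymbol k|=k_1+\cdots+k_n$. The $x_1,\dots,x_n$ are fixed complex parameters. All parameters are nonzero and generic in the sense that no denominators vanish. WP Bailey pair: given a matrix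 $\mathbf B=(B_{\boldsymbol k\boldsymbol j}(a,b))$ indexed by $n$-tuples of nonnegative integers, two sequences $\alpha_{\boldsymbol N}(a,b)$ and $\beta_{\boldsymbol N}(a,b)$ (indexed by $n$-tuples of nonnegative integers and depending on parameters $a,b$) form a WP Bailey pair with respect to $\mathbf B$ if for all $\boldsymbol N$ and all (generic) $a,b$ $$\beta_{\boldsymbol N}(a,b)=\sum_{0\le j_r\le N_r,\ r=1,\dots,n}B_{\boldsymbol N\boldsymbol j}(a,b)\,\alpha_{\boldsymbol j}(a,b).$$ The matrix $\mathbf B^{(2)}$ has entries $$B^{(2)}_{\boldsymbol k\boldsymbol j}(a,b)=\frac{(b;q,p)_{|\boldsymbol k|+|\boldsymbol j|}\prod_{r=1}^n(bq^{|\boldsymbol k|-k_r}/(ax_r);q,p)_{k_r-j_r}}{\prod_{r,s=1}^n(q^{1+j_r-j_s}x_r/x_s;q,p)_{k_r-j_r}\prod_{r=1}^n(ax_rq;q,p)_{k_r+|\boldsymbol j|}}.$$ *)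

(* Defs.v *)
From HB Require Import structures.
From mathcomp Require Import all_boot all_order all_algebra.
From mathcomp Require Import all_classical all_reals all_analysis.
From mathcomp Require Import complex.

Set Implicit Arguments.
Unset Strict Implicit.
Unset Printing Implicit Defensive.

Import Order.TTheory GRing.Theory Num.Theory numFieldNormedType.Exports.

Local Open Scope ring_scope.
Local Open Scope complex_scope.

(* The limit is taken in R[i]^o, the copy of R[i] that carries the topology
   of the complex modulus. *)
Definition theta (R : realType) (p a : R[i]) : R[i] :=
  limn ((fun m : nat =>
    \prod_(j < m) ((1 - a * p ^+ j) * (1 - p ^+ j.+1 / a))) : nat -> R[i]^o).

(* (a; q, p)_k for k in Z; [Negz m] is - (m + 1), and the index j of the
   defining product over k <= j <= -1 is - (i + 1) here. *)
Definition qpfact (R : realType) (q p a : R[i]) (k : int) : R[i] :=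
  match k with
  | Posz m => \prod_(i < m) theta p (a * q ^+ i)
  | Negz m => (\prod_(i < m.+1) theta p (a * q ^ (- (i.+1)%:Z)))^-1
  end.

Definition multi (n : nat) : Type := {ffun 'I_n -> nat}.

Definition wt (n : nat) (k : multi n) : nat := (\sum_(r < n) k r)%N.

Definition box_sum (R : realType) (n : nat) (N : multi n)
    (F : multi n -> R[i]) : R[i] :=
  \sum_(j : {dffun forall r : 'I_n, 'I_(N r).+1})
    F [ffun r => nat_of_ord (j r)].

(* [generic a b] delimits the parameter values for which the relation is
   asserted. *)
Definition WP_Bailey_pair (R : realType) (n : nat)
    (generic : R[i] -> R[i] -> Prop)
    (B : multi n -> multi n -> R[i] -> R[i] -> R[i])
    (alpha beta : multi n -> R[i] -> R[i] -> R[i]) : Prop :=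
  forall (N : multi n) (a b : R[i]), generic a b ->
    beta N a b = box_sum N (fun j => B N j a b * alpha j a b).

(* Differences of multi-index entries are formed in int, since the
   subtraction of nat is truncated. *)
Definition B2 (R : realType) (n : nat) (q p : R[i]) (x : 'I_n -> R[i])
    (k j : multi n) (a b : R[i]) : R[i] :=
  (qpfact q p b (wt k + wt j)%N%:Z
   * \prod_(r < n)
       qpfact q p (b * q ^ ((wt k)%:Z - (k r)%:Z) / (a * x r))
                  ((k r)%:Z - (j r)%:Z))
  / ((\prod_(r < n) \prod_(s < n)
       qpfact q p (q ^ (1 + (j r)%:Z - (j s)%:Z) * x r / x s)
                  ((k r)%:Z - (j r)%:Z))
     * \prod_(r < n) qpfact q p (a * x r * q) (k r + wt j)%N%:Z).

Definition alpha' (R : realType) (n : nat) (q p : R[i]) (x : 'I_n -> R[i])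
    (rho1 rho2 : R[i]) (alpha : multi n -> R[i] -> R[i] -> R[i])
    (N : multi n) (a b : R[i]) : R[i] :=
  qpfact q p rho1 (wt N)%:Z / qpfact q p (a * q / rho2) (wt N)%:Z
  * (\prod_(r < n)
      (qpfact q p (rho2 * x r) (N r)%:Z
       / qpfact q p (a * x r * q / rho1) (N r)%:Z))
  * (a * q / (rho1 * rho2)) ^+ wt N
  * alpha N a (b * rho1 * rho2 / (a * q)).

Definition beta' (R : realType) (n : nat) (q p : R[i]) (x : 'I_n -> R[i])
    (rho1 rho2 : R[i]) (beta : multi n -> R[i] -> R[i] -> R[i])
    (N : multi n) (a b : R[i]) : R[i] :=
  qpfact q p (b * rho2 / a) (wt N)%:Z / qpfact q p (a * q / rho2) (wt N)%:Z
  * (\prod_(r < n)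
      (qpfact q p (b * rho1 * q ^ ((wt N)%:Z - (N r)%:Z) / (a * x r)) (N r)%:Z
       / qpfact q p (a * x r * q / rho1) (N r)%:Z))
  * box_sum N (fun k =>
      qpfact q p rho1 (wt k)%:Z / qpfact q p (b * rho2 / a) (wt k)%:Z
      * (\prod_(r < n)
          (qpfact q p (rho2 * x r) (k r)%:Z
           * qpfact q p (b * rho1 * q ^+ wt N / (a * x r))
                        ((wt k)%:Z - (k r)%:Z)
           / qpfact q p (b * rho1 * q ^ ((wt N)%:Z - (N r)%:Z) / (a * x r))
                        (wt k)%:Z))
      * (theta p (b * rho1 * rho2 * q ^+ (2 * wt k) / (a * q))
         / theta p (b * rho1 * rho2 / (a * q)))
      * (qpfact q p b (wt N + wt k)%N%:Z
         / qpfact q p (b * rho1 * rho2 / a) (wt N + wt k)%N%:Z)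
      * (qpfact q p (a * q / (rho1 * rho2)) ((wt N)%:Z - (wt k)%:Z)
         / \prod_(r < n) \prod_(s < n)
             qpfact q p (q ^ (1 + (k r)%:Z - (k s)%:Z) * x r / x s)
                        ((N r)%:Z - (k r)%:Z))
      * (a * q / (rho1 * rho2)) ^+ wt k
      * beta k a (b * rho1 * rho2 / (a * q))).

(* "No denominators vanish", split according to the parameters involved:
   the denominators of B2 and beta' that contain only q, p and x ... *)
Definition generic_x (R : realType) (n : nat) (q p : R[i])
    (x : 'I_n -> R[i]) : Prop :=
  (forall r, x r != 0) /\
  (forall (k j : multi n), (forall r, (j r <= k r)%N) ->
     forall r s, qpfact q p (q ^ (1 + (j r)%:Z - (j s)%:Z) * x r / x s)
                            ((k r)%:Z - (j r)%:Z) != 0).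

(* ... the remaining denominators of B2 ... *)
Definition generic_B2 (R : realType) (n : nat) (q p : R[i])
    (x : 'I_n -> R[i]) (a b : R[i]) : Prop :=
  [/\ a != 0, b != 0 &
      forall (k j : multi n), (forall r, (j r <= k r)%N) ->
        forall r, qpfact q p (a * x r * q) (k r + wt j)%N%:Z != 0].

(* ... and the remaining denominators of alpha' and beta'. *)
Definition generic_rho (R : realType) (n : nat) (q p : R[i])
    (x : 'I_n -> R[i]) (rho1 rho2 a b : R[i]) : Prop :=
  theta p (b * rho1 * rho2 / (a * q)) != 0 /\
  (forall (N k : multi n), (forall r, (k r <= N r)%N) ->
     [/\ qpfact q p (a * q / rho2) (wt N)%:Z != 0,
         forall r, qpfact q p (a * x r * q / rho1) (N r)%:Z != 0,
         qpfact q p (b * rho2 / a) (wt k)%:Z != 0,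
         forall r,
           qpfact q p (b * rho1 * q ^ ((wt N)%:Z - (N r)%:Z) / (a * x r))
                      (wt k)%:Z != 0 &
         qpfact q p (b * rho1 * rho2 / a) (wt N + wt k)%N%:Z != 0]).

(* Main.v *)
From HB Require Import structures.
From mathcomp Require Import all_boot all_order all_algebra.
From mathcomp Require Import perm ring.
Set Implicit Arguments.
Unset Strict Implicit.
Unset Printing Implicit Defensive.
Import Order.TTheory GRing.Theory Num.Theory.
Local Open Scope ring_scope.

(** Both sides of the claimed relation are linear in the arbitrary sequence
    alpha.  Substituting the relation for beta_k(a, b'), where
    b' = b rho1 rho2 / (a q), into beta'_N and comparing the coefficients of
    alpha_j(a, b') leaves one summation over the k with j <= k <= N, namely
    [sum_bailey_term]: a Jackson-type summation for A_n series.

    That summation is a special case of [subset_expansion], a sum over the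
    subsets I of a finite set U in which every element e of U carries a free
    variable c_e.  For U take the pairs (r, i) with j_r <= i < N_r, and
    c_(r,i) = C x_r q^i.  The term of I contains the factors
    theta (q c_f / c_e) with e in I and f outside I, one of which is
    theta 1 = 0 as soon as I contains some (r, i + 1) but not (r, i).  Hence
    only the sets of all (r, i) with j_r <= i < k_r contribute, and these
    correspond to the multi-indices k.

    [subset_expansion] goes by induction on the cardinality n of U.  Single
    out z in U and let d be A q^n / (u v).  The terms with z in I contain
    theta (d c_z) and those with z outside I contain theta (c_z); so at
    c_z = 1/d, and at c_z = 1, only one kind survives, and what remains is
    the same identity for U minus z.  For other values of c_z every term is
    expanded by Lagrange interpolation at these two nodes.  This produces
    residues at the points c_z = c_e, and the residue of I at an element e of
    I is opposite to the residue of I minus e at e.  If d c_z is a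
    zero of theta, then c_z is a translate of the node 1/d by a
    quasi-period, and the identity is the one at that node.  Lagrange
    interpolation is an instance of the partial fraction identity [pfsum0],
    which follows by induction from the three-term relation of theta.

    So theta enters through three properties only: its inversion formula, the
    three-term relation, and its quasi-periodicity under translation by a
    zero; they are collected in [theta_like].  The first and the last can be
    read off the defining product.  For the three-term relation, Jacobi's
    triple product turns theta (x y) theta (x / y) into a double series over
    (k, l); separating the parity classes of k + l gives
    C x (Psi x Phi y - Phi x Psi y), and products of such 2 x 2 determinants
    satisfy the Pluecker relation.  The limits involved are controlled by
    geometric convergence of the truncated products and series. *)

(** * Sums over subsets and over strips *)

Section SetSums.
Variables (T : finType) (R : nmodType).
Implicit Types (U I : {set T}).

Lemma big_subsetU1 U z (G : {set T} -> R) : z \notin U ->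
  \sum_(I : {set T} | I \subset z |: U) G I =
  \sum_(I : {set T} | I \subset U) (G I + G (z |: I)).
Proof.
move=> zU; rewrite (bigID (fun I : {set T} => z \in I))/= addrC big_split/=.
congr (_ + _).
  apply: eq_bigl => I; apply/andP/idP => [[IU zI]|IU].
    apply/subsetP => x xI; move/subsetP: IU => /(_ _ xI); rewrite !inE.
    by case: eqP => // xz; rewrite xz (negbTE zI) in xI.
  split; first by rewrite subsetU// IU orbT.
  by apply: contra zU => /(subsetP IU).
rewrite (reindex_onto (fun I : {set T} => z |: I) (fun I => I :\ z))/=.
  apply: eq_bigl => I; rewrite setU11 andbT; apply/andP/idP => [[IU /eqP zI]|IU].
    rewrite -zI; apply/subsetP => x; rewrite !inE => /andP[xz xI].
    move/subsetP: IU => /(_ x); rewrite !inE xI => /(_ isT).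
    by rewrite (negbTE xz).
  split; first by rewrite setUS.
  by rewrite setU1K//; apply: contra zU => /(subsetP IU).
by move=> I /andP[_ zI]; rewrite setD1K.
Qed.

(** Removing e from I matches the pairs (I, e) with e in I with the pairs
    (J, f) with f outside J; residues will cancel along this matching. *)
Lemma sum_subset_mem U (X : {set T} -> T -> R) :
  \sum_(I : {set T} | I \subset U) \sum_(e in I) X I e =
  \sum_(I : {set T} | I \subset U) \sum_(f in U :\: I) X (f |: I) f.
Proof.
rewrite (exchange_big_dep (mem U))/=; last by move=> I e /subsetP; apply.
rewrite [RHS](exchange_big_dep (mem U))/=; last first.
  by move=> I e _; rewrite inE => /andP[].
apply: eq_bigr => e eU.
rewrite (reindex_onto (fun I : {set T} => e |: I) (fun I => I :\ e))/=; last first.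
  by move=> I /andP[_ eI]; rewrite setD1K.
apply: eq_bigl => I; rewrite setU11 andbT !inE eU andbT.
apply/andP/andP => -[].
  move=> IU /eqP eI; have eI' : e \notin I by rewrite -eI !inE eqxx.
  split=> //; apply: subset_trans IU; exact: subsetUr.
move=> IU eI; rewrite setU1K// eqxx; split=> //.
by rewrite subUset sub1set eU.
Qed.
End SetSums.

Section Strips.
Variables (n M : nat).
Implicit Types (j k N : 'I_n -> nat).

(** The cells of the skew diagram k / j; the bound M makes the type of cells
    finite. *)
Definition strip j k : {set 'I_n * 'I_M} :=
  [set e : 'I_n * 'I_M | (j e.1 <= e.2 < k e.1)%N].

Lemma big_strip (R : Type) (idx : R) (op : Monoid.com_law idx) j k
    (G : 'I_n -> nat -> R) : (forall r, (k r <= M)%N) ->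
  \big[op/idx]_(e in strip j k) G e.1 e.2 =
  \big[op/idx]_(r < n) \big[op/idx]_(j r <= i < k r) G r i.
Proof.
move=> kM; rewrite (eq_bigl (fun e : 'I_n * 'I_M =>
   predT e.1 && (j e.1 <= e.2 < k e.1)%N)); last by move=> e; rewrite inE.
rewrite -(pair_big_dep predT (fun r (i : 'I_M) => (j r <= i < k r)%N)
  (fun r (i : 'I_M) => G r i))/=.
apply: eq_bigr => r _; rewrite (@big_nat_widenl _ _ _ (j r) 0%N)//.
rewrite (big_nat_widen _ _ M)// big_mkord.
by apply: eq_bigl => i /=.
Qed.

Lemma strip_setD j k N : (forall r, (j r <= k r)%N) -> (forall r, (k r <= N r)%N) ->
  strip j N :\: strip j k = strip k N.
Proof.
move=> jk kN; apply/setP => -[r i]; rewrite !inE /=.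
case: (ltnP i (k r)) => ik; case: (leqP (j r) i) => //= ij.
by move: (leq_trans ij (leq_trans (jk r) ik)); rewrite ltnn.
Qed.

(** The least k above j for which I lies below k. *)
Definition heights j (I : {set 'I_n * 'I_M}) r :=
  maxn (j r) (\max_(i < M | (r, i) \in I) i.+1).

Lemma heights_le j (I : {set 'I_n * 'I_M}) r : (j r <= M)%N -> (heights j I r < M.+1)%N.
Proof.
by move=> jM; rewrite ltnS geq_max jM; apply/bigmax_leqP => i _; apply: ltn_ord.
Qed.

Lemma heights_strip j k r : (forall r, (k r <= M)%N) ->
  heights j (strip j k) r = maxn (j r) (k r).
Proof.
move=> kM; rewrite /heights; apply/eqP; rewrite eqn_leq !geq_max leq_maxl /=; apply/andP; split.
  apply/bigmax_leqP => i; rewrite inE /= => /andP[_ ik].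
  by rewrite leq_max ik orbT.
rewrite leq_maxl /=.
have [kj|jk] := leqP (k r) (j r); first by rewrite leq_max kj.
rewrite leq_max; apply/orP; right.
have k0 : (0 < k r)%N by apply: leq_ltn_trans jk.
have ltM : ((k r).-1 < M)%N by rewrite prednK.
rewrite -{1}(prednK k0) (@leq_bigmax_cond _ _ (fun i : 'I_M => i.+1) (Ordinal ltM))//.
by rewrite inE /= -ltnS prednK// jk leqnn.
Qed.

(** A set that is closed under moving left within the rows down to j is
    determined by the right end of each row. *)
Lemma strip_heights j N (I : {set 'I_n * 'I_M}) : I \subset strip j N ->
  (forall r (i i' : 'I_M), i'.+1 = i -> (r, i) \in I ->
     (j r <= i')%N -> (r, i') \in I) ->
  strip j (heights j I) = I.
Proof.
move=> IN clI.
have down r (i i' : 'I_M) : (r, i) \in I -> (j r <= i' <= i)%N -> (r, i') \in I.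
  have [m] := ubnP (i - i')%N; elim: m i i' => // m IH i i' lt iI /andP[ji ii].
  have [<-//|ne] := eqVneq i i'.
  have lt1 : (i'.+1 < M)%N.
    by apply: leq_ltn_trans (ltn_ord i); rewrite ltn_neqAle eq_sym ne.
  have lei : (i' < i)%N by rewrite ltn_neqAle eq_sym ne.
  apply: (clI r (Ordinal lt1)) => //; apply: (IH i) => //=.
    by rewrite -ltnS (leq_trans _ lt)// subnS prednK ?subn_gt0// ltnS.
  by rewrite (leq_trans ji)//= lei.
apply/setP => -[r i]; rewrite inE /=; apply/andP/idP => [[ji]|iI].
  rewrite leq_max ltnNge ji /= => lt.
  suff [i' i'I ii'] : exists2 i' : 'I_M, (r, i') \in I & (i <= i')%N.
    by apply: down i'I _; rewrite ji.
  have [/exists_inP//|/negP h] :=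
    boolP [exists (i' : 'I_M | (r, i') \in I), (i <= i')%N].
  exfalso; move: lt; rewrite ltnNge => /negP; apply.
  apply/bigmax_leqP => i' i'I; rewrite ltnNge; apply/negP => ii'.
  by apply: h; apply/exists_inP; exists i'.
have := subsetP IN _ iI; rewrite inE /= => /andP[-> _]; split=> //.
rewrite leq_max; apply/orP; right.
exact: (@leq_bigmax_cond _ _ (fun i : 'I_M => i.+1)).
Qed.

(** In the application G I has the factor th (q c_f / c_e) for e in I and f
    outside I, which is th 1 = 0 when f is the left neighbour of e; this
    explains the form of the vanishing hypothesis. *)
Lemma sum_strips (R : nmodType) j N (G : {set 'I_n * 'I_M} -> R) :
  (forall r, (j r <= N r)%N) -> (forall r, (N r <= M)%N) ->
  (forall (I : {set 'I_n * 'I_M}) r (i i' : 'I_M), I \subset strip j N ->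
     i'.+1 = i -> (r, i) \in I -> (r, i') \in strip j N :\: I -> G I = 0) ->
  \sum_(I : {set 'I_n * 'I_M} | I \subset strip j N) G I =
  \sum_(k : {ffun 'I_n -> 'I_M.+1} | [forall r, (j r <= k r <= N r)%N])
    G (strip j (fun r => k r)).
Proof.
move=> jN NM G0.
have jM r : (j r <= M)%N by rewrite (leq_trans (jN r)).
pose h (k : {ffun 'I_n -> 'I_M.+1}) := strip j (fun r => k r).
pose h' (I : {set 'I_n * 'I_M}) : {ffun 'I_n -> 'I_M.+1} := [ffun r => Ordinal (heights_le I (jM r))].
have hh' I : h (h' I) = strip j (heights j I).
  by apply/setP => -[r i]; rewrite !inE /= ffunE.
rewrite (bigID (fun I => h (h' I) == I))/= [X in _ + X]big1 ?addr0; last first.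
  move=> I /andP[IN /eqP ne]; have [->//|nz] := eqVneq (G I) 0.
  exfalso; apply: ne; rewrite hh'; apply: (strip_heights IN) => r i i' ii iI ji.
  apply: contraNT nz => i'I; apply/eqP; apply: (G0 I r i i' IN ii iI).
  rewrite !inE i'I /= ji /=; have := subsetP IN _ iI.
  by rewrite inE /= -ii => /andP[_]; apply: leq_trans.
rewrite (reindex_onto h h'); last by move=> I /andP[_ /eqP].
apply: eq_bigl => k.
have kM r : (k r <= M)%N by rewrite -ltnS.
have h'hE r : h' (h k) r = maxn (j r) (k r) :> nat.
  by rewrite ffunE /= heights_strip.
apply/idP/forallP => [/andP[/andP[/subsetP kN _] /eqP hk] r|jkN].
  have jk : (j r <= k r)%N by rewrite -hk h'hE leq_maxl.
  rewrite jk /=; move: jk; rewrite leq_eqVlt => /predU1P[<-//|jk].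
  have k0 : (0 < k r)%N by apply: leq_ltn_trans jk.
  have ltM : ((k r).-1 < M)%N by rewrite prednK.
  have := kN (r, Ordinal ltM); rewrite !inE /= prednK// leqnn -ltnS prednK// jk.
  by move=> /(_ isT).
have hk : h' (h k) = k.
  by apply/ffunP => r; apply/val_inj; rewrite /= h'hE; apply/maxn_idPr;
    case/andP: (jkN r).
rewrite hk !eqxx !andbT; apply/subsetP => -[r i]; rewrite !inE /= => /andP[-> ik].
by have /andP[_] := jkN r; apply: leq_trans.
Qed.

End Strips.

(** * Theta-like functions and their partial fractions *)

(** In [th_addition], Weierstrass' three-term relation, the parameters are
    chosen as products of the usual ones, so that no square root is needed
    to apply it.  [th_quasi] is quasi-periodicity stated without the period p:
    the nonzero zeros of theta (. ; p) are powers of p, and multiplying the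
    argument by one of them multiplies theta by a monomial. *)
Record theta_like (F : fieldType) (th : F -> F) : Prop := ThetaLike {
  thV : forall x, x != 0 -> th x^-1 = - th x / x;
  th_addition : forall c u v A, c != 0 -> u != 0 -> v != 0 -> A != 0 ->
    th (c / u) * th (v / c) * th (u * v / A) * th A =
    th c * th (u * v / c) * th (A / u) * th (v / A)
    + v / A * th (A * c / (u * v)) * th (A / c) * th u * th v;
  th_quasi : forall e, e != 0 -> th e = 0 ->
    exists2 l, l != 0 & exists d : int,
      forall x, x != 0 -> th (e * x) = l * x ^ d * th x }.

Section Theta.
Variables (F : fieldType) (th : F -> F).
Hypothesis H : theta_like th.

Lemma th1 : th 1 = 0.
Proof.
have := th_addition H (oner_neq0 F) (oner_neq0 F) (oner_neq0 F) (oner_neq0 F).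
rewrite !(mul1r, invr1) => /eqP; rewrite -subr_eq subrr eq_sym => /eqP h.
have : th 1 ^+ 4 = 0 by rewrite -h; ring.
by move/eqP; rewrite expf_eq0 => /eqP.
Qed.

Lemma thDV x y : x != 0 -> y != 0 -> th (x / y) = - (x / y) * th (y / x).
Proof.
move=> x0 y0; rewrite -[y / x]invf_div (thV H) ?mulf_neq0 ?invr_eq0//.
by field; rewrite x0 y0.
Qed.

Lemma th_div_eq0C x y : x != 0 -> y != 0 -> (th (x / y) == 0) = (th (y / x) == 0).
Proof.
move=> x0 y0; rewrite thDV// mulf_eq0 oppr_eq0 mulf_eq0 invr_eq0.
by rewrite (negbTE x0) (negbTE y0).
Qed.

Lemma th_ratio_zeros x y : x != 0 -> y != 0 -> th x = 0 -> th y = 0 -> th (y / x) = 0.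
Proof.
move=> x0 y0 tx ty; have [l l0 [d hd]] := th_quasi H x0 tx.
have yx0 : y / x != 0 by rewrite mulf_neq0 ?invr_eq0.
have := hd _ yx0; rewrite mulrC divfK// ty => /esym/eqP.
by rewrite !mulf_eq0 (negbTE l0) expfz_eq0 (negbTE yx0) andbF => /eqP.
Qed.

(** The three-term relation as interpolation in a: the product
    th (a / b0) th (a / b1) is a combination of two products with the same
    product of zeros, one of which vanishes at a0 and the other at a1. *)
Lemma th_interp a a0 a1 b0 b1 : a != 0 -> a0 != 0 -> a1 != 0 -> b0 != 0 ->
    b1 != 0 ->
  b1 * (th (b0 * b1 / (a0 * a1)) * th (a1 / a0)) * (th (a / b0) * th (a / b1)) =
  b0 * b1 / a0 * (th (a1 / b0) * th (b1 / a1))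
    * (th (a / a0) * th (a / (b0 * b1 / a0)))
  + b1 * (th (b0 / a0) * th (b1 / a0))
    * (th (a / a1) * th (a / (b0 * b1 / a1))).
Proof.
move=> n n0 n1 m0 m1.
have nz := (mulf_neq0, invr_eq0, n, n0, n1, m0, m1).
have h1 : a / a0 != 0 by rewrite ?nz.
have h2 : b0 / a0 != 0 by rewrite ?nz.
have h3 : b1 / a0 != 0 by rewrite ?nz.
have h4 : a1 / a0 != 0 by rewrite ?nz.
have := th_addition H h1 h2 h3 h4.
have -> : a / a0 / (b0 / a0) = a / b0 by field; rewrite ?nz.
have -> : b1 / a0 / (a / a0) = b1 / a by field; rewrite ?nz.
have -> : b0 / a0 * (b1 / a0) / (a1 / a0) = b0 * b1 / (a0 * a1).
  by field; rewrite ?nz.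
have -> : b0 / a0 * (b1 / a0) / (a / a0) = (b0 * b1 / a0) / a.
  by field; rewrite ?nz.
have -> : a1 / a0 / (b0 / a0) = a1 / b0 by field; rewrite ?nz.
have -> : b1 / a0 / (a1 / a0) = b1 / a1 by field; rewrite ?nz.
have -> : a1 / a0 * (a / a0) / (b0 / a0 * (b1 / a0)) = a / (b0 * b1 / a1).
  by field; rewrite ?nz.
have -> : a1 / a0 / (a / a0) = a1 / a by field; rewrite ?nz.
rewrite (thDV (x := b1) (y := a))// (thDV (x := a1) (y := a))//.
rewrite (thDV (x := b0 * b1 / a0) (y := a)) ?nz// => /(congr1 ( *%R (- a))) e.
transitivity (- a *
    (th (a / b0) * (- (b1 / a) * th (a / b1)) * th (b0 * b1 / (a0 * a1)) *
    th (a1 / a0))); first by field; rewrite ?nz.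
by rewrite e; field; rewrite ?nz.
Qed.

Section PartialFractions.
Variable T : finType.
Implicit Types (U : {set T}) (a b : T -> F).

Definition pfsum U a b := \sum_(i in U)
  (\prod_(j in U) th (a i / b j)) / \prod_(j in U :\ i) th (a i / a j).

(** A zero of the numerator at a node cancels the pole there. *)
Lemma pfsum_node U a b i0 : i0 \in U -> a i0 != 0 -> b i0 = a i0 ->
    (forall i, i \in U :\ i0 -> th (a i / a i0) != 0) ->
  pfsum U a b = pfsum (U :\ i0) a b.
Proof.
move=> iU n0 bi nd; rewrite /pfsum (big_setD1 i0)//=.
rewrite (big_setD1 i0 iU)/= bi divff// th1 !mul0r add0r.
apply: eq_bigr => i iU0; rewrite (big_setD1 i0 iU)/= bi.
have [ii0 iU'] := setD1P iU0.
have e : U :\ i0 :\ i = U :\ i :\ i0.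
  by apply/setP=> j; rewrite !inE; case: (j == i); case: (j == i0).
rewrite e [in LHS](big_setD1 i0 (A := U :\ i))/=; last by rewrite !inE eq_sym ii0.
by rewrite -mulf_div divff ?nd// mul1r.
Qed.

Definition upd2 b i0 x i1 y := fun j => if j == i0 then x else
  if j == i1 then y else b j : F.

Lemma pfsum_upd2 U a b i0 i1 x y : i0 \in U -> i1 \in U -> i0 != i1 ->
  pfsum U a (upd2 b i0 x i1 y) = \sum_(i in U)
   (th (a i / x) * th (a i / y)) *
   (\prod_(j in U :\ i0 :\ i1) th (a i / b j)) / \prod_(j in U :\ i) th (a i / a j).
Proof.
move=> u0 u1 d; apply: eq_bigr => i _; congr (_ / _).
rewrite (big_setD1 i0 u0)/= (big_setD1 i1)/=; last by rewrite !inE eq_sym d.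
rewrite /upd2 eqxx eqxx eq_sym (negbTE d) mulrA; congr (_ * _).
by apply: eq_bigr => j; rewrite !inE => /and3P[/negbTE-> /negbTE-> _].
Qed.

Lemma pfsum_perm U a b i1 i2 : i1 \in U -> i2 \in U ->
  pfsum U a (fun j => b (tperm i1 i2 j)) = pfsum U a b.
Proof.
move=> u1 u2; apply: eq_bigr => i _; congr (_ / _).
rewrite [RHS](reindex_inj (@perm_inj _ (tperm i1 i2)))/=.
by apply: eq_bigl => j; case: tpermP => [->|->|]; rewrite ?u1 ?u2.
Qed.

(** Partial fractions for a quotient of theta functions whose zeros and poles
    have the same product.  By [th_interp] the sum with zeros b i0, b i1 is a
    combination of the one with a i0, b i0 b i1 / a i0 and the one with a i1,
    b i0 b i1 / a i1 instead.  For each of these [pfsum_node] removes an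
    index, which allows induction on the cardinality of U. *)
Theorem pfsum0 U a b :
  (forall i, i \in U -> a i != 0) -> (forall i, i \in U -> b i != 0) ->
  {in U &, forall i j, i != j -> th (a i / a j) != 0} ->
  \prod_(i in U) a i = \prod_(i in U) b i -> pfsum U a b = 0.
Proof.
have [m] := ubnP #|U|; elim: m U b => // m IH U b.
have [->|[i0 u0]] := set_0Vmem U; first by move=> *; rewrite /pfsum big_set0.
have [U0|[i1]] := set_0Vmem (U :\ i0).
  move=> _ na nb nd; rewrite /pfsum !(big_setD1 i0 u0)/= U0 !big_set0 !mulr1 => e.
  by rewrite addr0 e divff ?nb// th1 mul0r.
rewrite !inE => /andP[d10 u1].
have [U1|[i2]] := set_0Vmem (U :\ i0 :\ i1).
  move=> _ na nb nd.
  have u1' : i1 \in U :\ i0 by rewrite !inE d10.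
  have e1 : U :\ i1 :\ i0 = set0.
    by rewrite -U1; apply/setP=> j; rewrite !inE; case: (j == i0); case: (j == i1).
  have u0' : i0 \in U :\ i1 by rewrite !inE eq_sym d10.
  rewrite !(big_setD1 i0 u0)/= !(big_setD1 i1 u1')/= U1 !big_set0 !mulr1 => e.
  rewrite /pfsum (big_setD1 i0 u0)/= [X in _ + X](big_setD1 i1 u1')/= U1 big_set0 addr0.
  rewrite !(big_setD1 i0 u0)/= !(big_setD1 i1 u1')/= !U1 !big_set0 !mulr1.
  rewrite (big_setD1 i0 u0')/= e1 big_set0 mulr1.
  have ea : a i1 = b i0 * b i1 / a i0 by rewrite -e mulrC mulKf ?na.
  have nz := (mulf_neq0, invr_eq0, oppr_eq0, na _ u0, na _ u1, nb _ u0, nb _ u1).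
  have := nd _ _ u0 u1; rewrite eq_sym d10 => /(_ isT) nt.
  have -> : a i1 / b i0 = b i1 / a i0 by rewrite ea; field; rewrite ?nz.
  have -> : a i1 / b i1 = b i0 / a i0 by rewrite ea; field; rewrite ?nz.
  rewrite (thDV (x := b i1)) ?nz// (thDV (x := b i0)) ?nz//.
  rewrite (thDV (x := a i1)) ?nz//; move: nt; set t := th (a i0 / a i1) => nt.
  by rewrite ea; field; rewrite ?nz ?nt.
rewrite !inE => /and3P[d21 d20 u2] lt na nb nd eab.
(* The coefficient th (b i0 b i1 / (a i0 a i1)) by which [th_interp] divides
   may vanish, but not together with the one for i2, because
   th (a i1 / a i2) <> 0. *)
wlog ndK : b nb eab / th (b i0 * b i1 / (a i0 * a i1)) != 0 \/
     th (b i0 * b i1 / (a i0 * a i2)) != 0.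
  apply=> //; apply/orP; rewrite -negb_and; apply/negP => /andP[/eqP h1 /eqP h2].
  have nz := (mulf_neq0, invr_eq0, na _ u0, na _ u1, na _ u2, nb _ u0, nb _ u1).
  have : th (b i0 * b i1 / (a i0 * a i2) / (b i0 * b i1 / (a i0 * a i1))) = 0.
    by apply: th_ratio_zeros; rewrite ?nz.
  have -> : b i0 * b i1 / (a i0 * a i2) / (b i0 * b i1 / (a i0 * a i1)) = a i1 / a i2.
    by field; rewrite ?nz.
  by apply/eqP; rewrite nd// eq_sym.
(* Exchanging the zeros attached to i1 and i2 leaves the sum unchanged. *)
wlog ndK1 : b i1 i2 u1 u2 d10 d21 d20 nb eab ndK /
    th (b i0 * b i1 / (a i0 * a i1)) != 0.
  move=> wl; case: ndK => ndK; first exact: (wl b i1 i2) (or_introl ndK) ndK.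
  rewrite -(pfsum_perm a b u1 u2); apply: (wl _ i2 i1) => //.
  - by rewrite eq_sym.
  - by move=> i iU; case: tpermP => [_|_|_ _]; rewrite nb.
  - rewrite eab [LHS](reindex_inj (@perm_inj _ (tperm i1 i2)))/=.
    by apply: eq_bigl => j; case: tpermP => [->|->|]; rewrite ?u1 ?u2.
  - by left; rewrite tpermD// tpermR.
  - by rewrite tpermD// tpermR.
set k := b i0 * b i1.
have b01 : pfsum U a b = pfsum U a (upd2 b i0 (b i0) i1 (b i1)).
  apply: eq_bigr => i _; congr (_ / _); apply: eq_bigr => j _; rewrite /upd2.
  by case: eqP => [->//|_]; case: eqP => [->//|_].
have d01 : i0 != i1 by rewrite eq_sym.
have n0 := na _ u0; have n1 := na _ u1.
have m0 := nb _ u0; have m1 := nb _ u1.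
have k0 : k != 0 by rewrite mulf_neq0.
have Bprod i x : i \in U -> (i == i0) || (i == i1) -> x * a i = k ->
   \prod_(j in U) upd2 b i0 (if i == i0 then a i else x) i1
      (if i == i0 then x else a i) j = \prod_(j in U) a j.
  move=> iU ii xk; rewrite eab.
  have u1' : i1 \in U :\ i0 by rewrite !inE d10.
  rewrite !(big_setD1 i0 u0)/= !(big_setD1 i1 u1')/=.
  rewrite [upd2 _ _ _ _ _ i0]/upd2 eqxx [upd2 _ _ _ _ _ i1]/upd2 (negbTE d10) eqxx.
  rewrite !mulrA; congr (_ * _).
    by rewrite -/k -xk; case: ifP; rewrite // mulrC.
  by apply: eq_bigr => j; rewrite !inE /upd2 => /and3P[/negbTE-> /negbTE-> _].
(* The two sums with a zero at the node a i reduce to U minus i. *)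
have red i : i \in U -> (i == i0) || (i == i1) ->
    pfsum U a (upd2 b i0 (if i == i0 then a i else k / a i) i1
      (if i == i0 then k / a i else a i)) = 0.
  move=> iU ii; have ni := na _ iU.
  have bi : upd2 b i0 (if i == i0 then a i else k / a i) i1
      (if i == i0 then k / a i else a i) i = a i.
    by rewrite /upd2; case: (i == i0) ii => //= ->.
  rewrite (@pfsum_node _ _ _ i)//; last first.
    by move=> j; rewrite !inE => /andP[ji jU]; rewrite nd.
  apply: IH => [||j|j1 j2|].
  - by move: lt; rewrite (cardsD1 i U) iU.
  - by move=> j; rewrite !inE => /andP[_ jU]; apply: na.
  - rewrite !inE /upd2 => /andP[_ jU]; case: ifP => _.
      by case: ifP; rewrite ?mulf_neq0 ?invr_eq0.
    by case: ifP => _; [case: ifP; rewrite ?mulf_neq0 ?invr_eq0|exact: nb].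
  - by rewrite !inE => /andP[_ h1] /andP[_ h2]; apply: nd.
  - have := Bprod i (k / a i) iU ii; rewrite divfK// => /(_ erefl).
    by rewrite !(big_setD1 i iU)/= bi => /(mulfI ni).
have W0 : b i1 * (th (k / (a i0 * a i1)) * th (a i1 / a i0)) != 0.
  by rewrite !mulf_neq0// nd.
apply: (mulfI W0); rewrite mulr0 b01 pfsum_upd2// mulr_sumr.
have := red i0 u0; rewrite eqxx => /(_ isT) r0.
have := red i1 u1; rewrite eqxx orbT (negbTE d10) => /(_ isT) r1.
move: r0 r1; rewrite !pfsum_upd2// => r0 r1.
have {r0 r1} := congr2 (fun s t => k / a i0 * (th (a i1 / b i0) * th (b i1 / a i1)) * s
   + b i1 * (th (b i0 / a i0) * th (b i1 / a i0)) * t) r0 r1.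
rewrite !mulr0 addr0 => r01; apply: etrans _ r01.
rewrite !mulr_sumr -big_split /=; apply: eq_bigr => i iU /=.
rewrite -[X in _ * X = _]mulrA [LHS]mulrA (th_interp (na _ iU) n0 n1 m0 m1) -/k.
by rewrite (mulrC (th (a i / (k / a i1)))) mulrDl -!mulrA.
Qed.

End PartialFractions.

(** * Lagrange interpolation at two nodes *)

Section Lagrange.
Variable T : finType.

(** The quotient Q has poles at the c e; its value at z is expressed by its
    value at y and its residues.  This is [pfsum0] for the nodes z, y and all
    c e, with the zeros l, all b e, and one more that balances the product. *)
Lemma lagrange_two_nodes (I : {set T}) (c b : T -> F) (z y l k : F) :
  {in I, forall e, c e != 0} -> {in I, forall e, b e != 0} ->
  z != 0 -> y != 0 -> l != 0 -> k = l * \prod_(e in I) b e / \prod_(e in I) c e ->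
  {in I &, forall e f, e != f -> th (c e / c f) != 0} ->
  {in I, forall e, th (z / c e) != 0} -> {in I, forall e, th (c e / y) != 0} ->
  th (z / y) != 0 ->
  let Q x := (\prod_(e in I) (th (x / b e) / th (x / c e))) * th (l / x) in
  th (k / y) * Q z = th (k / z) * Q y + th (z / y) * \sum_(e in I)
    (\prod_(f in I) th (c e / b f)) / (\prod_(f in I :\ e) th (c e / c f))
    * th (l / c e) * th (k * c e / (z * y)) / (th (z / c e) * th (c e / y)).
Proof.
move=> nc nb nz ny nl ek ndc ndz ndy ndzy Q.
have pc : \prod_(e in I) c e != 0 by apply/prodf_neq0 => e /nc.
have pb : \prod_(e in I) b e != 0 by apply/prodf_neq0 => e /nb.
have nk : k != 0 by rewrite ek !mulf_neq0 ?invr_eq0.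
(* None indexes the node z, Some None the node y; the zero z * y / k attached
   to the latter is the one that balances the product. *)
pose a' (o : option (option T)) :=
  if o is Some o' then if o' is Some e then c e else y else z.
pose b' (o : option (option T)) :=
  if o is Some o' then if o' is Some e then b e else z * y / k else l.
pose S (J : {set T}) : {set option (option T)} := [set Some (Some e) | e in J].
have inS J e : (Some (Some e) \in S J) = (e \in J).
  by apply/imsetP/idP => [[f fJ [->]]//|eJ]; exists e.
have NS J : None \notin S J by apply/imsetP => -[].
have NS1 J : Some None \notin S J by apply/imsetP => -[].
have NS2 J : None \notin Some None |: S J by rewrite !inE negb_or NS.
have SI (R : Type) (x : R) (op : Monoid.com_law x) J G :
    \big[op/x]_(j in S J) G j = \big[op/x]_(e in J) G (Some (Some e)).
  by rewrite big_imset//= => e f _ _ [].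
pose U := None |: (Some None |: S I).
have U0 : U :\ None = Some None |: S I by rewrite setU1K.
have U1 : U :\ Some None = None |: S I.
  apply/setP => -[[e|]|]; rewrite !inE //=.
  by rewrite (negbTE (NS1 _)).
have U2 e : U :\ Some (Some e) = None |: (Some None |: S (I :\ e)).
  by apply/setP => -[[f|]|]; rewrite !inE //= !inS !inE.
have PU0 (G : option (option T) -> F) : \prod_(j in Some None |: S I) G j =
    G (Some None) * \prod_(e in I) G (Some (Some e)) by rewrite big_setU1//= SI.
have PU1 J (G : option (option T) -> F) : \prod_(j in None |: S J) G j =
    G None * \prod_(e in J) G (Some (Some e)) by rewrite big_setU1//= SI.
have PU J (G : option (option T) -> F) : \prod_(j in None |: (Some None |: S J)) G j =
    G None * (G (Some None) * \prod_(e in J) G (Some (Some e))).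
  by rewrite ?/U !big_setU1//= SI.
have SU (G : option (option T) -> F) : \sum_(j in U) G j =
    G None + (G (Some None) + \sum_(e in I) G (Some (Some e))).
  by rewrite ?/U !big_setU1//= SI.
have h1 i : i \in U -> a' i != 0.
  by case: i => [[e|]|]; rewrite ?inE ?inS //= => /nc.
have h2 i : i \in U -> b' i != 0.
  case: i => [[e|]|]; rewrite ?inE ?inS //=; first exact: nb.
  move=> _.
  by rewrite !mulf_neq0 ?invr_eq0.
have h3 : {in U &, forall i j, i != j -> th (a' i / a' j) != 0}.
  move=> [[e|]|] [[f|]|]; rewrite ?inE ?inS //= => eI fI ef.
  - exact: ndc.
  - exact: ndy.
  - by rewrite th_div_eq0C ?nc// ndz.
  - by rewrite th_div_eq0C ?nc// ndy.
  - by rewrite th_div_eq0C.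
  - exact: ndz.
have := pfsum0 h1 h2 h3.
rewrite /pfsum SU U0 U1 !PU PU0 PU1 /=.
under [\sum_(e in I) _]eq_bigr do rewrite U2 !PU /=.
have -> : z / (z * y / k) = k / y by field; rewrite nz ny nk.
have -> : y / (z * y / k) = k / z by field; rewrite nz ny nk.
have -> : l * (z * y / k * \prod_(e in I) b e) = z * (y * \prod_(e in I) c e).
  by rewrite ek; field; rewrite pc pb nl.
move/(_ erefl).
rewrite (thDV (x := z) (y := l))// (thDV (x := y) (y := l))//.
rewrite (thDV (x := y) (y := z))//.
set D := \sum_(e in I) _; set E := \sum_(e in I) _.
have -> : D = z / l * E.
  rewrite /D /E mulr_sumr; apply: eq_bigr => e eI.
  rewrite (thDV (x := c e) (y := l)) ?nc// (thDV (x := c e) (y := z)) ?nc//.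
  have -> : c e / (z * y / k) = k * c e / (z * y).
    by field; rewrite ?nz ?ny ?nk.
  have pd : \prod_(f in I :\ e) th (c e / c f) != 0.
    apply/prodf_neq0 => f; rewrite !inE => /andP[fe fI].
    by apply: ndc => //; rewrite eq_sym.
  by field; rewrite ?oppr_eq0 ?nl ?nz ?ny ?nk ?(nc e eI) ?(ndz e eI) ?(ndy e eI) ?pd.
rewrite /Q !prodf_div.
have pz : \prod_(e in I) th (z / c e) != 0 by apply/prodf_neq0 => e /ndz.
have py : \prod_(e in I) th (y / c e) != 0.
  by apply/prodf_neq0 => e eI; rewrite th_div_eq0C ?nc ?ndy.
move=> e0; apply/eqP; rewrite -subr_eq0; apply/eqP.
rewrite -[RHS](mulr0 (- (l / z) * th (z / y))) -e0.
by field; rewrite ?oppr_eq0 ?nl ?nz ?ny ?nk ?ndzy ?pz ?py.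
Qed.
End Lagrange.

(** * The multivariable Jackson sum over subsets *)

Variable q : F.
Hypothesis nq : q != 0.

(** The shifted factorial with base q. *)
Definition tfact x n := \prod_(i < n) th (x * q ^+ i).

Lemma tfactSr x n : tfact x n.+1 = tfact x n * th (x * q ^+ n).
Proof. exact: big_ord_recr. Qed.

Lemma tfactS x n : tfact x n.+1 = th x * tfact (x * q) n.
Proof.
rewrite /tfact big_ord_recl mulr1; congr (_ * _).
by apply: eq_bigr => i _; rewrite /= exprS mulrA.
Qed.

(** The very-well-poised factor of the Jackson sum, which depends on a subset
    only through its cardinality k. *)
Definition weight n k u v A :=
  th (A * q ^+ (2 * k)) / tfact (A * q ^+ k) n.+1 * tfact u k * tfact v k
  * tfact (A * q ^+ k.+1 / u) (n - k) * tfact (v / (A * q ^+ n)) (n - k)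
  * (v / (A * q ^+ n)) ^+ k.

Lemma weightSl m k u v A : (k <= m)%N -> A != 0 -> u != 0 ->
  th (A * q ^+ (m.+1 + k)) != 0 ->
  weight m.+1 k u v A * th (A * q ^+ (m.+1 + k)) * q ^+ k =
  weight m k u v A * (th (A * q ^+ m.+1 / u) * th (v / (A * q ^+ m.+1))).
Proof.
move=> km nA nu nt; rewrite /weight subSn// [tfact _ m.+2]tfactSr.
rewrite [tfact (_ / u) _]tfactSr [tfact (v / _) (m - k).+1]tfactS.
have -> : A * q ^+ k.+1 / u * q ^+ (m - k) = A * q ^+ m.+1 / u.
  by rewrite -(subnK km) -addnS exprD addnK; field.
have -> : v / (A * q ^+ m.+1) * q = v / (A * q ^+ m).
  by rewrite exprSr; field; rewrite nA nq expf_neq0.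
rewrite -[A * q ^+ k * q ^+ m.+1]mulrA -exprD (addnC k).
have -> : (v / (A * q ^+ m)) ^+ k = (v / (A * q ^+ m.+1)) ^+ k * q ^+ k.
  by rewrite -exprMn exprSr; congr (_ ^+ _); field; rewrite nA nq expf_neq0.
have [->|nz] := eqVneq (tfact (A * q ^+ k) m.+1) 0.
  by rewrite !(mul0r, invr0, mulr0).
by field; rewrite nz nt.
Qed.

Lemma weightSS m k u v A : (k <= m)%N -> A != 0 -> u != 0 ->
  th (A * q ^+ k.+1) != 0 ->
  weight m.+1 k.+1 u v A * th (A * q ^+ k.+1) =
  weight m k (u * q) (v * q) (A * q ^+ 2)
  * (th u * th v * (v / (A * q ^+ m.+1))).
Proof.
move=> km nA nu nt; rewrite /weight subSS [tfact _ m.+2]tfactS.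
rewrite [tfact u _]tfactS [tfact v _]tfactS.
have -> : A * q ^+ 2 * q ^+ (2 * k) = A * q ^+ (2 * k.+1).
  by rewrite -mulrA -exprD mulnS.
have -> : A * q ^+ 2 * q ^+ k = A * q ^+ k.+1 * q.
  by rewrite !exprS; ring.
have -> : A * q ^+ 2 * q ^+ k.+1 / (u * q) = A * q ^+ k.+2 / u.
  by rewrite !exprS; field; rewrite nu nq.
have -> : v * q / (A * q ^+ 2 * q ^+ m) = v / (A * q ^+ m.+1).
  by rewrite !exprS; field; rewrite nA nq expf_neq0.
have [->|nz] := eqVneq (tfact (A * q ^+ k.+1 * q) m.+1) 0.
  by rewrite !(mul0r, invr0, mulr0).
by set g := v / _; rewrite (exprS g); field; rewrite nz nt.
Qed.

Section SubsetExpansion.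
Variable T : finType.
Implicit Types (U I J : {set T}) (c : T -> F).

Definition cross c I J :=
  \prod_(e in I) \prod_(f in J) (th (q * c f / c e) / th (c f / c e)).

(** The factors that depend on the variables c.  In use, k and A are already
    multiplied by q ^+ #|I|. *)
Definition subset_term c (d k A : F) I J :=
  cross c I J
  * \prod_(e in I) (th (d * c e) * th (A / c e))
  * \prod_(f in J) (th (c f) * th (k / c f)).

(** Interpolation of the terms whose subset I misses the singled out element:
    as functions of its variable z they have poles at the c e with e in I,
    and the node is 1/d. *)
Lemma lagrange_in I c (z k d : F) : {in I, forall e, c e != 0} ->
  z != 0 -> k != 0 -> d != 0 ->
  {in I &, forall e f, e != f -> th (c e / c f) != 0} ->
  {in I, forall e, th (c e / z) != 0} -> {in I, forall e, th (d * c e) != 0} ->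
  th (d * z) != 0 ->
  let Q x := \prod_(e in I) (th (q * x / c e) / th (x / c e)) in
  th (k * d) * Q z * th (k * q ^+ #|I| / z) =
  th (k / z) * Q d^-1 * th (k * d * q ^+ #|I|)
  + th (d * z) * th q * \sum_(e in I)
    (\prod_(f in I :\ e) (th (q * c e / c f) / th (c e / c f)))
    * th (k * q ^+ #|I| / c e) * th (k * d * c e / z)
    / (th (z / c e) * th (d * c e)).
Proof.
move=> nc nz nk nd ndc ndz ndd ndt Q.
have nqI : q ^+ #|I| != 0 by rewrite expf_neq0.
have ncI : \prod_(e in I) c e != 0 by apply/prodf_neq0 => e /nc.
have nb : {in I, forall e, c e / q != 0}.
  by move=> e eI; rewrite mulf_neq0 ?invr_eq0 ?nc.
have nd' : d^-1 != 0 by rewrite invr_eq0.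
have nl : k * q ^+ #|I| != 0 by rewrite mulf_neq0.
have ek : k = k * q ^+ #|I| * \prod_(e in I) (c e / q) / \prod_(e in I) c e.
  rewrite big_split prodr_const /= exprVn.
  by field; rewrite ncI nqI.
have ndz' : {in I, forall e, th (z / c e) != 0}.
  by move=> e eI; rewrite th_div_eq0C ?nc ?ndz.
have ndd' : {in I, forall e, th (c e / d^-1) != 0}.
  by move=> e eI; rewrite invrK mulrC ndd.
have ndt' : th (z / d^-1) != 0 by rewrite invrK mulrC.
have := lagrange_two_nodes nc nb nz nd' nl ek ndc ndz' ndd' ndt'.
have E x : \prod_(e in I) (th (x / (c e / q)) / th (x / c e)) = Q x.
  by apply: eq_bigr => e eI; rewrite invf_div mulrA (mulrC _ q).
rewrite /= !E !invrK (mulrC z d) mulrA => ->.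
rewrite (mulrAC k) -!mulrA; congr (_ * (_ * _) + _ * _).
rewrite mulr_sumr; apply: eq_bigr => e eI.
rewrite (big_setD1 e eI)/= invf_div prodf_div.
have -> : c e * (q / c e) = q by field; rewrite nc.
have -> : \prod_(f in I :\ e) th (c e / (c f / q)) =
    \prod_(f in I :\ e) th (q * c e / c f).
  by apply: eq_bigr => f _; rewrite invf_div mulrA (mulrC _ q).
have -> : k * c e / (z * d^-1) = k * d * c e / z by field; rewrite nz nd.
by rewrite (mulrC (c e) d) !mulrA.
Qed.

(** Interpolation of the terms whose subset contains the singled out element:
    here J is the complement, which carries the poles, and the node is 1. *)
Lemma lagrange_out J c (z L K : F) : {in J, forall e, c e != 0} ->
  z != 0 -> L != 0 -> K = L * q ^+ #|J| ->
  {in J &, forall e f, e != f -> th (c e / c f) != 0} ->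
  {in J, forall e, th (c e / z) != 0} -> {in J, forall e, th (c e) != 0} ->
  th z != 0 ->
  let Q x := \prod_(f in J) (th (q * c f / x) / th (c f / x)) in
  th K * Q z * th (L / z) =
  th (K / z) * Q 1 * th L
  - th z * th q * \sum_(f in J)
    (\prod_(g in J :\ f) (th (q * c g / c f) / th (c g / c f)))
    * th (L / c f) * th (K * c f / z) / (th (z / c f) * th (c f)).
Proof.
move=> nc nz nL eK ndc ndz nd1 ndt Q.
have nqJ : q ^+ #|J| != 0 by rewrite expf_neq0.
have ncJ : \prod_(e in J) c e != 0 by apply/prodf_neq0 => e /nc.
have nb : {in J, forall e, q * c e != 0} by move=> e eJ; rewrite mulf_neq0 ?nc.
have ek : K = L * \prod_(e in J) (q * c e) / \prod_(e in J) c e.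
  by rewrite big_split prodr_const /= eK; field.
have ndz' : {in J, forall e, th (z / c e) != 0}.
  by move=> e eJ; rewrite th_div_eq0C ?nc ?ndz.
have nd1' : {in J, forall e, th (c e / 1) != 0}.
  by move=> e eJ; rewrite divr1 nd1.
have ndt' : th (z / 1) != 0 by rewrite divr1.
have := lagrange_two_nodes nc nb nz (oner_neq0 F) nL ek ndc ndz' nd1' ndt'.
(* In Q the variable stands in the denominators; inversion brings it to the
   form required by [lagrange_two_nodes]. *)
have R a x : a != 0 -> x != 0 ->
    th (q * a / x) / th (a / x) = q * (th (x / (q * a)) / th (x / a)).
  move=> na nx; rewrite (thDV (x := q * a)) ?mulf_neq0//.
  rewrite (thDV (x := a) (y := x))//.
  have [->|nt] := eqVneq (th (x / a)) 0; first by rewrite !(mulr0, invr0).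
  by field; rewrite ?oppr_eq0 nt nx na.
have E x : x != 0 ->
    Q x = q ^+ #|J| * \prod_(e in J) (th (x / (q * c e)) / th (x / c e)).
  move=> nx; rewrite -prodr_const -big_split; apply: eq_bigr => e eJ.
  by rewrite R ?nc.
rewrite /= !E ?oner_neq0// !divr1 => e0.
rewrite (mulrCA (th K)) -!mulrA e0 mulrDr; congr (_ + _); first by ring.
rewrite mulrCA -mulrN; congr (_ * _).
rewrite -mulNr !mulr_sumr; apply: eq_bigr => e eJ; rewrite mulr1 divr1.
have -> : \prod_(g in J :\ e) (th (q * c g / c e) / th (c g / c e)) =
  q ^+ #|J :\ e| *
   \prod_(g in J :\ e) (th (c e / (q * c g)) / th (c e / c g)).
  rewrite -prodr_const -big_split; apply: eq_bigr => f.
  by rewrite !inE => /andP[_ fJ]; rewrite R ?nc.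
rewrite (big_setD1 e eJ)/= prodf_div (cardsD1 e J) eJ exprS.
have -> : c e / (q * c e) = 1 / q by field; rewrite nq nc.
rewrite (thDV (x := 1) (y := q)) ?oner_neq0// divr1 ?mulr1.
set P := \prod_(_ in _) _; set P' := \prod_(_ in _) _.
have nP' : P' != 0.
  apply/prodf_neq0 => f; rewrite !inE => /andP[fe fJ].
  by rewrite ndc// eq_sym.
by field; rewrite nP' nq ndz' ?nd1.
Qed.

Definition expansion_term U c u v A I :=
  subset_term c (A * q ^+ #|U| / (u * v)) (u * v * q ^+ #|I|) (A * q ^+ #|I|)
    I (U :\: I)
  * weight #|U| #|I| u v A.

Definition expansion U c u v A :=
  \prod_(e in U) (th (c e / u) * th (v / c e))
    * tfact (u * v / (A * q ^+ #|U|)) #|U| =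
  \sum_(I : {set T} | I \subset U) expansion_term U c u v A I.

(** These conditions pass to subsets of U and are stable under multiplication
    of c by q, as the induction requires. *)
Definition separated U c :=
  [/\ {in U, forall e, c e != 0},
      {in U &, forall e f, e != f -> th (c e / c f) != 0} &
      {in U, forall e i, th (c e * q ^+ i) != 0}].

Section Step.
Variables (U : {set T}) (c : T -> F) (u v A : F).
Hypotheses (nu : u != 0) (nv : v != 0) (nA : A != 0).
Hypothesis (ndA : forall i, th (A * q ^+ i) != 0).
Let d := A * q ^+ #|U|.+1 / (u * v).

Let nqX i : q ^+ i != 0. Proof. by rewrite expf_neq0. Qed.
Let nd : d != 0. Proof. by rewrite !mulf_neq0 ?invr_eq0 ?mulf_neq0. Qed.

(** At c z = 1/d the terms with z in I vanish; the others add up to the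
    expansion for U with unchanged parameters, since only the weights and the
    factors th (d * c e) depend on the cardinality of the set. *)
Lemma node_inv : {in U, forall e, c e != 0} ->
  {in U, forall e, th (d * c e) != 0} ->
  expansion U c u v A ->
  \sum_(I : {set T} | I \subset U)
    subset_term c d (u * v * q ^+ #|I|) (A * q ^+ #|I|) I (U :\: I)
    * \prod_(e in I) (th (q * d^-1 / c e) / th (d^-1 / c e))
    * th (u * v * d * q ^+ #|I|) * weight #|U|.+1 #|I| u v A =
  \prod_(e in U) (th (c e / u) * th (v / c e)) * tfact (q / d) #|U|
  * (th (A * q ^+ #|U|.+1 / u) * th (v / (A * q ^+ #|U|.+1))).
Proof.
move=> nc ndc ex.
have qd : q / d = u * v / (A * q ^+ #|U|).
  by rewrite /d exprSr; field; rewrite nA nu nv nq nqX.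
rewrite [in RHS]qd ex mulr_suml; apply: eq_bigr => I IU; rewrite /expansion_term.
have -> : u * v * d * q ^+ #|I| = A * q ^+ (#|U|.+1 + #|I|).
  by rewrite /d exprD; field; rewrite nu nv.
rewrite -[RHS]mulrA -weightSl ?subset_leq_card// /subset_term.
set P1 := \prod_(e in I) _; set P2 := \prod_(e in I) _.
set P3 := \prod_(e in I) _; set G := \prod_(f in _) _.
suff E : P1 * P2 = P3 * q ^+ #|I|.
  by rewrite (mulrAC _ G) -(mulrA _ P1) E; ring.
rewrite -prodr_const -!big_split; apply: eq_bigr => e eI /=.
have eU := subsetP IU _ eI; have nce := nc _ eU; have ndce := ndc _ eU.
have -> : q / d / c e = q / (d * c e) by field; rewrite nd nce.
have -> : d^-1 / c e = (d * c e)^-1 by field; rewrite nd nce.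
have ndce' : d * c e != 0 by rewrite mulf_neq0.
rewrite (thDV (x := q))// (thV H)//.
have -> : A * q ^+ #|U| / (u * v) * c e = d * c e / q.
  by rewrite /d exprSr; field; rewrite nu nv nq.
by field; rewrite ?oppr_eq0 ?nd ?nce ?nq ?ndce.
Qed.

(** At c z = 1 the terms with z outside I vanish; absorbing the factors of z
    multiplies c, u, v by q and A by q ^+ 2. *)
Lemma node_one : {in U, forall e, c e != 0} ->
  expansion U (fun e => q * c e) (u * q) (v * q) (A * q ^+ 2) ->
  {in U, forall e, th (c e) != 0} ->
  \sum_(I : {set T} | I \subset U)
    subset_term c d (u * v * q ^+ #|I|.+1) (A * q ^+ #|I|.+1) I (U :\: I)
    * \prod_(f in U :\: I) (th (q * c f / 1) / th (c f / 1))
    * th (A * q ^+ #|I|.+1) * weight #|U|.+1 #|I|.+1 u v A =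
  \prod_(e in U) (th (c e / u) * th (v / c e)) * tfact (q / d) #|U|
  * (th u * th v * (v / (A * q ^+ #|U|.+1))).
Proof.
move=> nc ex nc1.
have -> : \prod_(e in U) (th (c e / u) * th (v / c e)) =
    \prod_(e in U) (th (q * c e / (u * q)) * th (v * q / (q * c e))).
  apply: eq_bigr => e _; congr (th _ * th _); first by field; rewrite nu nq.
  by rewrite invfM mulrA mulfK.
have -> : q / d = u * q * (v * q) / (A * q ^+ 2 * q ^+ #|U|).
  by rewrite /d exprSr expr2; field; rewrite nA nu nv nq nqX.
rewrite ex mulr_suml; apply: eq_bigr => I IU; rewrite /expansion_term.
rewrite -[LHS]mulrA [th _ * weight _ _ _ _ _]mulrC.
rewrite weightSS ?subset_leq_card// mulrA; congr (_ * _); congr (_ * _).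
rewrite /subset_term -mulrA -[X in _ * X = _]big_split; congr (_ * _ * _).
- apply: eq_bigr => e _; apply: eq_bigr => f _.
  have E x y : q * x / (q * y) = x / y by rewrite -mulf_div divff ?mul1r.
  by rewrite !E.
- apply: eq_bigr => e eI; have nce := nc _ (subsetP IU _ eI).
  congr (th _ * th _).
    by rewrite /d exprSr expr2; field; rewrite nu nv nq.
  by rewrite !exprS; field; rewrite nq nce.
- apply: eq_bigr => f /setDP[fU _] /=; rewrite !divr1.
  rewrite mulrC mulrA divfK ?nc1//; congr (_ * th _).
  by rewrite exprS; field; rewrite nq nc.
Qed.

Variable z : T.
Hypothesis zU : z \notin U.
Let cardU : #|z |: U| = #|U|.+1. Proof. by rewrite cardsU1 zU. Qed.

Lemma crossUl I J : z \notin I ->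
  cross c (z |: I) J =
    \prod_(f in J) (th (q * c f / c z) / th (c f / c z)) * cross c I J.
Proof. by move=> zI; rewrite /cross big_setU1. Qed.

Lemma crossUr I J : z \notin J ->
  cross c I (z |: J) =
    \prod_(e in I) (th (q * c z / c e) / th (c z / c e)) * cross c I J.
Proof.
move=> zJ; rewrite /cross -big_split; apply: eq_bigr => e _.
by rewrite big_setU1.
Qed.

Lemma expansion_term_out I : I \subset U ->
  expansion_term (z |: U) c u v A I =
  subset_term c d (u * v * q ^+ #|I|) (A * q ^+ #|I|) I (U :\: I)
  * \prod_(e in I) (th (q * c z / c e) / th (c z / c e))
  * (th (c z) * th (u * v * q ^+ #|I| / c z)) * weight #|U|.+1 #|I| u v A.
Proof.
move=> IU; rewrite /expansion_term cardU -/d; congr (_ * _).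
have zI : z \notin I by apply: contra zU => /(subsetP IU).
have zJ : z \notin U :\: I by rewrite inE negb_and zU orbT.
have -> : (z |: U) :\: I = z |: (U :\: I).
  by apply/setP => x; rewrite !inE; case: eqP => // ->; rewrite (negbTE zI).
by rewrite /subset_term crossUr// big_setU1//=; ring.
Qed.

Lemma expansion_term_in I : I \subset U ->
  expansion_term (z |: U) c u v A (z |: I) =
  subset_term c d (u * v * q ^+ #|I|.+1) (A * q ^+ #|I|.+1) I (U :\: I)
  * \prod_(f in U :\: I) (th (q * c f / c z) / th (c f / c z))
  * (th (d * c z) * th (A * q ^+ #|I|.+1 / c z)) * weight #|U|.+1 #|I|.+1 u v A.
Proof.
move=> IU; rewrite /expansion_term cardU -/d.
have zI : z \notin I by apply: contra zU => /(subsetP IU).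
rewrite (cardsU1 z I) zI; congr (_ * _).
have -> : (z |: U) :\: (z |: I) = U :\: I.
  by apply/setP => x; rewrite !inE; case: eqP => // ->; rewrite (negbTE zU) andbF.
by rewrite /subset_term crossUl// big_setU1//=; ring.
Qed.

(** The interpolation of the term of I, where z is not in I, contributes this
    at the pole c z = c e, for e in I. *)
Definition residue_in I e :=
  subset_term c d (u * v * q ^+ #|I|) (A * q ^+ #|I|) I (U :\: I)
  * weight #|U|.+1 #|I| u v A
  * (th (c z) * th (d * c z) * th q)
  * ((\prod_(f in I :\ e) (th (q * c e / c f) / th (c e / c f)))
    * th (u * v * q ^+ #|I| / c e) * th (u * v * d * c e / c z)
    / (th (c z / c e) * th (d * c e))).

(** The interpolation of the term of z |: I contributes the opposite of this
    at the pole c z = c f, for f outside z |: I. *)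
Definition residue_out I f :=
  subset_term c d (u * v * q ^+ #|I|.+1) (A * q ^+ #|I|.+1) I (U :\: I)
  * weight #|U|.+1 #|I|.+1 u v A
  * (th (c z) * th (d * c z) * th q)
  * ((\prod_(g in U :\: I :\ f) (th (q * c g / c f) / th (c g / c f)))
    * th (A * q ^+ #|I|.+1 / c f) * th (u * v * d * c f / c z)
    / (th (c z / c f) * th (c f))).

Lemma residue_cancel I f : I \subset U -> f \in U :\: I ->
  th (d * c f) != 0 -> th (c f) != 0 -> th (c z / c f) != 0 ->
  residue_in (f |: I) f = residue_out I f.
Proof.
move=> IU fJ ndf ncf nzf; have [fU fI] := setDP fJ.
have cI : #|f |: I| = #|I|.+1 by rewrite cardsU1 fI.
have eJ : U :\: (f |: I) = U :\: I :\ f.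
  by apply/setP => x; rewrite !inE; case: eqP; rewrite ?andbF//= andbT.
rewrite /residue_in /residue_out cI eJ setU1K//.
have fJ' : f \notin U :\: I :\ f by rewrite !inE eqxx.
have -> : subset_term c d (u * v * q ^+ #|I|.+1) (A * q ^+ #|I|.+1) (f |: I)
    (U :\: I :\ f) =
  subset_term c d (u * v * q ^+ #|I|.+1) (A * q ^+ #|I|.+1) I (U :\: I :\ f)
  * \prod_(g in U :\: I :\ f) (th (q * c g / c f) / th (c g / c f))
  * (th (d * c f) * th (A * q ^+ #|I|.+1 / c f)).
  by rewrite /subset_term /cross !big_setU1//=; ring.
have -> : subset_term c d (u * v * q ^+ #|I|.+1) (A * q ^+ #|I|.+1) I (U :\: I) =
  subset_term c d (u * v * q ^+ #|I|.+1) (A * q ^+ #|I|.+1) I (U :\: I :\ f)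
  * \prod_(e in I) (th (q * c f / c e) / th (c f / c e))
  * (th (c f) * th (u * v * q ^+ #|I|.+1 / c f)).
  rewrite -{1}(setD1K fJ) /subset_term /cross.
  rewrite [X in _ * X = _]big_setU1//=.
  have -> : \prod_(e in I) \prod_(g in f |: U :\: I :\ f)
      (th (q * c g / c e) / th (c g / c e)) =
    \prod_(e in I) (th (q * c f / c e) / th (c f / c e)) *
    \prod_(e in I) \prod_(g in U :\: I :\ f)
      (th (q * c g / c e) / th (c g / c e)).
    by rewrite -big_split; apply: eq_bigr => e _; rewrite big_setU1.
  by ring.
by field; rewrite ndf ncf nzf.
Qed.

(** The alternative excludes the case where c z is generic but some other c e
    is not; in that case the element singled out has to be e. *)
Lemma expansion_step : separated (z |: U) c ->
  th (d * c z) = 0 \/ {in U, forall e, th (d * c e) != 0} ->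
  expansion U c u v A ->
  expansion U (fun e => q * c e) (u * q) (v * q) (A * q ^+ 2) ->
  expansion (z |: U) c u v A.
Proof.
move=> [nc' ndc' nc1'] deg ex1 ex2.
have sub e : e \in U -> e \in z |: U by move=> eU; rewrite !inE eU orbT.
have zz : z \in z |: U by rewrite setU11.
have nc : {in U, forall e, c e != 0} by move=> e /sub/nc'.
have nz := nc' z zz.
have nez e : e \in U -> e != z by apply: contraTneq => ->.
have ndc : {in U &, forall e f, e != f -> th (c e / c f) != 0}.
  by move=> e f /sub eU /sub fU; apply: ndc'.
have ndz : {in U, forall e, th (c e / c z) != 0}.
  by move=> e eU; apply: ndc'; rewrite ?zz ?sub ?nez.
have ndz' : {in U, forall e, th (c z / c e) != 0}.
  by move=> e eU; rewrite th_div_eq0C ?nz ?nc ?ndz.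
have nc1 : {in U, forall e, th (c e) != 0}.
  by move=> e /sub eU; have := nc1' _ eU 0%N; rewrite expr0 mulr1.
have nz1 : th (c z) != 0 by have := nc1' _ zz 0%N; rewrite expr0 mulr1.
have ndd : {in U, forall e, th (d * c e) != 0}.
  case: deg => // dz e eU; apply/eqP => de.
  have : th (d * c e / (d * c z)) = 0 by apply: th_ratio_zeros => //; apply: mulf_neq0 => //; apply: nc.
  by rewrite -mulf_div divff// mul1r; apply/eqP/ndz.
have S1 := node_inv nc ndd ex1; have S2 := node_one nc ex2 nc1.
rewrite /expansion cardU big_setU1//= big_subsetU1//.
have -> : u * v / (A * q ^+ #|U|.+1) = d^-1 by rewrite invf_div.
rewrite tfactS [_ * q]mulrC.
have nK : A * q ^+ #|U|.+1 != 0 by rewrite mulf_neq0.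
have dK : u * v * d = A * q ^+ #|U|.+1 by rewrite mulrC divfK// mulf_neq0.
have d1 : d^-1 / u = v / (A * q ^+ #|U|.+1) by rewrite invf_div; field; rewrite nA nqX nu.
have d2 : v * d = A * q ^+ #|U|.+1 / u by rewrite /d; field; rewrite ?nv ?nu.
have [dz|dz] := eqVneq (th (d * c z)) 0.
  (* Here d * c z is a zero of th, so that th (x * c z) and th (x / d) differ
     by a monomial in x: the identity is a multiple of the one at 1/d. *)
  under [RHS]eq_bigr => I IU.
    rewrite expansion_term_in// dz !(mul0r, mulr0) addr0 expansion_term_out//.
    over.
  have ne : d * c z != 0 by apply: mulf_neq0.
  have [l nl [s qs]] := th_quasi H ne dz.
  have qz x : x != 0 -> th (x * c z) = l * (x / d) ^ s * th (x / d).
    by move=> nx; rewrite -qs ?mulf_neq0 ?invr_eq0//; congr th; field.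
  have zz1 : th (c z) = l * d^-1 ^ s * th d^-1.
    by rewrite -[c z]mul1r qz ?oner_neq0// mul1r.
  have zu : th (c z / u) = l * (d^-1 / u) ^ s * th (d^-1 / u).
    by rewrite mulrC qz ?invr_eq0// (mulrC u^-1).
  have qV x : x != 0 -> th (x / c z) = l^-1 * (x / c z) ^ (- s) * th (x * d).
    move=> nx; have nxz : x / c z != 0 by rewrite mulf_neq0 ?invr_eq0.
    have -> : x * d = d * c z * (x / c z) by field.
    by rewrite qs// -invr_expz; field; rewrite nl expfz_neq0.
  pose C := (d^-1 / u) ^ s * (v / c z) ^ (- s) * th d^-1.
  transitivity (C * (\prod_(e in U) (th (c e / u) * th (v / c e)) *
      tfact (q / d) #|U| * (th (A * q ^+ #|U|.+1 / u) * th (v / (A * q ^+ #|U|.+1))))).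
    by rewrite zu qV// -d2 /C -d1; field.
  rewrite -S1 mulr_sumr; apply: eq_bigr => I IU.
  have -> : \prod_(e in I) (th (q * c z / c e) / th (c z / c e)) =
      (q ^ s) ^+ #|I| * \prod_(e in I) (th (q * d^-1 / c e) / th (d^-1 / c e)).
    rewrite -prodr_const -big_split; apply: eq_bigr => e eI /=.
    have nce := nc _ (subsetP IU _ eI).
    rewrite mulrAC qz ?mulf_neq0 ?invr_eq0// -[c z / c e]mulrC qz ?invr_eq0//.
    rewrite -mulf_div -mulf_div divff// mul1r; congr (_ * (th _ / th _)).
    - rewrite invr_expz -exprz_inv -expfzMl; congr (_ ^ s).
      by field; rewrite nd nce oner_neq0.
    - by rewrite mulrAC.
    - by rewrite mulrC.
  rewrite zz1 qV ?mulf_neq0//.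
  have -> : u * v * q ^+ #|I| * d = u * v * d * q ^+ #|I| by rewrite mulrAC.
  have -> : C = (q ^ s) ^+ #|I| * (l * d^-1 ^ s * th d^-1) *
     (l^-1 * (u * v * q ^+ #|I| / c z) ^ (- s)).
    have -> : u * v * q ^+ #|I| / c z = u * (q ^+ #|I| * (v / c z)) by field.
    have -> : C = d^-1 ^ s * u ^ (- s) * (v / c z) ^ (- s) * th d^-1.
      by rewrite /C -[u ^ (- s)]exprz_inv -expfzMl.
    rewrite (expfzMl u) (expfzMl (q ^+ #|I|)).
    have -> : (q ^+ #|I|) ^ (- s) = ((q ^ s) ^+ #|I|)^-1.
      by rewrite -invr_expz !exprnP exprzAC.
    by field; rewrite nl expf_neq0 // expfz_neq0.
  by ring.
under [RHS]eq_bigr => I IU.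
  rewrite expansion_term_in// expansion_term_out//.
  over.
(* th (A q^n) is the coefficient of the interpolated function in both
   [lagrange_in] and [lagrange_out], since u * v * d = A q^n. *)
apply: (mulfI (ndA #|U|.+1)).
transitivity (\prod_(e in U) (th (c e / u) * th (v / c e)) * tfact (q / d) #|U|
   * (th (c z) * th (u * v / c z) * (th (A * q ^+ #|U|.+1 / u) * th (v / (A * q ^+ #|U|.+1)))
     + th (d * c z) * th (A * q ^+ #|U|.+1 / c z)
       * (th u * th v * (v / (A * q ^+ #|U|.+1))))).
  (* The three-term relation combines the values at the two nodes. *)
  have := th_addition H nz nu nv nK.
  have -> : u * v / (A * q ^+ #|U|.+1) = d^-1 by rewrite invf_div.
  have -> : A * q ^+ #|U|.+1 * c z / (u * v) = d * c z by rewrite mulrAC.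
  move=> e3.
  transitivity (\prod_(e in U) (th (c e / u) * th (v / c e)) * tfact (q / d) #|U| *
    (th (c z / u) * th (v / c z) * th d^-1 * th (A * q ^+ #|U|.+1))).
    by ring.
  by rewrite e3; ring.
have -> : forall X p1 p2 n1 n2 : F, X * (p1 * n1 + p2 * n2) =
   p1 * (X * n1) + p2 * (X * n2) by move=> *; ring.
have L1 I : I \subset U ->
  th (A * q ^+ #|U|.+1) * (subset_term c d (u * v * q ^+ #|I|) (A * q ^+ #|I|) I (U :\: I)
  * \prod_(e in I) (th (q * c z / c e) / th (c z / c e))
  * (th (c z) * th (u * v * q ^+ #|I| / c z)) * weight #|U|.+1 #|I| u v A) =
  th (c z) * th (u * v / c z) *
  (subset_term c d (u * v * q ^+ #|I|) (A * q ^+ #|I|) I (U :\: I)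
    * \prod_(e in I) (th (q * d^-1 / c e) / th (d^-1 / c e))
    * th (u * v * d * q ^+ #|I|) * weight #|U|.+1 #|I| u v A)
  + \sum_(e in I) residue_in I e.
  move=> IU; have s := subsetP IU.
  have := @lagrange_in I c (c z) (u * v) d (sub_in1 s nc) nz
    (mulf_neq0 nu nv) nd (sub_in2 s ndc) (sub_in1 s ndz) (sub_in1 s ndd) dz.
  rewrite /= dK; set Q := \prod_(e in I) _; set S := \sum_(e in I) _ => L.
  have -> : \sum_(e in I) residue_in I e =
    subset_term c d (u * v * q ^+ #|I|) (A * q ^+ #|I|) I (U :\: I)
    * weight #|U|.+1 #|I| u v A * th (c z) * (th (d * c z) * th q * S).
    by rewrite !mulr_sumr; apply: eq_bigr => e _; rewrite /residue_in dK; ring.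
  transitivity (subset_term c d (u * v * q ^+ #|I|) (A * q ^+ #|I|) I (U :\: I)
    * weight #|U|.+1 #|I| u v A * th (c z)
    * (th (A * q ^+ #|U|.+1) * Q * th (u * v * q ^+ #|I| / c z))); first by ring.
  by rewrite L; ring.
have L2 I : I \subset U ->
  th (A * q ^+ #|U|.+1) *
  (subset_term c d (u * v * q ^+ #|I|.+1) (A * q ^+ #|I|.+1) I (U :\: I)
  * \prod_(f in U :\: I) (th (q * c f / c z) / th (c f / c z))
  * (th (d * c z) * th (A * q ^+ #|I|.+1 / c z)) * weight #|U|.+1 #|I|.+1 u v A) =
  th (d * c z) * th (A * q ^+ #|U|.+1 / c z) *
  (subset_term c d (u * v * q ^+ #|I|.+1) (A * q ^+ #|I|.+1) I (U :\: I)
    * \prod_(f in U :\: I) (th (q * c f / 1) / th (c f / 1))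
    * th (A * q ^+ #|I|.+1) * weight #|U|.+1 #|I|.+1 u v A)
  - \sum_(f in U :\: I) residue_out I f.
  move=> IU; have s : {subset U :\: I <= U} by move=> e /setDP[].
  have nL : A * q ^+ #|I|.+1 != 0 by rewrite mulf_neq0.
  have eL : A * q ^+ #|U|.+1 = A * q ^+ #|I|.+1 * q ^+ #|U :\: I|.
    rewrite -mulrA -exprD cardsD (setIidPr IU); congr (_ * _ ^+ _).
    by rewrite addSn subnKC ?subset_leq_card.
  have := @lagrange_out (U :\: I) c (c z) _ _ (sub_in1 s nc) nz nL
    eL (sub_in2 s ndc) (sub_in1 s ndz) (sub_in1 s nc1) nz1.
  rewrite /=; set Q := \prod_(e in _) _; set Q1 := \prod_(e in _) (th _ / _).
  set S := \sum_(e in _) _ => L.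
  have -> : \sum_(f in U :\: I) residue_out I f =
    subset_term c d (u * v * q ^+ #|I|.+1) (A * q ^+ #|I|.+1) I (U :\: I)
    * weight #|U|.+1 #|I|.+1 u v A * th (d * c z) * (th (c z) * th q * S).
    by rewrite !mulr_sumr; apply: eq_bigr => e _; rewrite /residue_out dK; ring.
  transitivity (
    subset_term c d (u * v * q ^+ #|I|.+1) (A * q ^+ #|I|.+1) I (U :\: I)
    * weight #|U|.+1 #|I|.+1 u v A * th (d * c z)
    * (th (A * q ^+ #|U|.+1) * Q * th (A * q ^+ #|I|.+1 / c z))); first by ring.
  by rewrite L; ring.
rewrite -S1 -S2 2!mulr_sumr [RHS]mulr_sumr -big_split /=.
under [RHS]eq_bigr => I IU.
  rewrite mulrDr L1// L2// addrACA.
  over.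
rewrite [RHS]big_split /= -[LHS]addr0; congr (_ + _).
rewrite big_split/= sumrN sum_subset_mem; apply/esym/eqP; rewrite subr_eq0.
apply/eqP; apply: eq_bigr => I IU; apply: eq_bigr => f fJ.
have [fU _] := setDP fJ.
by apply: residue_cancel; rewrite ?ndd ?nc1 ?ndz'.
Qed.

End Step.

Lemma separatedS U U' c : U' \subset U -> separated U c -> separated U' c.
Proof.
move=> /subsetP s [h1 h2 h3]; split.
- by move=> e /s/h1.
- by move=> e f /s eU /s fU; apply: h2.
- by move=> e /s/h3.
Qed.

Lemma separated_scale U c : separated U c -> separated U (fun e => q * c e).
Proof.
move=> [h1 h2 h3]; split=> [e eU|e f eU fU ef|e eU i].
- by rewrite mulf_neq0 ?h1.
- by rewrite -mulf_div divff// mul1r h2.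
- by rewrite mulrAC -exprS mulrC h3.
Qed.

(** With n = #|U| this expands
      prod_(e in U) th (c_e / u) th (v / c_e) * (u v / (A q^n); q)_n
    over the subsets of U; the one-variable Jackson sum is the case where the
    c_e form a geometric progression of ratio q. *)
Theorem subset_expansion U c u v A : u != 0 -> v != 0 -> A != 0 ->
  (forall i, th (A * q ^+ i) != 0) -> separated U c -> expansion U c u v A.
Proof.
have [m] := ubnP #|U|.
elim: m U c u v A => // m IH U c u v A lt nu nv nA ndA sep.
have [->|[z0 z0U]] := set_0Vmem U.
  rewrite /expansion big_set0 cards0 mul1r /tfact big_ord0.
  rewrite (big_pred1 set0); last by move=> I; rewrite subset0.
  rewrite /expansion_term /subset_term /cross !big_set0 set0D big_set0.
  rewrite !mul1r /weight cards0 /tfact !big_ord0 big_ord1 !expr0 !mulr1.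
  by rewrite ?mul1r divff//; have := ndA 0%N; rewrite expr0 mulr1.
have step z : z \in U ->
    th (A * q ^+ #|U| / (u * v) * c z) = 0 \/
    {in U :\ z, forall e, th (A * q ^+ #|U| / (u * v) * c e) != 0} ->
    expansion U c u v A.
  move=> zU; have cU : #|U| = #|U :\ z|.+1 by rewrite (cardsD1 z U) zU.
  have lt' : (#|U :\ z| < m)%N by rewrite -ltnS -cU.
  have sep' := separatedS (subD1set U z) sep.
  move=> deg; rewrite -(setD1K zU); apply: expansion_step => //.
  - by rewrite !inE eqxx.
  - by rewrite setD1K.
  - by rewrite -cU.
  - exact: IH.
  - apply: IH; rewrite ?mulf_neq0 ?expf_neq0//.
      by move=> i; rewrite -mulrA -exprD.
    exact: separated_scale.
have [z /andP[zU /eqP z0']|h] :=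
    pickP (fun z => (z \in U) && (th (A * q ^+ #|U| / (u * v) * c z) == 0)).
  by apply: (step z) => //; left.
apply: (step z0) => //; right=> e /setD1P[_ eU].
by have := h e; rewrite eU => /negbT.
Qed.

End SubsetExpansion.

(** * The Jackson sum over multi-indices *)

Section Terms.

Variables (n M : nat) (x : 'I_n -> F).
Hypothesis nx : forall r, x r != 0.
Hypothesis ndx : forall r s (i : int), (r != s) || (0 < i) ->
  th (q ^ i * x r / x s) != 0.
Implicit Types (j k N : 'I_n -> nat).

Let size k := (\sum_(r < n) k r)%N.

Lemma tfactD a s t : tfact a (s + t) = tfact a s * tfact (a * q ^+ s) t.
Proof.
rewrite /tfact big_split_ord; congr (_ * _).
by apply: eq_bigr => i _; rewrite /= exprD mulrA.
Qed.

Lemma tfact_nat a s t : (s <= t)%N ->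
  tfact (a * q ^+ s) (t - s) = \prod_(s <= i < t) th (a * q ^+ i).
Proof.
move=> st; rewrite -[in RHS](add0n s) big_addn big_mkord; apply: eq_bigr => i _.
by rewrite -mulrA -exprD addnC.
Qed.

Lemma tfact_rev a s t : a != 0 -> (s <= t)%N ->
  tfact a (t - s) = \prod_(s <= i < t) th (a * q ^+ t / q ^+ i.+1).
Proof.
move=> na st; rewrite big_nat_rev /= -[X in \prod_(X <= _ < _) _](add0n s) big_addn big_mkord.
apply: eq_bigr => i _; congr th.
have lt : (i + s < t)%N by rewrite addnC -ltn_subRL.
have le : (i < t)%N by apply: leq_ltn_trans lt; apply: leq_addr.
have -> : (0 + s + t - (i + s).+1).+1 = (t - i)%N.
  by rewrite add0n -addSn (addnC i.+1) subnDl subnSK.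
move/ltnW in le.
by rewrite -{2}(subnKC le) exprD; field; rewrite expf_neq0.
Qed.

(** The denominators of B^(2) that involve only q and x. *)
Definition xdenom k j :=
  \prod_(r < n) \prod_(s < n)
    tfact (q ^ (1 + (j r)%:Z - (j s)%:Z) * x r / x s) (k r - j r).

Let t r s (i : int) := th (q ^ i * x r / x s).

Lemma tfact_xdenom r s a b c : (a <= c)%N ->
  tfact (q ^ (1 + a%:Z - b%:Z) * x r / x s) (c - a) =
  \prod_(a <= l < c) t r s (1 + l%:Z - b%:Z).
Proof.
move=> ac; rewrite -[in RHS](add0n a) big_addn big_mkord; apply: eq_bigr => i _.
congr th; rewrite PoszD mulrAC; congr (_ / _); rewrite mulrAC; congr (_ * _).
by rewrite exprnP -expfzDr//; congr (q ^ _); ring.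
Qed.

(** The range is split at b, and on its upper part the offset e is replaced
    by d; the quotient of the two factors telescopes over e <= m < d. *)
Lemma prod_xdenom r s (a b c d e : nat) :
  (r != s) || (d <= b)%N -> (a <= b <= c)%N -> (e <= d)%N ->
  \prod_(a <= l < c) t r s (1 + l%:Z - e%:Z) =
  \prod_(b <= l < c) t r s (1 + l%:Z - d%:Z) *
  \prod_(a <= l < b) t r s (1 + l%:Z - e%:Z) *
  \prod_(b <= l < c) \prod_(e <= m < d)
    (t r s (1 + l%:Z - m%:Z) / t r s (l%:Z - m%:Z)).
Proof.
move=> rs /andP[ab bc] ed; rewrite (big_cat_nat ab bc)/= mulrC mulrAC.
congr (_ * _); rewrite -big_split; apply: eq_big_nat => l /andP[bl lc] /=.
have nt m : (e <= m <= d)%N -> t r s (1 + l%:Z - m%:Z) != 0.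
  move=> /andP[em md]; apply: ndx; case/orP: rs => [->//|db]; apply/orP; right.
  by rewrite subr_gt0 -PoszD ltz_nat add1n ltnS (leq_trans md (leq_trans db bl)).
have -> : \prod_(e <= m < d) (t r s (1 + l%:Z - m%:Z) / t r s (l%:Z - m%:Z)) =
    \prod_(e <= m < d) (t r s (1 + l%:Z - m%:Z) / t r s (1 + l%:Z - m.+1%:Z)).
  by apply: eq_bigr => m _; congr (_ / t r s _); rewrite -[m.+1]add1n PoszD; ring.
move: ed; rewrite leq_eqVlt => /predU1P[ed|ed].
  by rewrite ed big_geq// mulr1.
rewrite (@telescope_prodr _ _ _ (fun m : nat => t r s (1 + l%:Z - m%:Z)))//.
  by rewrite mulrC divfK ?nt// (ltnW ed) leqnn.
by move=> m /andP[em md]; rewrite unitfE nt// (ltnW em) (ltnW md).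
Qed.

Definition stripc C (e : 'I_n * 'I_M) := C * x e.1 * q ^+ e.2.

(** [xdenom] is multiplicative along j <= k <= N up to the cross factor
    between the strips k / j and N / k, which is how the latter arises from
    the two matrices and the kernel of beta'. *)
Lemma xdenom_cross C j k N : C != 0 ->
  (forall r, (j r <= k r)%N) -> (forall r, (k r <= N r)%N) ->
  (forall r, (N r <= M)%N) ->
  xdenom N j = xdenom N k * xdenom k j * cross (stripc C) (strip M j k) (strip M k N).
Proof.
move=> nC jk kN NM.
have kM r : (k r <= M)%N by rewrite (leq_trans (kN r)).
have -> : cross (stripc C) (strip M j k) (strip M k N) =
    \prod_(r < n) \prod_(s < n) \prod_(k r <= l < N r) \prod_(j s <= m < k s)
      (t r s (1 + l%:Z - m%:Z) / t r s (l%:Z - m%:Z)).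
  transitivity (\prod_(e in strip M j k) \prod_(r < n) \prod_(k r <= l < N r)
      (t r e.1 (1 + l%:Z - e.2%:Z) / t r e.1 (l%:Z - e.2%:Z))).
    apply: eq_bigr => e _.
    rewrite -(@big_strip _ M _ _ _ k N (fun r l => t r e.1 (1 + l%:Z - e.2%:Z)
      / t r e.1 (l%:Z - e.2%:Z)))//.
    apply: eq_bigr => f _.
    rewrite /stripc; congr (th _ / th _).
      rewrite -addrA expfzDr// expr1z expfzDr// -exprnN -exprnP.
      by field; rewrite nC nx expf_neq0.
    by rewrite expfzDr// -exprnN -exprnP; field; rewrite nC nx expf_neq0.
  rewrite (@big_strip _ M _ _ _ j k (fun s m => \prod_(r < n) \prod_(k r <= l < N r)
      (t r s (1 + l%:Z - m%:Z) / t r s (l%:Z - m%:Z))))//.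
  rewrite [RHS]exchange_big; apply: eq_bigr => s _.
  rewrite [LHS]exchange_big; apply: eq_bigr => r _ /=.
  by rewrite exchange_big.
rewrite /xdenom -!big_split; apply: eq_bigr => r _ /=.
rewrite -!big_split; apply: eq_bigr => s _ /=.
rewrite !tfact_xdenom ?(leq_trans (jk r) (kN r))//; apply: prod_xdenom => //.
  by case: eqVneq => [->|//]; rewrite leqnn.
by rewrite jk kN.
Qed.

Lemma xdenom_neq0 k j : (forall r, (j r <= k r)%N) -> xdenom k j != 0.
Proof.
move=> jk; apply/prodf_neq0 => r _; apply/prodf_neq0 => s _.
rewrite tfact_xdenom//; elim: (k r) (jk r) => [|m IH].
  by rewrite leqn0 => /eqP->; rewrite big_geq// oner_neq0.
rewrite leq_eqVlt => /predU1P[<-|jm]; first by rewrite big_geq// oner_neq0.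
rewrite big_nat_recr//= mulf_neq0 ?IH//; apply: ndx.
case: eqVneq => [<-|//]; rewrite subr_gt0 -PoszD ltz_nat add1n ltnS.
exact: jm.
Qed.

Lemma card_strip j k : (forall r, (j r <= k r)%N) -> (forall r, (k r <= M)%N) ->
  #|strip M j k| = (size k - size j)%N.
Proof.
move=> jk kM; rewrite -sum1_card (@big_strip _ M _ _ _ j k (fun _ _ => 1%N))//.
rewrite -sumnB//; apply: eq_bigr => r _.
by rewrite sum_nat_const_nat muln1.
Qed.

Lemma tfact_cat a s l : (s <= l)%N ->
  tfact a l = tfact a s * \prod_(s <= i < l) th (a * q ^+ i).
Proof. by move=> st; rewrite -tfact_nat// -tfactD subnKC. Qed.

Lemma prod_tfact_cat (f : 'I_n -> F) j k : (forall r, (j r <= k r)%N) ->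
  \prod_(r < n) tfact (f r) (k r) = \prod_(r < n) tfact (f r) (j r)
    * \prod_(r < n) \prod_(j r <= i < k r) th (f r * q ^+ i).
Proof.
by move=> jk; rewrite -big_split; apply: eq_bigr => r _ /=; rewrite -tfact_cat.
Qed.

Lemma size_ge k r : (k r <= size k)%N.
Proof. by rewrite /size (bigD1 r)//= leq_addr. Qed.

Lemma size_le j k : (forall r, (j r <= k r)%N) -> (size j <= size k)%N.
Proof. by move=> jk; apply: leq_sum => r _. Qed.

(** The contribution of k to the coefficient of alpha_j in beta'_N: prefactor
    of beta'_N, kernel at k, and entry (k, j) of B^(2) at b'. *)
Definition bailey_term (a b r1 r2 : F) j N k :=
  let b' := b * r1 * r2 / (a * q) in let g := a * q / (r1 * r2) in
  (tfact (b * r2 / a) (size N) / tfact (a * q / r2) (size N)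
   * \prod_(r < n) (tfact (b * r1 * q ^+ (size N - N r) / (a * x r)) (N r)
                    / tfact (a * x r * q / r1) (N r)))
  * (tfact r1 (size k) / tfact (b * r2 / a) (size k)
     * (\prod_(r < n) (tfact (r2 * x r) (k r)
          * tfact (b * r1 * q ^+ size N / (a * x r)) (size k - k r)
          / tfact (b * r1 * q ^+ (size N - N r) / (a * x r)) (size k)))
     * (th (b * r1 * r2 * q ^+ (2 * size k) / (a * q)) / th b')
     * (tfact b (size N + size k) / tfact (b * r1 * r2 / a) (size N + size k))
     * (tfact g (size N - size k) / xdenom N k)
     * g ^+ size k)
  * (tfact b' (size k + size j)
     * (\prod_(r < n) tfact (b' * q ^+ (size k - k r) / (a * x r)) (k r - j r))
     / (xdenom k j * \prod_(r < n) tfact (a * x r * q) (k r + size j))).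

(** The coefficient of alpha_j in the sum of B^(2)_(N j) alpha'_j. *)
Definition bailey_total (a b r1 r2 : F) j N :=
  let g := a * q / (r1 * r2) in
  tfact b (size N + size j)
  * (\prod_(r < n) tfact (b * q ^+ (size N - N r) / (a * x r)) (N r - j r))
  / (xdenom N j * \prod_(r < n) tfact (a * x r * q) (N r + size j))
  * (tfact r1 (size j) / tfact (a * q / r2) (size j)
     * (\prod_(r < n) (tfact (r2 * x r) (j r) / tfact (a * x r * q / r1) (j r)))
     * g ^+ size j).

Section BaileyParameters.
Variables (a b r1 r2 : F).
Hypotheses (na : a != 0) (nb : b != 0) (nr1 : r1 != 0) (nr2 : r2 != 0).
Let b' := b * r1 * r2 / (a * q).
Let nqX i : q ^+ i != 0. Proof. by rewrite expf_neq0. Qed.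

Variables (j k N : 'I_n -> nat).
Hypotheses (jk : forall r, (j r <= k r)%N) (kN : forall r, (k r <= N r)%N).
Hypothesis (NM : forall r, (N r <= M)%N).
Let kM r : (k r <= M)%N. Proof. exact: leq_trans (kN r) (NM r). Qed.
Let jN r : (j r <= N r)%N. Proof. exact: leq_trans (jk r) (kN r). Qed.
Let sjk : (size j <= size k)%N. Proof. exact: size_le. Qed.
Let skN : (size k <= size N)%N. Proof. exact: size_le. Qed.

(* The parameters of [subset_expansion] that give the sum over k; they are
   determined by matching the factors in the lemmas strip_prod below.  Here d
   equals r2 / (a * q ^+ (size j).+1). *)
Let C := a * q ^+ (size j).+1.
Let u := r1 * q ^+ size j.
Let v := b * q ^+ (size N + size j).
Let A := b' * q ^+ (2 * size j).
Let c := stripc C.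
Let d := A * q ^+ (size N - size j) / (u * v).

Lemma strip_prod_in :
  \prod_(r < n) tfact (r2 * x r) (k r) =
  \prod_(r < n) tfact (r2 * x r) (j r) * \prod_(e in strip M j k) th (d * c e).
Proof.
rewrite (prod_tfact_cat _ jk); congr (_ * _).
rewrite -(@big_strip _ M _ _ _ j k (fun r i => th (r2 * x r * q ^+ i)))//.
apply: eq_bigr => e _; congr th; rewrite /c /stripc /d /A /C /u /v /b'.
have -> : (2 * size j = size j + size j)%N by rewrite mul2n addnn.
have -> : (size N + size j = (size N - size j) + (size j + size j))%N.
  by rewrite addnA subnK// (leq_trans sjk).
rewrite !exprD exprS.
by field; rewrite ?na ?nq ?nqX ?nr1 ?nb.
Qed.

Lemma strip_prod_out :
  \prod_(r < n) tfact (a * x r * q) (N r + size j) =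
  \prod_(r < n) tfact (a * x r * q) (k r + size j)
  * \prod_(e in strip M k N) th (c e).
Proof.
transitivity (\prod_(r < n) tfact (a * x r * q) (k r + size j) *
   \prod_(r < n) \prod_(k r <= i < N r) th (C * x r * q ^+ i)).
  rewrite -big_split; apply: eq_bigr => r _ /=.
  rewrite ![(_ + size j)%N]addnC !tfactD.
  rewrite (tfact_cat _ (kN r)) mulrA; congr (_ * _); apply: eq_bigr => i _.
  by congr th; rewrite /C exprS; ring.
by congr (_ * _); rewrite -(@big_strip _ M _ _ _ k N (fun r i => th (C * x r * q ^+ i))).
Qed.

(** Factorials in which the variable stands in the denominator are read
    backwards along the row. *)
Lemma strip_prod_rev (f : F) (s l : 'I_n -> nat) w : f != 0 ->
  (forall r, (s r <= l r)%N) -> (forall r, (l r <= M)%N) ->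
  (forall r, (l r <= w)%N) ->
  \prod_(r < n) tfact (f * q ^+ (w - l r) / (a * x r)) (l r - s r) =
  \prod_(e in strip M s l) th (f * q ^+ (w + size j) / c e).
Proof.
move=> nf sl lM lw.
rewrite (@big_strip _ M _ _ _ s l
   (fun r i => th (f * q ^+ (w + size j) / (C * x r * q ^+ i))))//.
apply: eq_bigr => r _; rewrite tfact_rev ?mulf_neq0 ?invr_eq0 ?mulf_neq0//.
apply: eq_bigr => i _; congr th; rewrite /C -{2}(subnK (lw r)) !exprD !exprS.
by field; rewrite na nx nq !nqX.
Qed.

Lemma strip_prod_out_rev :
  \prod_(r < n) tfact (b * r1 * q ^+ (size N - N r) / (a * x r)) (N r)
  * \prod_(r < n) tfact (b * r1 * q ^+ size N / (a * x r)) (size k - k r) =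
  \prod_(r < n) tfact (b * r1 * q ^+ (size N - N r) / (a * x r)) (size k)
  * \prod_(e in strip M k N) th (u * v * q ^+ (size k - size j) / c e).
Proof.
have -> : u * v * q ^+ (size k - size j) =
    b * r1 * q ^+ (size N + size k + size j).
  rewrite -{2}(subnKC sjk) /u /v !exprD; ring.
rewrite -strip_prod_rev ?mulf_neq0// => [|r]; last first.
  by rewrite (leq_trans (size_ge N r))// leq_addr.
rewrite -[LHS]big_split -[RHS]big_split; apply: eq_bigr => r _ /=.
have e1 : b * r1 * q ^+ size N / (a * x r) =
    b * r1 * q ^+ (size N - N r) / (a * x r) * q ^+ N r.
  by rewrite -{1}(subnK (size_ge N r)) exprD; field; rewrite na nx.
have e2 : b * r1 * q ^+ (size N + size k - N r) / (a * x r) =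
    b * r1 * q ^+ (size N - N r) / (a * x r) * q ^+ size k.
  rewrite -addnBAC ?size_ge// exprD; field; rewrite na nx//.
rewrite e1 e2 -!tfactD; congr (tfact _ _).
by rewrite addnBA ?size_ge// addnC addnBA.
Qed.

Let g := a * q / (r1 * r2).

(** The quotient of [bailey_term] by the corresponding term of the subset
    expansion; it does not depend on k. *)
Definition common_factor :=
  tfact b (size N + size j) * tfact r1 (size j) * g ^+ size j
  * (\prod_(r < n) tfact (r2 * x r) (j r))
  / (xdenom N j * (\prod_(r < n) tfact (a * x r * q) (N r + size j))
     * (\prod_(r < n) tfact (a * x r * q / r1) (N r))
     * tfact (a * q / r2) (size N)).

Hypotheses (h1 : forall r i, th (a * x r * q * q ^+ i) != 0)
  (h2 : forall r, tfact (a * x r * q / r1) (N r) != 0)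
  (h3 : tfact (a * q / r2) (size N) != 0)
  (h4 : tfact (b * r2 / a) (size k) != 0)
  (h5 : forall r, tfact (b * r1 * q ^+ (size N - N r) / (a * x r)) (size k) != 0)
  (h6 : th b' != 0)
  (h7 : tfact (b * r1 * r2 / a) (size N + size k) != 0).

Let n1 s : \prod_(r < n) tfact (a * x r * q) (s r) != 0.
Proof. by apply/prodf_neq0 => r _; apply/prodf_neq0 => i _; apply: h1. Qed.

(** The factors that depend on k only through size k make up [weight]. *)
Lemma common_factor_weight :
  tfact r1 (size k) / tfact (b * r2 / a) (size k)
  * (th (b * r1 * r2 * q ^+ (2 * size k) / (a * q)) / th b')
  * (tfact b (size N + size k) / tfact (b * r1 * r2 / a) (size N + size k))
  * tfact g (size N - size k) * g ^+ size k * tfact b' (size k + size j)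
  * tfact (b * r2 / a) (size N) =
  tfact b (size N + size j) * tfact r1 (size j) * g ^+ size j
  * weight (size N - size j) (size k - size j) u v A.
Proof.
rewrite /weight.
have nb' : b' != 0 by rewrite !mulf_neq0 ?invr_eq0 ?mulf_neq0.
have nu : u != 0 by rewrite mulf_neq0.
have sNj : (size j <= size N)%N by apply: leq_trans skN.
have eNk : (size N - size j - (size k - size j) = size N - size k)%N
  by rewrite -subnDA subnKC.
have s1 : tfact r1 (size k) = tfact r1 (size j) * tfact u (size k - size j).
  by rewrite -tfactD subnKC.
have s2 : tfact b (size N + size k) =
    tfact b (size N + size j) * tfact v (size k - size j).
  by rewrite -tfactD -addnA subnKC.
have s3 : tfact (b * r2 / a) (size N) = tfact (b * r2 / a) (size k) *
    tfact (A * q ^+ (size k - size j).+1 / u) (size N - size k).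
  rewrite -{1}(subnKC skN) tfactD; congr (_ * tfact _ _).
  rewrite /A /u -{1}(subnKC sjk) mul2n -addnn !exprD exprS /b'.
  by field; rewrite na nq nqX nr1.
have eg : v / (A * q ^+ (size N - size j)) = g.
  rewrite /v /A /g /b' -{1}(subnK sNj) mul2n -addnn !exprD.
  by field; rewrite na nq !nqX nr1 nr2 nb.
have s5 : tfact b' (size k + size j) * tfact (A * q ^+ (size k - size j))
    (size N - size j).+1 = th b' * tfact (b * r1 * r2 / a) (size N + size k).
  have -> : A * q ^+ (size k - size j) = b' * q ^+ (size k + size j).
    rewrite /A -mulrA -exprD; congr (_ * _ ^+ _).
    by rewrite mul2n -addnn -addnA subnKC// addnC.
  rewrite -tfactD.
  have -> : (size k + size j + (size N - size j).+1 = (size N + size k).+1)%N.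
    by rewrite -addnA addnS subnKC// addnS addnC.
  rewrite tfactS; congr (_ * tfact _ _); rewrite /b'.
  by field; rewrite na nq.
have s6 : th (b * r1 * r2 * q ^+ (2 * size k) / (a * q)) =
    th (A * q ^+ (2 * (size k - size j))).
  congr th; rewrite /A -[in RHS]mulrA -exprD.
  have -> : (2 * size j + 2 * (size k - size j) = 2 * size k)%N.
    by rewrite -mulnDr subnKC.
  by rewrite /b' mulrAC.
have s7 : g ^+ size k = g ^+ size j * g ^+ (size k - size j).
  by rewrite -exprD subnKC.
have n5 : tfact (A * q ^+ (size k - size j)) (size N - size j).+1 != 0.
  have : th b' * tfact (b * r1 * r2 / a) (size N + size k) != 0 by rewrite mulf_neq0.
  by rewrite -s5 mulf_eq0 negb_or => /andP[].
rewrite eNk eg s1 s2 s3 s6 s7.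
have -> : tfact b' (size k + size j) = th b' * tfact (b * r1 * r2 / a)
   (size N + size k) / tfact (A * q ^+ (size k - size j)) (size N - size j).+1.
  by rewrite -s5 mulfK.
by field; rewrite h4 h6 h7 n5.
Qed.

Lemma bailey_term_strip : bailey_term a b r1 r2 j N k =
  common_factor * expansion_term (strip M j N) c u v A (strip M j k).
Proof.
have nb' : b' != 0 by rewrite !mulf_neq0 ?invr_eq0 ?mulf_neq0.
have nC : C != 0 by rewrite mulf_neq0.
rewrite /bailey_term -/b' -/g /expansion_term !card_strip// -/d strip_setD// /subset_term.
rewrite !big_split /= !prodfV -/c.
have D := xdenom_cross nC jk kN NM.
have nD1 := xdenom_neq0 jk; have nD2 := xdenom_neq0 kN.
have nD3 := xdenom_neq0 jN.
have n2 : \prod_(r < n) tfact (a * x r * q / r1) (N r) != 0.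
  by apply/prodf_neq0 => r _.
have n5 : \prod_(r < n) tfact (b * r1 * q ^+ (size N - N r) / (a * x r)) (size k) != 0.
  by apply/prodf_neq0 => r _.
have Pout := strip_prod_out. have Pin := strip_prod_in.
have Pr := strip_prod_rev nb' jk kM (size_ge k).
have Po := strip_prod_out_rev.
have W := common_factor_weight.
have eA : A * q ^+ (size k - size j) = b' * q ^+ (size k + size j).
  rewrite /A -mulrA -exprD; congr (_ * _ ^+ _).
  by rewrite mul2n -addnn -addnA subnKC// addnC.
rewrite Pr Pin /common_factor eA.
have cr : cross c (strip M j k) (strip M k N) = xdenom N j / (xdenom N k * xdenom k j).
  by rewrite D mulrC mulKf// mulf_neq0.
have nk1 : \prod_(r < n) tfact (a * x r * q) (k r + size j) != 0.
  by apply/prodf_neq0 => r _; apply/prodf_neq0 => i _; apply: h1.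
have := n1 (fun r => N r + size j)%N; rewrite /= Pout mulf_eq0 negb_or => /andP[_ nm].
rewrite cr.
move: W Po; set wt := weight _ _ _ _ _; set p1 := \prod_(r < n) tfact _ (N r).
set p2 := \prod_(r < n) tfact _ (size k - k r)%N => W Po.
set p3 := \prod_(r < n) tfact _ (size k) in Po n5 *.
set X := \prod_(r < n) tfact (r2 * x r) (j r).
set P := \prod_(e in strip M j k) _; set P' := \prod_(e in strip M j k) _.
set e1 := \prod_(r < n) tfact _ (k r + size j)%N in nk1 *.
set m := \prod_(e in strip M k N) th (c e) in nm *.
set po := \prod_(e in strip M k N) _ in Po *.
set p4 := \prod_(r < n) tfact (a * x r * q / r1) (N r) in n2 *.
transitivity ((tfact r1 (size k) / tfact (b * r2 / a) (size k)
  * (th (b * r1 * r2 * q ^+ (2 * size k) / (a * q)) / th b')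
  * (tfact b (size N + size k) / tfact (b * r1 * r2 / a) (size N + size k))
  * tfact g (size N - size k) * g ^+ size k * tfact b' (size k + size j)
  * tfact (b * r2 / a) (size N)) * (p1 * p2)
  * (X * P * P') / (tfact (a * q / r2) (size N) * p4 * p3 * xdenom N k
     * xdenom k j * e1)).
  by field; rewrite ?h3 ?h4 ?h6 ?h7 ?n2 ?n5 ?nD1 ?nD2 ?nk1.
rewrite W Po; field.
by rewrite ?h3 ?n2 ?n5 ?nD1 ?nD2 ?nD3 ?nk1 ?nm.
Qed.

Lemma bailey_total_strip : bailey_total a b r1 r2 j N =
  common_factor * (\prod_(e in strip M j N) (th (c e / u) * th (v / c e))
    * tfact (u * v / (A * q ^+ #|strip M j N|)) #|strip M j N|).
Proof.
have sNj : (size j <= size N)%N by apply: leq_trans skN.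
rewrite /bailey_total -/g card_strip// !big_split /= !prodfV /common_factor.
rewrite (strip_prod_rev nb jN NM (size_ge N)) -/v.
have e1 : tfact (a * q / r2) (size N) = tfact (a * q / r2) (size j)
    * tfact (u * v / (A * q ^+ (size N - size j))) (size N - size j).
  rewrite -{1}(subnKC sNj) tfactD; congr (_ * tfact _ _).
  have eN : q ^+ size N = q ^+ (size N - size j) * q ^+ size j.
    by rewrite -exprD subnK.
  rewrite /u /v /A mul2n -addnn !exprD eN /b'.
  by field; rewrite na nq !nqX nr1 nr2 nb.
have e2 : \prod_(r < n) tfact (a * x r * q / r1) (N r) =
    \prod_(r < n) tfact (a * x r * q / r1) (j r)
    * \prod_(e in strip M j N) th (c e / u).
  rewrite (prod_tfact_cat _ jN); congr (_ * _).
  rewrite -(@big_strip _ M _ _ _ j N (fun r i => th (a * x r * q / r1 * q ^+ i)))//.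
  apply: eq_bigr => e _; congr th; rewrite /c /stripc /C /u exprS.
  by field; rewrite nr1 nqX.
have n2 : \prod_(r < n) tfact (a * x r * q / r1) (N r) != 0.
  by apply/prodf_neq0 => r _.
move: h3 n2; rewrite e1 e2 !mulf_eq0 !negb_or => /andP[n3 n4] /andP[n5 n6].
have n7 := xdenom_neq0 jN.
have n8 : \prod_(r < n) tfact (a * x r * q) (N r + size j) != 0.
  by apply/prodf_neq0 => r _; apply/prodf_neq0 => i _; apply: h1.
by field; rewrite n3 n4 n5 n6 n7 n8.
Qed.

Lemma separated_strip U : separated U c.
Proof.
have nC : C != 0 by rewrite mulf_neq0.
have nc e : c e != 0 by rewrite !mulf_neq0.
split=> [//|[r i] [s l] _ _ ne|[r i] _ m]; last first.
  have -> : c (r, i) * q ^+ m = a * x r * q * q ^+ (size j + i + m).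
    by rewrite /c /stripc /C !exprD exprS /=; ring.
  exact: h1.
have cE (r' s' : 'I_n) (i' l' : 'I_M) :
    c (r', i') / c (s', l') = q ^ (i'%:Z - l'%:Z) * x r' / x s'.
  rewrite expfzDr// -exprnN -exprnP /c /stripc /=.
  by field; rewrite nC nx nqX.
have [il|li|il] := ltngtP i l.
- rewrite th_div_eq0C ?nc// cE; apply: ndx; apply/orP; right.
  by rewrite subr_gt0 ltz_nat.
- by rewrite cE; apply: ndx; apply/orP; right; rewrite subr_gt0 ltz_nat.
- rewrite cE; apply: ndx; apply/orP; left; apply: contraNneq ne => <-.
  by rewrite (val_inj il).
Qed.
End BaileyParameters.

Lemma cross_vanish C j N (I : {set 'I_n * 'I_M}) r (i i' : 'I_M) :
  C != 0 -> i'.+1 = i -> (r, i) \in I -> (r, i') \in strip M j N :\: I ->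
  cross (stripc C) I (strip M j N :\: I) = 0.
Proof.
move=> nC ii iI i'I; rewrite /cross (bigD1 (r, i))//= (bigD1 (r, i'))//=.
have -> : q * stripc C (r, i') / stripc C (r, i) = 1.
  by rewrite /stripc /= -ii exprS; field; rewrite nC nx nq expf_neq0.
by rewrite th1 !mul0r.
Qed.

(** [subset_expansion] on the strip N / j, where [cross_vanish] leaves only
    the substrips k / j. *)
Theorem sum_bailey_term a b r1 r2 j N :
  let b' := b * r1 * r2 / (a * q) in let g := a * q / (r1 * r2) in
  a != 0 -> b != 0 -> r1 != 0 -> r2 != 0 ->
  (forall r, (j r <= N r)%N) -> (forall r, (N r <= M)%N) ->
  (forall r i, th (a * x r * q * q ^+ i) != 0) ->
  (forall r, tfact (a * x r * q / r1) (N r) != 0) ->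
  tfact (a * q / r2) (size N) != 0 ->
  (forall k, (forall r, (k r <= N r)%N) -> tfact (b * r2 / a) (size k) != 0) ->
  (forall k r, (forall r, (k r <= N r)%N) ->
    tfact (b * r1 * q ^+ (size N - N r) / (a * x r)) (size k) != 0) ->
  (forall i, th (b' * q ^+ i) != 0) ->
  \sum_(k : {ffun 'I_n -> 'I_M.+1} | [forall r, (j r <= k r <= N r)%N])
  bailey_term a b r1 r2 j N (fun r => k r) =
  bailey_total a b r1 r2 j N.
Proof.
move=> b' g na nb nr1 nr2 jN NM h1 h2 h3 h4 h5 h6.
have nqX i : q ^+ i != 0 by rewrite expf_neq0.
have h6' : th b' != 0 by have := h6 0%N; rewrite expr0 mulr1.
have h7 m : tfact (b * r1 * r2 / a) m != 0.
  apply/prodf_neq0 => i _; have := h6 i.+1; rewrite exprS mulrA.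
  by congr (th (_ * _) != 0); rewrite /b'; field; rewrite na nq.
rewrite (bailey_total_strip na nb nr1 nr2 (fun r => leqnn (j r)) jN NM)//.
have nu : r1 * q ^+ size j != 0 by rewrite mulf_neq0.
have nv : b * q ^+ (size N + size j) != 0 by rewrite mulf_neq0.
have nA : b' * q ^+ (2 * size j) != 0 by rewrite !mulf_neq0 ?invr_eq0 ?mulf_neq0.
have ndA i : th (b' * q ^+ (2 * size j) * q ^+ i) != 0 by rewrite -mulrA -exprD.
rewrite (subset_expansion nu nv nA ndA (separated_strip na j h1 _)).
rewrite sum_strips//; last first.
  move=> I r i i' IN ii iI i'I; rewrite /expansion_term /subset_term.
  by rewrite (cross_vanish _ ii iI i'I) ?mul0r// mulf_neq0.
rewrite mulr_sumr; apply: eq_bigr => k /forallP jkN.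
have jk r : (j r <= k r)%N by case/andP: (jkN r).
have kN r : (k r <= N r)%N by case/andP: (jkN r).
by rewrite -bailey_term_strip//; [exact: h4|move=> r; apply: h5].
Qed.
End Terms.

End Theta.

(** * Geometric convergence of sequences and products of complex numbers *)

Require Import Defs.
From mathcomp Require Import all_classical all_reals all_analysis.
From mathcomp Require Import complex.
From mathcomp Require Import ring lra zify.
Import Order.TTheory GRing.Theory Num.Theory numFieldNormedType.Exports.
Local Open Scope ring_scope.
Local Open Scope complex_scope.

Section Modulus.
Variable R : realType.
Implicit Types x y z : R[i].

(** The norm of R[i] takes its values in R[i]; estimates are more convenient
    in the ordered field R. *)
Definition cmod (x : R[i]) : R := ComplexField.Normc.normc x.

Lemma cmodE x : `|x| = (cmod x)%:C.
Proof. by case: x => a b; rewrite normc_def. Qed.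

Lemma cmod_ge0 x : 0 <= cmod x.
Proof. by rewrite -lecR -cmodE; exact: normr_ge0. Qed.

Lemma cmodM x y : cmod (x * y) = cmod x * cmod y.
Proof. exact: Normc.normcM. Qed.

Lemma cmodD x y : cmod (x + y) <= cmod x + cmod y.
Proof. exact: le_normcD. Qed.

Lemma cmodN x : cmod (- x) = cmod x.
Proof. exact: normcN. Qed.

Lemma cmodB x y : cmod (x - y) <= cmod x + cmod y.
Proof. by rewrite -(cmodN y) cmodD. Qed.

Lemma cmodV x : cmod x^-1 = (cmod x)^-1.
Proof. exact: Normc.normcV. Qed.

Lemma cmod1 : cmod 1 = 1. Proof. exact: Normc.normc1. Qed.
Lemma cmod0 : cmod 0 = 0. Proof. exact: Normc.normc0. Qed.

Lemma cmodX x n : cmod (x ^+ n) = cmod x ^+ n.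
Proof.
by elim: n => [|n IH]; rewrite ?expr0 ?cmod1// !exprS cmodM IH.
Qed.

Lemma cmod_eq0 x : (cmod x == 0) = (x == 0).
Proof. by apply/eqP/eqP => [/Normc.eq0_normc|->]; rewrite ?cmod0. Qed.

Lemma cmod_gt0 x : (0 < cmod x) = (x != 0).
Proof. by rewrite lt_def cmod_ge0 andbT cmod_eq0. Qed.

Lemma cmod_sum (I : Type) (s : seq I) (P : pred I) (f : I -> R[i]) :
  cmod (\sum_(i <- s | P i) f i) <= \sum_(i <- s | P i) cmod (f i).
Proof.
elim/big_ind2: _ => [|a b c d h1 h2|//]; first by rewrite cmod0.
by apply: le_trans (cmodD _ _) _; apply: lerD.
Qed.

Lemma cmod_Re x : `|complex.Re x| <= cmod x.
Proof. by rewrite -lecR -cmodE; exact: normc_ge_Re. Qed.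

Lemma cmod_Im x : `|complex.Im x| <= cmod x.
Proof.
case: x => a b; rewrite /cmod /= -[`|b|]sqrtr_sqr ler_wsqrtr//.
by rewrite lerDr sqr_ge0.
Qed.

Lemma cmod_le (a b : R) : cmod (a +i* b) <= `|a| + `|b|.
Proof.
rewrite -[leRHS]ger0_norm ?addr_ge0// -sqrtr_sqr ler_wsqrtr//=.
rewrite sqrrD !real_normK ?num_real// lerD2r lerDl.
by rewrite mulrn_wge0// mulr_ge0.
Qed.

(** The sequences v m - K r^m and v m + K r^m, with K = C / (1 - r), are
    monotone and enclose v; the limit is the supremum of the former. *)
Lemma geometric_cauchyR (r C : R) (v : nat -> R) : 0 <= r < 1 ->
  (forall m, `|v m.+1 - v m| <= C * r ^+ m) ->
  exists l, forall m, `|v m - l| <= C / (1 - r) * r ^+ m.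
Proof.
move=> /andP[r0 r1] hv; set K := C / (1 - r).
have CK : C = K * (1 - r) by rewrite divfK// subr_eq0 gt_eqF.
have inc : {homo (fun m => v m - K * r ^+ m) : m n / (m <= n)%N >-> m <= n}.
  apply: homo_leq => [//|y x z|m]; first exact: le_trans.
  have := hv m; rewrite CK ler_norml exprS => /andP[h _]; lra.
have dec : {homo (fun m => v m + K * r ^+ m) : m n / (m <= n)%N >-> n <= m}.
  apply: homo_leq => [//|y x z h1 h2|m]; first exact: le_trans h2 h1.
  have := hv m; rewrite CK ler_norml exprS => /andP[_ h]; lra.
have C0 : 0 <= C by have := le_trans (normr_ge0 _) (hv 0%N); rewrite expr0 mulr1.
have K0 : 0 <= K by rewrite divr_ge0// subr_ge0 ltW.
have ab m n : v m - K * r ^+ m <= v n + K * r ^+ n.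
  have Kr k : 0 <= K * r ^+ k by rewrite mulr_ge0 ?exprn_ge0.
  have [mn|nm] := leqP m n.
    by apply: le_trans (inc _ _ mn) _; have := Kr n; lra.
  by apply: le_trans (dec _ _ (ltnW nm)); have := Kr m; lra.
pose S := range (fun m => v m - K * r ^+ m).
have hS : has_sup S.
  split; first by exists (v 0%N - K * r ^+ 0); exists 0%N.
  by exists (v 0%N + K * r ^+ 0) => _ [m _ <-].
exists (sup S) => m.
have up : v m - K * r ^+ m <= sup S by apply: sup_upper_bound => //; exists m.
have lo : sup S <= v m + K * r ^+ m by apply: ge_sup => [|_ [k _ <-]//]; case: hS.
by rewrite ler_norml; apply/andP; split; lra.
Qed.

End Modulus.

Section GeometricConvergence.
Local Open Scope classical_set_scope.
Local Open Scope ring_scope.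
Variables (R : realType) (r : R).
Hypotheses (r0 : 0 <= r) (r1 : r < 1).
Implicit Types (u w : nat -> R[i]) (l k : R[i]).

(** Convergence with a geometric rate: it has the usual algebra of limits,
    and its rate permits to replace a truncation index by another. *)
Definition gcvg u l := exists C, forall m, cmod (u m - l) <= C * r ^+ m.

Lemma expr_small (e C : R) : 0 < e -> exists n, forall m, (n <= m)%N -> C * r ^+ m <= e.
Proof.
move=> e0; have [C0|C0] := leP C 0.
  exists 0%N => m _; apply: le_trans (ltW e0).
  by rewrite mulr_le0_ge0// exprn_ge0.
have : (fun m : nat => r ^+ m) @ \oo --> (0 : R).
  by apply: cvg_expr; rewrite ger0_norm.
move/cvgrPdist_le => /(_ (e / C)); rewrite divr_gt0// => /(_ isT) [n _ hn].
exists n => m nm; have := hn m nm.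
by rewrite sub0r normrN ger0_norm ?exprn_ge0// ler_pdivlMr// mulrC.
Qed.

Lemma gcvg_cvg u l : gcvg u l -> (u : nat -> R[i]^o) @ \oo --> (l : R[i]^o).
Proof.
move=> [C hC]; apply/cvgrPdist_le => /= e e0.
have [eR e'0] : e = (complex.Re e)%:C /\ 0 < complex.Re e.
  by move: e0; case: e => a b; rewrite ltcE /= => /andP[/eqP-> h].
have [n hn] := expr_small C e'0.
exists n => // m nm; rewrite distrC cmodE eR lecR.
exact: le_trans (hC m) (hn _ nm).
Qed.

Lemma gcvg_lim u l : gcvg u l -> limn (u : nat -> R[i]^o) = l.
Proof. by move=> /gcvg_cvg h; apply: cvg_lim => //; exact: norm_hausdorff. Qed.

Lemma gcvg_uniq u l k : gcvg u l -> gcvg u k -> l = k.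
Proof. by move=> /gcvg_lim <- /gcvg_lim <-. Qed.

Lemma gcvg_ext u w l : (forall m, u m = w m) -> gcvg u l -> gcvg w l.
Proof. by move=> uw [C h]; exists C => m; rewrite -uw. Qed.

Lemma gcvg_cst l : gcvg (fun=> l) l.
Proof. by exists 0 => m; rewrite subrr cmod0 mul0r. Qed.

Lemma gcvg_const_ge0 u l C : (forall m, cmod (u m - l) <= C * r ^+ m) -> 0 <= C.
Proof.
by move=> /(_ 0%N); rewrite expr0 mulr1; apply: le_trans; exact: cmod_ge0.
Qed.

Lemma gcvgD u w l k : gcvg u l -> gcvg w k -> gcvg (fun m => u m + w m) (l + k).
Proof.
move=> [C hC] [D hD]; exists (C + D) => m.
have -> : u m + w m - (l + k) = (u m - l) + (w m - k) by ring.
by rewrite mulrDl; apply: le_trans (cmodD _ _) _; apply: lerD.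
Qed.

Lemma gcvg_bound u l : gcvg u l -> exists2 B, 0 <= B & forall m, cmod (u m) <= B.
Proof.
move=> [C hC]; have C0 := gcvg_const_ge0 hC.
exists (C + cmod l); first by rewrite addr_ge0// cmod_ge0.
move=> m; rewrite -[u m](subrK l); apply: le_trans (cmodD _ _) _.
rewrite lerD2r; apply: le_trans (hC m) _.
by rewrite ler_piMr// exprn_ile1// ltW.
Qed.

Lemma gcvgM u w l k : gcvg u l -> gcvg w k -> gcvg (fun m => u m * w m) (l * k).
Proof.
move=> hu; have [B B0 hB] := gcvg_bound hu; case: hu => C hC [D hD].
have C0 := gcvg_const_ge0 hC.
exists (B * D + C * cmod k) => m.
have -> : u m * w m - l * k = u m * (w m - k) + (u m - l) * k by ring.
apply: le_trans (cmodD _ _) _; rewrite !cmodM.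
have h1 : cmod (u m) * cmod (w m - k) <= B * (D * r ^+ m).
  by rewrite ler_pM ?cmod_ge0.
have h2 : cmod (u m - l) * cmod k <= C * r ^+ m * cmod k.
  by rewrite ler_wpM2r ?cmod_ge0.
by apply: le_trans (lerD h1 h2) _; rewrite le_eqVlt; apply/orP; left; apply/eqP; ring.
Qed.

Lemma gcvgZ c u l : gcvg u l -> gcvg (fun m => c * u m) (c * l).
Proof. by apply: gcvgM; apply: gcvg_cst. Qed.

Lemma gcvgB u w l k : gcvg u l -> gcvg w k -> gcvg (fun m => u m - w m) (l - k).
Proof.
move=> hu /(gcvgZ (-1)) hw; rewrite -mulN1r; apply: gcvg_ext (gcvgD hu hw) => m.
by rewrite mulN1r.
Qed.

Lemma gcvg_expr z : cmod z <= r -> gcvg (fun m => z ^+ m) 0.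
Proof.
move=> zr; exists 1 => m; rewrite subr0 cmodX mul1r.
by apply: lerXn2r; rewrite ?nnegrE ?cmod_ge0.
Qed.

Lemma gcvg_geometric C u : (forall m, cmod (u m.+1 - u m) <= C * r ^+ m) ->
  exists l, gcvg u l.
Proof.
move=> hu.
have hr : 0 <= r < 1 by rewrite r0.
have hRe m : `|complex.Re (u m.+1) - complex.Re (u m)| <= C * r ^+ m.
  by apply: le_trans (hu m); rewrite -raddfB cmod_Re.
have hIm m : `|complex.Im (u m.+1) - complex.Im (u m)| <= C * r ^+ m.
  by apply: le_trans (hu m); rewrite -raddfB cmod_Im.
have [a ha] := geometric_cauchyR hr hRe.
have [b hb] := geometric_cauchyR hr hIm.
exists (a +i* b); exists (C / (1 - r) + C / (1 - r)) => m.
have -> : u m - (a +i* b) = (complex.Re (u m) - a) +i* (complex.Im (u m) - b).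
  by case: (u m).
by rewrite mulrDl; apply: le_trans (cmod_le _ _) _; apply: lerD.
Qed.

(** Beyond some n the cmod (z j) add up to at most 1/2, so that the partial
    products stay above 1 - 1/2; their inverses do as well since
    (1 - x) (1 + x) <= 1. *)
Lemma prod_tail_bounds C (z : nat -> R[i]) :
  (forall j, cmod (z j) <= C * r ^+ j) ->
  exists n, forall m, 2^-1 <= cmod (\prod_(n <= j < m) (1 - z j)) <= 2.
Proof.
move=> hz; have C0 : 0 <= C.
  by have := le_trans (cmod_ge0 _) (hz 0%N); rewrite expr0 mulr1.
have d0 : 0 < 1 - r by rewrite subr_gt0.
have [n hn] := expr_small (C / (1 - r)) (e := 2^-1) ltac:(by rewrite invr_gt0).
exists n => m; have {hn} := hn n (leqnn n); set K := C / (1 - r) => hn.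
have CK : C = K * (1 - r) by rewrite divfK// gt_eqF.
have K0 : 0 <= K by rewrite divr_ge0// ltW.
have [mn|nm] := leqP m n.
  by rewrite big_geq// cmod1; apply/andP; split; lra.
(* L is the product of the 1 - cmod (z j), a lower bound both of the modulus
   P of the partial product and of 1 / P. *)
have aux (k : nat) : (n <= k)%N -> exists2 L, 1 - K * r ^+ n + K * r ^+ k <= L &
     0 <= L /\ L <= cmod (\prod_(n <= j < k) (1 - z j)) /\
     L * cmod (\prod_(n <= j < k) (1 - z j)) <= 1 /\ L <= 1.
  elim: k => [|k IH].
    rewrite leqn0 => /eqP n0; rewrite big_geq ?n0// cmod1; exists 1; last lra.
    by lra.
  rewrite leq_eqVlt => /predU1P[nk|nk].
    rewrite -nk big_geq// cmod1; exists 1; last lra.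
    by lra.
  have [L hL [L0 [LP [LU L1]]]] := IH nk.
  rewrite big_nat_recr//= cmodM; set P := cmod _ in LP LU *.
  set x := cmod (z k); have x0 : 0 <= x := cmod_ge0 _.
  have xk : x <= K * r ^+ k - K * r ^+ k.+1.
    by have := hz k; rewrite -/x CK exprS; lra.
  have rk0 : 0 <= K * r ^+ k by rewrite mulr_ge0 ?exprn_ge0.
  have rk1 : 0 <= K * r ^+ k.+1 by rewrite mulr_ge0 ?exprn_ge0.
  have rkn : K * r ^+ k <= K * r ^+ n by rewrite ler_wpM2l// ler_wiXn2l// ltW.
  have x1 : x <= 1 by lra.
  have hl : 1 - x <= cmod (1 - z k).
    have := cmodD (1 - z k) (z k); rewrite subrK cmod1 -/x; lra.
  have hu : cmod (1 - z k) <= 1 + x.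
    by have := cmodB 1 (z k); rewrite cmod1.
  have P0 : 0 <= P := cmod_ge0 _.
  exists (L * (1 - x)).
    have : x * L <= x by rewrite ler_piMr.
    lra.
  split; first by rewrite mulr_ge0// subr_ge0.
  split; first by rewrite ler_pM// subr_ge0.
  split; last by rewrite mulr_ile1// ?subr_ge0//; lra.
  apply: (@le_trans _ _ ((L * P) * ((1 - x) * (1 + x)))).
    rewrite mulrACA; apply: ler_wpM2l; first exact: mulr_ge0.
    by rewrite ler_wpM2l// subr_ge0.
  rewrite mulr_ile1 ?mulr_ge0 ?subr_ge0//; first lra.
  have : 0 <= x * x by rewrite mulr_ge0.
  lra.
have [L hL [L0 [LP [LU L1]]]] := aux m (ltnW nm).
have hL2 : 2^-1 <= L.
  have : 0 <= K * r ^+ m by rewrite mulr_ge0 ?exprn_ge0.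
  lra.
apply/andP; split; first exact: le_trans hL2 LP.
have P0 : 0 <= cmod (\prod_(n <= j < m) (1 - z j)) := cmod_ge0 _.
nra.
Qed.

Lemma prod_cvg C (z : nat -> R[i]) :
  (forall j, cmod (z j) <= C * r ^+ j) ->
  exists l, gcvg (fun m => \prod_(j < m) (1 - z j)) l.
Proof.
move=> hz; suff [V hV] : exists V, forall m, cmod (\prod_(0 <= j < m) (1 - z j)) <= V.
  apply: (@gcvg_geometric (V * C)) => m; rewrite big_ord_recr /=.
  set P := \prod_(_ < m) _.
  have -> : P * (1 - z m) - P = - (P * z m) by ring.
  rewrite cmodN cmodM -mulrA ler_pM ?cmod_ge0//.
  by have := hV m; rewrite big_mkord.
have [n hn] := prod_tail_bounds hz.
have {hn} : exists V, forall m, cmod (\prod_(n <= j < m) (1 - z j)) <= V.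
  by exists 2 => m; have /andP[] := hn m.
elim: n => // n IH [V hV]; apply: IH; exists (1 + cmod (1 - z n) * V) => m.
have V0 : 0 <= V by apply: le_trans (cmod_ge0 _) (hV 0%N).
have V1 : 0 <= cmod (1 - z n) * V by rewrite mulr_ge0 ?cmod_ge0.
have [mn|nm] := leqP m n; first by rewrite big_geq// cmod1; lra.
rewrite big_ltn// cmodM.
have : cmod (1 - z n) * cmod (\prod_(n.+1 <= i < m) (1 - z i)) <= cmod (1 - z n) * V.
  by rewrite ler_wpM2l ?cmod_ge0.
lra.
Qed.

Lemma prod_bounds C (z : nat -> R[i]) :
  (forall j, cmod (z j) <= C * r ^+ j) -> (forall j, z j != 1) ->
  exists V, forall m, cmod (\prod_(j < m) (1 - z j)) <= V /\
     cmod (\prod_(j < m) (1 - z j))^-1 <= V.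
Proof.
move=> hz nz; have [n hn] := prod_tail_bounds hz.
suff: exists V, forall m, cmod (\prod_(0 <= j < m) (1 - z j)) <= V /\
     cmod (\prod_(0 <= j < m) (1 - z j))^-1 <= V.
  by move=> [V h]; exists V => m; have := h m; rewrite big_mkord.
have {hn} : exists V, forall m, cmod (\prod_(n <= j < m) (1 - z j)) <= V /\
     cmod (\prod_(n <= j < m) (1 - z j))^-1 <= V.
  exists 2 => m; have /andP[h1 h2] := hn m; split=> //.
  by rewrite cmodV invf_ple ?posrE// (lt_le_trans _ h1)// invr_gt0.
elim: n => // n IH [V hV]; apply: IH.
set w := 1 - z n; have w0 : 0 < cmod w by rewrite cmod_gt0 subr_eq0 eq_sym nz.
have V0 : 0 <= V by apply: le_trans (cmod_ge0 _) (hV 0%N).1.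
exists (1 + V * cmod w + V * (cmod w)^-1) => m.
have V1 : 0 <= V * cmod w by rewrite mulr_ge0// cmod_ge0.
have V2 : 0 <= V * (cmod w)^-1 by rewrite mulr_ge0// invr_ge0 cmod_ge0.
have [mn|nm] := leqP m n; first by rewrite big_geq// invr1 cmod1; split; lra.
have [h1 h2] := hV m; rewrite big_ltn// -/w invfM !cmodM; split.
  have : cmod w * cmod (\prod_(n.+1 <= i < m) (1 - z i)) <= cmod w * V.
    by rewrite ler_wpM2l// ltW.
  lra.
have : cmod w^-1 * cmod (\prod_(n.+1 <= i < m) (1 - z i))^-1 <= (cmod w)^-1 * V.
  by rewrite cmodV ler_wpM2l// invr_ge0 ltW.
lra.
Qed.

Lemma prod_gcvg_neq0 C (z : nat -> R[i]) :
  (forall j, cmod (z j) <= C * r ^+ j) -> (forall j, z j != 1) ->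
  exists2 l, l != 0 & gcvg (fun m => \prod_(j < m) (1 - z j)) l /\
    gcvg (fun m => (\prod_(j < m) (1 - z j))^-1) l^-1.
Proof.
move=> hz nz; have [V hV] := prod_bounds hz nz.
have V0 : 0 <= V by apply: le_trans (cmod_ge0 _) (hV 0%N).1.
have [l hl] := prod_cvg hz.
have [k hk] : exists l, gcvg (fun m => (\prod_(j < m) (1 - z j))^-1) l.
  apply: (@gcvg_geometric (V * C)) => m.
  have h := (hV m.+1).2.
  have -> : (\prod_(j < m.+1) (1 - z j))^-1 - (\prod_(j < m) (1 - z j))^-1 =
      (\prod_(j < m.+1) (1 - z j))^-1 * z m.
    rewrite big_ord_recr /=; field.
    rewrite subr_eq0 eq_sym nz /=.
    by apply/prodf_neq0 => i _; rewrite subr_eq0 eq_sym nz.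
  by rewrite cmodM -mulrA ler_pM ?cmod_ge0.
have lk : l * k = 1.
  apply: gcvg_uniq (gcvg_cst 1); apply: gcvg_ext (gcvgM hl hk) => m.
  rewrite divff//; apply/prodf_neq0 => i _; by rewrite subr_eq0 eq_sym nz.
have l0 : l != 0 by apply/eqP => l0; move/eqP: lk; rewrite l0 mul0r eq_sym oner_eq0.
exists l => //; split=> //.
by have -> : l^-1 = k by apply: (mulfI l0); rewrite lk divff.
Qed.

End GeometricConvergence.

(** * Inversion and quasi-periodicity of theta *)

Section ThetaProduct.
Variables (R : realType) (p : R[i]).
Hypothesis p1 : cmod p < 1.
Let r := cmod p.
Let r0 : 0 <= r := cmod_ge0 p.
Implicit Types a x e : R[i].

Definition thetap m a := \prod_(j < m) ((1 - a * p ^+ j) * (1 - p ^+ j.+1 / a)).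

Lemma thetapE m a : thetap m a =
  (\prod_(j < m) (1 - a * p ^+ j)) * \prod_(j < m) (1 - p ^+ j.+1 / a).
Proof. exact: big_split. Qed.

Lemma cmod_mul_expr a j : cmod (a * p ^+ j) <= cmod a * r ^+ j.
Proof. by rewrite cmodM cmodX. Qed.

Lemma cmod_expr_div a j : cmod (p ^+ j.+1 / a) <= r / cmod a * r ^+ j.
Proof. by rewrite cmodM cmodX cmodV exprS mulrAC. Qed.

Lemma theta_gcvg a : gcvg r (thetap ^~ a) (theta p a).
Proof.
have [l hl] := prod_cvg r0 p1 (cmod_mul_expr a).
have [k hk] := prod_cvg r0 p1 (cmod_expr_div a).
have h : gcvg r (thetap ^~ a) (l * k).
  by apply: gcvg_ext (gcvgM r0 p1 hl hk) => m; rewrite thetapE.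
by rewrite /theta (gcvg_lim r0 p1 h).
Qed.

Lemma theta_neq0 a : (forall j, a * p ^+ j != 1) -> (forall j, p ^+ j.+1 / a != 1) ->
  theta p a != 0.
Proof.
move=> h1 h2.
have [l l0 [hl _]] := prod_gcvg_neq0 r0 p1 (cmod_mul_expr a) h1.
have [k k0 [hk _]] := prod_gcvg_neq0 r0 p1 (cmod_expr_div a) h2.
have h : gcvg r (thetap ^~ a) (l * k).
  by apply: gcvg_ext (gcvgM r0 p1 hl hk) => m; rewrite thetapE.
by rewrite (gcvg_uniq r0 p1 (theta_gcvg a) h) mulf_neq0.
Qed.

Lemma theta1 : theta p 1 = 0.
Proof.
apply: (gcvg_uniq r0 p1 (theta_gcvg 1)); exists 1; case=> [|m].
  by rewrite /thetap big_ord0 subr0 cmod1 expr0 mulr1.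
by rewrite /thetap big_ord_recl expr0 mulr1 subrr !mul0r subr0 cmod0 mul1r exprn_ge0.
Qed.

Lemma prod_shift (f : nat -> R[i]) m :
  f 0%N * \prod_(j < m) f j.+1 = (\prod_(j < m) f j) * f m.
Proof. by rewrite -(big_ord_recr m (fun j => f (nat_of_ord j)))/= big_ord_recl. Qed.

Lemma gcvg_cexpr c : gcvg r (fun m => 1 - c * p ^+ m) 1.
Proof.
rewrite -[in X in gcvg _ _ X](subr0 1) -(mulr0 c).
by apply: gcvgB => //; [exact: gcvg_cst|apply: gcvgZ => //; exact: gcvg_expr].
Qed.

(** The truncations of theta at y = 1/x and at x agree up to boundary factors,
    which the hypothesis clears; two of them tend to 1. *)
Lemma theta_shift x y : x != 0 -> x != 1 -> y != 0 ->
  (forall m, thetap m y * (1 - x) * (1 - p ^+ m / x) =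
     thetap m x * (1 - x * p ^+ m) * (1 - x^-1)) ->
  theta p y = - theta p x / x.
Proof.
move=> x0 nx1 y0 h.
have := gcvgM r0 p1 (gcvgM r0 p1 (theta_gcvg y) (gcvg_cst r (1 - x)))
   (gcvg_cexpr x^-1).
have := gcvgM r0 p1 (gcvgM r0 p1 (theta_gcvg x) (gcvg_cexpr x))
   (gcvg_cst r (1 - x^-1)).
rewrite !mulr1 => h1 h2.
have e : theta p y * (1 - x) = theta p x * (1 - x^-1).
  apply: (gcvg_uniq r0 p1 h2); apply: gcvg_ext h1 => m.
  by rewrite -h [x^-1 * _]mulrC.
have n1 : 1 - x != 0 by rewrite subr_eq0 eq_sym.
by apply: (mulIf n1); rewrite e; field.
Qed.

Lemma thetaV x : x != 0 -> theta p x^-1 = - theta p x / x.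
Proof.
move=> x0; have [->|nx1] := eqVneq x 1; first by rewrite invr1 theta1 oppr0 mul0r.
apply: theta_shift; rewrite ?invr_eq0// => m.
rewrite !thetapE invrK.
have := prod_shift (fun j => 1 - x * p ^+ j) m.
have := prod_shift (fun j => 1 - p ^+ j / x) m.
rewrite !expr0 mulr1 div1r => h1 h2.
have -> : \prod_(j < m) (1 - x^-1 * p ^+ j) = \prod_(j < m) (1 - p ^+ j / x).
  by apply: eq_bigr => j _; rewrite mulrC.
have -> : \prod_(j < m) (1 - p ^+ j.+1 * x) = \prod_(j < m) (1 - x * p ^+ j.+1).
  by apply: eq_bigr => j _; rewrite mulrC.
set P1 := \prod_(j < m) (1 - p ^+ j / x) in h1 *.
set P2 := \prod_(j < m) (1 - x * p ^+ j.+1) in h2 *.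
transitivity ((P1 * (1 - p ^+ m / x)) * ((1 - x) * P2)); first by ring.
by rewrite -h1 h2; ring.
Qed.

Hypothesis p0 : p != 0.

Lemma thetaMp x : x != 0 -> theta p (p * x) = - theta p x / x.
Proof.
move=> x0; rewrite -thetaV//; apply: (gcvg_uniq r0 p1 (theta_gcvg _)).
apply: gcvg_ext (theta_gcvg x^-1) => m; rewrite !thetapE mulrC.
congr (_ * _); apply: eq_bigr => j _; congr (1 - _).
  by rewrite invrK exprS; ring.
by rewrite exprS; field; rewrite x0 p0.
Qed.

Lemma theta_pexp (k : int) : exists2 l, l != 0 & exists d : int,
  forall x, x != 0 -> theta p (p ^ k * x) = l * x ^ d * theta p x.
Proof.
have up (j : int) : (exists2 l, l != 0 & exists d : int,
    forall x, x != 0 -> theta p (p ^ j * x) = l * x ^ d * theta p x) ->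
  exists2 l, l != 0 & exists d : int,
    forall x, x != 0 -> theta p (p ^ (j + 1) * x) = l * x ^ d * theta p x.
  move=> [l l0 [d h]]; exists (- (l / p ^ j)).
    by rewrite oppr_eq0 mulf_neq0 ?invr_eq0 ?expfz_neq0.
  exists (d - 1) => x x0.
  rewrite (addrC j) expfzDr// expr1z -(mulrA p) thetaMp ?mulf_neq0 ?expfz_neq0//.
  rewrite h// expfzDr// -(exprnN x 1) expr1.
  by field; rewrite x0 expfz_neq0.
have down (j : int) : (exists2 l, l != 0 & exists d : int,
    forall x, x != 0 -> theta p (p ^ j * x) = l * x ^ d * theta p x) ->
  exists2 l, l != 0 & exists d : int,
    forall x, x != 0 -> theta p (p ^ (j - 1) * x) = l * x ^ d * theta p x.
  move=> [l l0 [d h]]; exists (- (l * p ^ (j - 1))).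
    by rewrite oppr_eq0 mulf_neq0 ?expfz_neq0.
  exists (d + 1) => x x0.
  have nz : p ^ (j - 1) * x != 0 by rewrite mulf_neq0 ?expfz_neq0.
  have pj : p * p ^ (j - 1) = p ^ j by rewrite -{1}[p]expr1z -expfzDr// addrC subrK.
  have := thetaMp nz; rewrite mulrA pj h// => e.
  rewrite (@expfzDr _ x d 1)// expr1z; apply: (mulIf nz).
  transitivity (- (l * x ^ d * theta p x) * (p ^ (j - 1) * x) ^+ 2).
    by rewrite e; field; rewrite x0 expfz_neq0.
  by ring.
elim: k => [|n IH|n IH].
- by exists 1; [exact: oner_neq0|exists 0 => x _; rewrite expr0z !mul1r].
- by rewrite -addn1 PoszD; apply: up.
- by rewrite -addn1 PoszD opprD; apply: down.
Qed.

(** By [theta_neq0] the zeros of theta are powers of p. *)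
Lemma theta_quasi e : e != 0 -> theta p e = 0 -> exists2 l, l != 0 & exists d : int,
  forall x, x != 0 -> theta p (e * x) = l * x ^ d * theta p x.
Proof.
move=> e0 te; have [k ->] : exists k : int, e = p ^ k; last exact: theta_pexp.
have [[j ej]|h1] := pselect (exists j : nat, e * p ^+ j = 1).
  exists (- j%:Z); apply: (mulIf (expf_neq0 j p0)).
  by rewrite ej -exprnN mulVf// expf_neq0.
have [[j ej]|h2] := pselect (exists j : nat, p ^+ j.+1 / e = 1).
  exists j.+1%:Z; rewrite -exprnP; apply/esym.
  by rewrite -[LHS](divfK e0) ej mul1r.
have /eqP[] : theta p e != 0; last by [].
apply: theta_neq0 => j; apply/eqP => h; [apply: h1|apply: h2]; by exists j.
Qed.
End ThetaProduct.

(** * Jacobi's triple product *)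

Definition zsum (V : nmodType) m (g : int -> V) := \sum_(i < (2 * m).+1) g (i%:Z - m%:Z).

Lemma zsumS (V : nmodType) m (g : int -> V) :
  zsum m.+1 g = zsum m g + (g m.+1%:Z + g (- m.+1%:Z)).
Proof.
rewrite /zsum mulnS add2n big_ord_recr big_ord_recl /= sub0r addrC addrA addrC.
congr (_ + (g _ + _)).
  by apply: eq_bigr => i _; congr g; rewrite /bump /= add1n -[i.+1]addn1 -[m.+1]addn1 !PoszD; ring.
by rewrite -[(2 * m).+2]/(2 + 2 * m)%N PoszD -[m.+1]addn1 PoszD PoszM; ring.
Qed.

(** The terms of the truncated series decay like r ^+ `|k|, the coefficients
    in [finite_triple] converge like r ^+ i and r ^+ (2 * m - i); the two
    rates add up to m. *)
Lemma dist_le_l (m i : nat) : (m <= `|i%:Z - m%:Z| + i)%N.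
Proof. lia. Qed.

Lemma dist_le_r (m i : nat) : (i <= 2 * m)%N ->
  (m <= `|i%:Z - m%:Z| + (2 * m - i))%N.
Proof. lia. Qed.

Section FiniteTriple.
Variables (F : fieldType) (s p : F).
Hypotheses (s0 : s != 0) (sp : s ^+ 2 = p).
Hypothesis np : forall i, p ^+ i.+1 != 1.

Let p0 : p != 0. Proof. by rewrite -sp expf_neq0. Qed.

Definition euler n := \prod_(i < n) (1 - p ^+ i.+1).

Lemma euler_neq0 n : euler n != 0.
Proof. by apply/prodf_neq0 => i _; rewrite subr_eq0 eq_sym np. Qed.

Definition qbinom n i := euler n / (euler i * euler (n - i)).

Lemma qbinomS n i : (i < n)%N ->
  qbinom n.+1 i.+1 = qbinom n i.+1 + p ^+ (n - i) * qbinom n i.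
Proof.
move=> lt; rewrite /qbinom subSS; have [d dE] : exists d, (n - i = d.+1)%N.
  by exists (n - i.+1)%N; rewrite subnSK.
have -> : (n - i.+1 = d)%N by rewrite subnS dE.
rewrite dE [euler n.+1]big_ord_recr [euler i.+1]big_ord_recr [euler d.+1]big_ord_recr /=.
have -> : p ^+ n.+1 = p ^+ d.+1 * p ^+ i.+1.
  by rewrite -exprD addnS -dE subnK// ltnW.
rewrite -/(euler n) -/(euler i) -/(euler d); field.
by rewrite !euler_neq0 !subr_eq0 ![1 == _]eq_sym !np.
Qed.

Lemma qbinom0 n : qbinom n 0 = 1.
Proof. by rewrite /qbinom subn0 {2}/euler big_ord0 mul1r divff// euler_neq0. Qed.

Lemma qbinomn n : qbinom n n = 1.
Proof. by rewrite /qbinom subnn {3}/euler big_ord0 mulr1 divff// euler_neq0. Qed.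

Let c (i : nat) := (-1) ^+ i * s ^ (i%:Z * (i%:Z - 1)).

Lemma cS i : c i.+1 = - c i * p ^+ i.
Proof.
have e : s ^ (i.+1%:Z * (i.+1%:Z - 1)) = s ^ (i%:Z * (i%:Z - 1)) * s ^+ (2 * i).
  rewrite exprnP -expfzDr//; congr (s ^ _).
  by rewrite -[i.+1]addn1 PoszD PoszM; ring.
by rewrite /c exprS e -sp exprM; ring.
Qed.

(** The q-binomial theorem, in base p. *)
Lemma qbinomial n b : \prod_(j < n) (1 - b * p ^+ j) =
  \sum_(i < n.+1) c i * b ^+ i * qbinom n i.
Proof.
elim: n => [|n IH].
  by rewrite big_ord0 big_ord1 qbinom0 /c !expr0 mul0r expr0z !mulr1.
rewrite big_ord_recr /= IH mulrBr mulr1.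
set A := fun i => c i * b ^+ i * qbinom n i.
have e1 : \sum_(i < n.+1) A i = c 0%N + \sum_(i < n) A i.+1.
  by rewrite big_ord_recl /A expr0 qbinom0 !mulr1.
have e2 : \sum_(i < n.+1) A i = \sum_(i < n) A i + c n * b ^+ n.
  by rewrite big_ord_recr /= /A qbinomn mulr1.
rewrite [X in X - _]e1 [X in _ - X * _]e2 big_ord_recl expr0 qbinom0 !mulr1.
have -> : \sum_(i < n.+1) c (bump 0 i) * b ^+ bump 0 i * qbinom n.+1 (bump 0 i) =
    \sum_(i < n) (A i.+1 - A i * (b * p ^+ n)) + c n.+1 * b ^+ n.+1.
  rewrite big_ord_recr /= /bump !add1n qbinomn mulr1; congr (_ + _).
  apply: eq_bigr => i _; rewrite add1n qbinomS// /A cS.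
  have -> : p ^+ n = p ^+ i * p ^+ (n - i) by rewrite -exprD subnKC// ltnW.
  by rewrite exprS; ring.
by rewrite big_split /= sumrN -mulr_suml cS exprS; ring.
Qed.

(** The general term of the theta series; s is a square root of the base, so
    that its half-integral exponents become integral. *)
Definition jterm a (k : int) := (-1) ^ k * s ^ (k * (k - 1)) * a ^ k.

(** The finite form of the triple product: the product on the left is, up to a
    monomial, the q-binomial product of length 2 m starting at a / p^m. *)
Lemma finite_triple m a : a != 0 ->
  \prod_(j < m) ((1 - a * p ^+ j) * (1 - p ^+ j.+1 / a)) =
  \sum_(i < (2 * m).+1) jterm a (i%:Z - m%:Z) * qbinom (2 * m) i.
Proof.
move=> a0.
have n1 : (-1 : F) != 0 by rewrite oppr_eq0 oner_neq0.
pose D n := \prod_(j < n) (- a / p ^+ j.+1).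
have DE n : D n = (-1) ^+ n * a ^+ n * s ^ (- (n%:Z * (n%:Z + 1))).
  rewrite /D; elim: n => [|n IH].
    by rewrite big_ord0 mul0r oppr0 expr0z !expr0 !mulr1.
  have -> : s ^ (- (n.+1%:Z * (n.+1%:Z + 1))) =
      s ^ (- (n%:Z * (n%:Z + 1))) / p ^+ n.+1.
    rewrite -sp -exprM exprnN -expfzDr//; congr (s ^ _).
    by rewrite PoszM -[n.+1]addn1 PoszD; ring.
  by rewrite big_ord_recr /= IH !exprS; field; rewrite p0 expf_neq0.
have D0 : D m != 0.
  apply/prodf_neq0 => j _; by rewrite mulf_neq0 ?oppr_eq0 ?invr_eq0 ?expf_neq0.
apply: (mulfI D0).
transitivity (\prod_(j < 2 * m) (1 - a / p ^+ m * p ^+ j)).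
  rewrite mul2n -addnn big_split_ord /= big_split /= mulrCA mulrC.
  congr (_ * _); last first.
    apply: eq_bigr => j _; congr (1 - _).
    by rewrite exprD mulrA divfK// expf_neq0.
  rewrite /D -big_split [RHS](reindex_inj rev_ord_inj)/=; apply: eq_bigr => j _.
  have -> : p ^+ m = p ^+ (m - j.+1) * p ^+ j.+1 by rewrite -exprD subnK.
  by field; rewrite a0 !expf_neq0.
rewrite qbinomial mulr_sumr; apply: eq_bigr => i _.
rewrite [RHS]mulrA; congr (_ * _); rewrite DE /jterm /c expr_div_n.
rewrite (expfzDr _ _ n1) (expfzDr _ _ a0) -(exprnN (-1)) -(exprnN a) -!exprnP.
have -> : s ^ ((i%:Z - m%:Z) * (i%:Z - m%:Z - 1)) =
    s ^ (i%:Z * (i%:Z - 1)) * s ^ (m%:Z * (m%:Z + 1)) / p ^+ m ^+ i.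
  rewrite -exprM -sp -exprM exprnN -!expfzDr//; congr (s ^ _).
  by rewrite !PoszM; ring.
rewrite -invr_expz; field.
by rewrite !expf_neq0// expfz_neq0.
Qed.

End FiniteTriple.

Section ZSum.
Variables (R : realType) (r : R).
Hypotheses (r0 : 0 < r) (r1 : r < 1).
Let r0' := ltW r0.
Let r1' := ltW r1.

Lemma zsum_geometric m :
  (1 - r) * zsum m (fun k => r ^+ `|k|%N) = 1 + r - 2 * r ^+ m.+1.
Proof.
elim: m => [|m IH].
  by rewrite /zsum muln0 big_ord1 subr0 absz0 expr0 expr1; ring.
rewrite zsumS mulrDr IH abszN absz_nat !exprS; ring.
Qed.

Lemma zsum_geometric_le m : zsum m (fun k => r ^+ `|k|%N) <= 2 / (1 - r).
Proof.
have d0 : 0 < 1 - r by rewrite subr_gt0.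
rewrite ler_pdivlMr// mulrC zsum_geometric.
have : 0 <= r ^+ m.+1 by rewrite exprn_ge0.
by move: r1; lra.
Qed.

(** A Gaussian weight beats every exponential: the base r ^+ n * w is
    eventually below 1. *)
Lemma gauss_bound (w : R) : 0 < w -> exists D, forall n, (r ^+ n * w) ^+ n <= D.
Proof.
move=> w0; have [n hn] := expr_small r0' r1 w ltr01.
exists ((1 + w) ^+ n) => k.
have p0 : 0 <= r ^+ k * w by rewrite mulr_ge0 ?exprn_ge0// ltW.
have w1 : 1 <= 1 + w by rewrite lerDl ltW.
have [nk|kn] := leqP n k.
  apply: (@le_trans _ _ 1); last by rewrite exprn_ege1.
  by rewrite exprn_ile1// mulrC hn.
apply: (@le_trans _ _ ((1 + w) ^+ k)); last by rewrite ler_weXn2l// ltnW.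
rewrite lerXn2r ?nnegrE//; first by rewrite addr_ge0// ltW.
have : r ^+ k * w <= w by rewrite ler_piMl ?exprn_ile1// ltW.
lra.
Qed.

Lemma zsum_gcvg (g : int -> R[i]) D :
  (forall k, cmod (g k) <= D * r ^+ `|k|%N) -> exists l, gcvg r (fun m => zsum m g) l.
Proof.
move=> hg; have D0 : 0 <= D.
  by have := le_trans (cmod_ge0 _) (hg 0); rewrite absz0 expr0 mulr1.
apply: (gcvg_geometric r0' r1 (C := 2 * D)) => m.
rewrite zsumS addrAC subrr add0r; apply: le_trans (cmodD _ _) _.
have := lerD (hg m.+1%:Z) (hg (- m.+1%:Z)); rewrite abszN absz_nat => h.
apply: le_trans h _.
have : D * r ^+ m.+1 <= D * r ^+ m by rewrite ler_wpM2l// ler_wiXn2l.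
lra.
Qed.

End ZSum.

Section TripleProduct.
Variables (R : realType) (p s : R[i]).
Hypotheses (p0 : p != 0) (p1 : cmod p < 1) (sp : s ^+ 2 = p).
Let r := cmod p.
Let r0 : 0 < r. Proof. by rewrite cmod_gt0. Qed.
Let r0' := ltW r0.
Let s0 : s != 0. Proof. by apply: contraNneq p0 => s0; rewrite -sp s0 expr0n. Qed.

Let np i : p ^+ i.+1 != 1.
Proof.
apply/eqP => h; have := cmodX p i.+1; rewrite h cmod1 => /esym/eqP.
by rewrite lt_eqF// exprn_ilt1// cmod_ge0.
Qed.

Let tau := cmod s.
Let tau0 : 0 < tau. Proof. by rewrite cmod_gt0. Qed.
Let tau2 : tau ^+ 2 = r. Proof. by rewrite -cmodX sp. Qed.
Let tau1 : tau < 1.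
Proof.
rewrite ltNge; apply/negP => h; have := p1; rewrite -/r -tau2 ltNge.
by rewrite exprn_ege1.
Qed.

Lemma cmodXz (x : R[i]) (k : int) : cmod (x ^ k) = cmod x ^ k.
Proof.
case: k => n; first by rewrite -!exprnP cmodX.
by rewrite NegzE -!exprnN cmodV cmodX.
Qed.

Lemma cmod_jterm (a : R[i]) (k : int) :
  cmod (jterm s a k) = tau ^ (k * (k - 1)) * cmod a ^ k.
Proof.
rewrite /jterm !cmodM !cmodXz cmodN cmod1 exp1rz mul1r//.
Qed.

(** The bound r ^+ (2 `|k|) is stronger than the r ^+ `|k| needed for
    summability; one half of the decay pays for the convergence of the
    q-binomial coefficients. *)
Lemma jterm_bound (a : R[i]) : a != 0 ->
  exists D, forall k : int, cmod (jterm s a k) <= D * r ^+ (2 * `|k|%N).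
Proof.
move=> a0; have c0 : 0 < cmod a by rewrite cmod_gt0.
have [D hD] := gauss_bound tau0 tau1 (w := cmod a / tau ^+ 5) ltac:(by rewrite divr_gt0 ?exprn_gt0).
have [E hE] := gauss_bound tau0 tau1 (w := tau / (cmod a * tau ^+ 4)) ltac:(by rewrite divr_gt0 ?mulr_gt0).
have D0 : 0 <= D by apply: le_trans (hD 0%N); rewrite expr0.
have E0 : 0 <= E by apply: le_trans (hE 0%N); rewrite expr0.
have r20 n : 0 < r ^+ n by rewrite exprn_gt0.
have tn := lt0r_neq0 tau0.
exists (D + E) => -[n|n]; rewrite cmod_jterm.
  have h := hD n.
  apply: (@le_trans _ _ (D * r ^+ (2 * n))); last first.
    by rewrite ler_wpM2r ?lerDl// ltW.
  rewrite -ler_pdivrMr// -tau2 -exprM; apply: le_trans h; rewrite le_eqVlt.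
  apply/orP; left; apply/eqP.
  rewrite -exprnP exprMn expr_div_n -!exprM.
  have -> : tau ^ (n%:Z * (n%:Z - 1)) = tau ^+ (n * n) / tau ^+ n.
    rewrite exprnP exprnN -expfzDr//; congr (tau ^ _).
    by rewrite PoszM; ring.
  have -> : tau ^+ (5 * n) = tau ^+ n * tau ^+ (2 * (2 * n)).
    by rewrite -exprD mulnA -mulSn.
  by field; rewrite !expf_neq0.
have h := hE n.+1.
apply: (@le_trans _ _ (E * r ^+ (2 * n.+1))); last first.
  by rewrite ler_wpM2r ?lerDr// ltW.
rewrite -ler_pdivrMr// -tau2 -exprM; apply: le_trans h; rewrite le_eqVlt.
apply/orP; left; apply/eqP.
rewrite NegzE -exprnN exprMn expr_div_n exprMn -!exprM.
have -> : tau ^ (- n.+1%:Z * (- n.+1%:Z - 1)) = tau ^+ (n.+1 * n.+1) * tau ^+ n.+1.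
  rewrite !exprnP -expfzDr//; congr (tau ^ _).
  by rewrite PoszM; ring.
have -> : tau ^+ (4 * n.+1) = tau ^+ (2 * (2 * n.+1)).
  by rewrite mulnA.
by field; rewrite !expf_neq0// lt0r_neq0.
Qed.

(** The limit of [finite_triple]: away from both ends the q-binomial
    coefficients tend to the inverse of prod_j (1 - p^j), and near the ends the
    terms of the series are small. *)
Lemma triple_product : exists2 c : R[i], c != 0 &
  forall a, a != 0 -> gcvg r (fun m => c * zsum m (jterm s a)) (theta p a).
Proof.
have zb j : cmod (p ^+ j.+1) <= r * r ^+ j by rewrite cmodX exprS.
have [L L0 [hL hLi]] := prod_gcvg_neq0 r0' p1 zb np.
exists L^-1; first by rewrite invr_eq0.
move=> a a0.
have [B B0 hB] := gcvg_bound r0' p1 hLi.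
have [C hC] := hL; have [C' hC'] := hLi.
have C0 := gcvg_const_ge0 hC; have C'0 := gcvg_const_ge0 hC'.
have [D hD] := jterm_bound a0.
have D0 : 0 <= D.
  by have := le_trans (cmod_ge0 _) (hD 0); rewrite absz0 muln0 expr0 mulr1.
pose K := C * B * B + cmod L * C' * B + C'.
have K0 : 0 <= K by rewrite !addr_ge0 ?mulr_ge0 ?cmod_ge0.
(* Both factors in the denominator of the q-binomial coefficient have to be
   close to their limit, whence the two powers. *)
have hq n i : (i <= n)%N -> cmod (qbinom p n i - L^-1) <= K * (r ^+ i + r ^+ (n - i)).
  move=> le; rewrite /qbinom invfM.
  set f := (euler p i)^-1; set f' := (euler p (n - i))^-1; set e := euler p n.
  have -> : e * (f * f') - L^-1 = (e - L) * f * f' + (L * (f - L^-1) * f' + (f' - L^-1)).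
    by field.
  have hi : 0 <= r ^+ i by rewrite exprn_ge0.
  have hni : 0 <= r ^+ (n - i) by rewrite exprn_ge0.
  have hn : r ^+ n <= r ^+ i by rewrite ler_wiXn2l// ltW.
  have g0 x : 0 <= cmod x := cmod_ge0 x.
  have h1 : cmod ((e - L) * f * f') <= C * r ^+ n * B * B.
    rewrite !cmodM; apply: ler_pM; rewrite ?mulr_ge0 ?g0//; last exact: hB.
    by apply: ler_pM; rewrite ?g0//; [exact: hC|exact: hB].
  have h2 : cmod (L * (f - L^-1) * f') <= cmod L * (C' * r ^+ i) * B.
    rewrite !cmodM; apply: ler_pM; rewrite ?mulr_ge0 ?g0//; last exact: hB.
    by rewrite ler_wpM2l ?g0//; exact: hC'.
  have h3 : C * r ^+ n * B * B <= C * B * B * r ^+ i.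
    have -> : C * r ^+ n * B * B = C * B * B * r ^+ n by ring.
    by rewrite ler_wpM2l// !mulr_ge0.
  apply: le_trans (cmodD _ _) _.
  apply: (@le_trans _ _ (C * B * B * r ^+ i + (cmod L * C' * B * r ^+ i + C' * r ^+ (n - i)))).
    apply: lerD; first exact: le_trans h1 h3.
    apply: le_trans (cmodD _ _) _; apply: lerD; last exact: hC'.
    by apply: le_trans h2 _; rewrite le_eqVlt; apply/orP; left; apply/eqP; ring.
  have k1 : 0 <= C * B * B by rewrite !mulr_ge0.
  have k2 : 0 <= cmod L * C' * B by rewrite !mulr_ge0 ?g0.
  have : 0 <= (C * B * B + cmod L * C' * B) * r ^+ (n - i).
    by rewrite mulr_ge0// addr_ge0.
  have : 0 <= C' * r ^+ i by rewrite mulr_ge0.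
  rewrite /K; lra.
suff h : gcvg r (fun m => thetap p m a - L^-1 * zsum m (jterm s a)) 0.
  have := gcvgB r0' p1 (theta_gcvg p1 a) h; rewrite subr0.
  by apply: gcvg_ext => m; rewrite opprB addrC subrK.
exists (D * K * 2 * (2 / (1 - r))) => m; rewrite subr0.
rewrite /thetap (finite_triple s0 sp np)// /zsum mulr_sumr -sumrB.
apply: le_trans (cmod_sum _ _ _) _.
apply: (@le_trans _ _ (zsum m (fun k => D * K * 2 * r ^+ m * r ^+ `|k|%N))).
  apply: ler_sum => i _.
  have -> : jterm s a (i%:Z - m%:Z) * qbinom p (2 * m) i - L^-1 * jterm s a (i%:Z - m%:Z) =
     jterm s a (i%:Z - m%:Z) * (qbinom p (2 * m) i - L^-1) by ring.
  have lt : (i <= 2 * m)%N by rewrite -ltnS.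
  rewrite cmodM; apply: le_trans (ler_pM (cmod_ge0 _) (cmod_ge0 _) (hD _) (hq _ _ lt)) _.
  set d := `|i%:Z - m%:Z|%N.
  have d1 : r ^+ d * r ^+ i <= r ^+ m.
    by rewrite -exprD ler_wiXn2l ?(ltW p1)//; exact: dist_le_l.
  have d2 : r ^+ d * r ^+ (2 * m - i) <= r ^+ m.
    by rewrite -exprD ler_wiXn2l ?(ltW p1)//; apply: dist_le_r.
  have dd : r ^+ (2 * d) = r ^+ d * r ^+ d by rewrite mul2n -addnn exprD.
  rewrite dd.
  have -> : D * (r ^+ d * r ^+ d) * (K * (r ^+ i + r ^+ (2 * m - i))) =
    D * K * (r ^+ d * (r ^+ d * r ^+ i + r ^+ d * r ^+ (2 * m - i))) by ring.
  have -> : D * K * 2 * r ^+ m * r ^+ d = D * K * (r ^+ d * (r ^+ m + r ^+ m)) by ring.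
  by rewrite ler_wpM2l ?mulr_ge0// ler_wpM2l ?exprn_ge0// lerD.
rewrite /zsum -mulr_sumr -/(zsum m (fun k => r ^+ `|k|%N)).
have := zsum_geometric_le r0 p1 m; set Z := zsum m _ => hZ.
have -> : D * K * 2 * (2 / (1 - r)) * r ^+ m = D * K * 2 * r ^+ m * (2 / (1 - r)).
  by rewrite mulrAC.
by rewrite ler_wpM2l// !mulr_ge0// exprn_ge0.
Qed.
End TripleProduct.

(** * The three-term relation of theta *)

Definition zrange m : seq int := [seq i%:Z - m%:Z | i <- iota 0 (2 * m).+1].

Definition zbox m : seq (int * int) := [seq (k, l) | k <- zrange m, l <- zrange m].

Lemma zrange_uniq m : uniq (zrange m).
Proof. by rewrite map_inj_uniq ?iota_uniq// => i j /addIr[]. Qed.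

Lemma mem_zrange m (k : int) : (k \in zrange m) = (`|k|%N <= m)%N.
Proof.
apply/mapP/idP => [[i ii]|km]; first by move: ii; rewrite mem_iota => /andP[_ h] ->; lia.
exists (absz (k + m%:Z)); first by rewrite mem_iota; lia.
lia.
Qed.

Lemma zsumE (V : nmodType) m (g : int -> V) : zsum m g = \sum_(k <- zrange m) g k.
Proof. by rewrite /zsum big_map -(big_mkord xpredT (fun i => g (i%:Z - m%:Z))) /index_iota subn0. Qed.

Lemma zbox_uniq m : uniq (zbox m).
Proof.
by apply: allpairs_uniq; rewrite ?zrange_uniq// => -[a b] [c d] _ _ /= [-> ->].
Qed.

Lemma mem_zbox m (e : int * int) : (e \in zbox m) = (`|e.1|%N <= m)%N && (`|e.2|%N <= m)%N.
Proof.
case: e => a b; rewrite /= -!mem_zrange.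
apply/allpairsP/andP => [[[c d] /= [h1 h2 [-> ->]]//]|[h1 h2]].
by exists (a, b).
Qed.

Lemma sum_zbox (V : nmodType) m (h : int -> int -> V) :
  \sum_(e <- zbox m) h e.1 e.2 = zsum m (fun k => zsum m (h k)).
Proof.
rewrite /zbox big_allpairs zsumE; apply: eq_bigr => k _.
by rewrite zsumE.
Qed.

Lemma sum_subseq (V : nmodType) (T : eqType) (s t : seq T) (h : T -> V) :
  uniq s -> uniq t -> {subset s <= t} ->
  \sum_(e <- t) h e = \sum_(e <- s) h e + \sum_(e <- t | e \notin s) h e.
Proof.
move=> us ut st; rewrite (bigID (mem s))/=; congr (_ + _).
rewrite -big_filter; apply: perm_big; apply: uniq_perm => //.
  exact: filter_uniq.
by move=> e; rewrite mem_filter andb_idr//; exact: st.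
Qed.

(** The index pairs (k, l) with k + l odd are (i + j + 1, i - j), those with
    k + l even are (j + 1 + i, j + 1 - i); under these substitutions the
    product of two theta terms separates in i and j. *)
Definition odd_pair (e : int * int) := (e.1 + e.2 + 1, e.1 - e.2).
Definition even_pair (e : int * int) := (e.2 + 1 + e.1, e.2 + 1 - e.1).

(** The image of two square truncations; it lies between two square
    truncations in (k, l). *)
Definition diamond m := map odd_pair (zbox m) ++ map even_pair (zbox m).

Lemma diamond_uniq m : uniq (diamond m).
Proof.
have i1 : injective odd_pair.
  by move=> [a b] [c d] []/= h1 h2; congr (_, _); lia.
have i2 : injective even_pair.
  by move=> [a b] [c d] []/= h1 h2; congr (_, _); lia.
rewrite cat_uniq !map_inj_uniq// !zbox_uniq andTb andbT.
apply/hasPn => _ /mapP[[a b] _ ->]; apply/mapP => -[[c d] _].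
by rewrite /odd_pair /even_pair /= => -[]; lia.
Qed.

Lemma zbox_diamond m : {subset zbox m <= diamond m.+1}.
Proof.
move=> [a b]; rewrite mem_zbox mem_cat => /andP[ha hb].
have {}ha : (absz a <= m)%N := ha; have {}hb : (absz b <= m)%N := hb.
have [c [cE|cE]] : exists c : int, a + b = 2 * c \/ a + b = 2 * c + 1.
  exists ((a + b) %/ 2)%Z; lia.
- apply/orP; right; apply/mapP; exists (a - c, c - 1).
    by rewrite mem_zbox /=; lia.
  by rewrite /even_pair /=; congr (_, _); lia.
- apply/orP; left; apply/mapP; exists (c, a - c - 1).
    by rewrite mem_zbox /=; lia.
  by rewrite /odd_pair /=; congr (_, _); lia.
Qed.

Lemma diamond_zbox m : {subset diamond m <= zbox (2 * m).+1}.
Proof.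
move=> e; rewrite mem_cat => /orP[] /mapP[[a b] ab ->]; move: ab;
  rewrite !mem_zbox => /andP[/= ha hb]; apply/andP; split; rewrite /=; lia.
Qed.

Section DoubleSum.
Variables (R : realType) (r : R).
Hypotheses (r0 : 0 < r) (r1 : r < 1).

Lemma sum_zbox_geometric m :
  \sum_(e <- zbox m) r ^+ (`|e.1| + `|e.2|) =
  zsum m (fun k => r ^+ `|k|%N) ^+ 2.
Proof.
rewrite (sum_zbox m (fun k l => r ^+ (`|k| + `|l|))) expr2 {1 2}/zsum mulr_suml.
apply: eq_bigr => i _; rewrite mulr_sumr; apply: eq_bigr => j _.
by rewrite exprD.
Qed.

Lemma le_sum_notin (T : eqType) (s t t' : seq T) (a : T -> R) :
  uniq t -> uniq t' -> {subset t <= t'} -> (forall e, 0 <= a e) ->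
  \sum_(e <- t | e \notin s) a e <= \sum_(e <- t' | e \notin s) a e.
Proof.
move=> ut ut' tt' a0; rewrite ![\sum_(e <- _ | e \notin s) _]big_mkcond /=.
rewrite (sum_subseq _ ut ut' tt') lerDl sumr_ge0// => e _.
by case: ifP.
Qed.

(** The two truncations differ by terms outside the small square and inside a
    large one, whose sum is of the order of r ^+ m. *)
Lemma diamond_gcvg (h : int -> int -> R[i]) D :
  (forall k l, cmod (h k l) <= D * r ^+ (`|k| + `|l|)) ->
  gcvg r (fun m => \sum_(e <- diamond m.+1) h e.1 e.2
                   - \sum_(e <- zbox m) h e.1 e.2) 0.
Proof.
move=> hh; have D0 : 0 <= D.
  by have := le_trans (cmod_ge0 _) (hh 0 0); rewrite expr0 mulr1.
have d0 : 0 < 1 - r by rewrite subr_gt0.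
pose K := (1 - r)^-1; have K0 : 0 <= K by rewrite invr_ge0 ltW.
exists (D * (8 * K * K)) => m; rewrite subr0.
rewrite (sum_subseq _ (zbox_uniq m) (diamond_uniq m.+1) (@zbox_diamond m)).
rewrite addrAC subrr add0r; apply: le_trans (cmod_sum _ _ _) _.
set M := (2 * m.+1).+1.
apply: (@le_trans _ _ (\sum_(e <- zbox M | e \notin zbox m) D * r ^+ (`|e.1| + `|e.2|))).
  apply: (@le_trans _ _ (\sum_(e <- diamond m.+1 | e \notin zbox m)
      D * r ^+ (`|e.1| + `|e.2|))); first by apply: ler_sum => e _; apply: hh.
  apply: le_sum_notin; rewrite ?diamond_uniq ?zbox_uniq//.
    exact: diamond_zbox.
  by move=> e; rewrite mulr_ge0// exprn_ge0// ltW.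
rewrite -mulr_sumr -mulrA ler_wpM2l//.
have sub : {subset zbox m <= zbox M}.
  move=> e; rewrite !mem_zbox => /andP[h1 h2].
  have mM : (m <= M)%N by rewrite /M leqW// mulnS addnCA leq_addr.
  by apply/andP; split; [exact: leq_trans h1 mM|exact: leq_trans h2 mM].
have := sum_subseq (fun e : int * int => r ^+ (`|e.1| + `|e.2|))
  (zbox_uniq m) (zbox_uniq M) sub.
rewrite !sum_zbox_geometric; set Z := zsum M _; set z := zsum m _; set S := \sum_(_ <- _ | _) _.
move=> e0; have -> : S = (Z - z) * (Z + z).
  by rewrite -subr_sqr e0 addrAC subrr add0r.
have hz := zsum_geometric r m; have hZ := zsum_geometric r M.
have leZ : Z <= 2 * K by apply: zsum_geometric_le.
have lez : z <= 2 * K by apply: zsum_geometric_le.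
have rm0 n : 0 <= r ^+ n by rewrite exprn_ge0// ltW.
have dZ : Z - z = K * (2 * r ^+ m.+1 - 2 * r ^+ M.+1).
  apply: (mulfI (lt0r_neq0 d0)); rewrite mulrBr hz hZ [RHS]mulrA divff ?lt0r_neq0//.
  by ring.
have rm1 : r ^+ m.+1 <= r ^+ m by rewrite ler_wiXn2l// ltW.
have dZ1 : Z - z <= K * (2 * r ^+ m).
  by rewrite dZ ler_wpM2l//; have := rm0 M.+1; lra.
have dZ0 : 0 <= Z - z.
  rewrite dZ mulr_ge0//.
  have : r ^+ M.+1 <= r ^+ m.+1.
    rewrite ler_wiXn2l ?ltW// ltnS /M leqW// (leq_trans (leqnSn m))//.
    by rewrite leq_pmull.
  lra.
have sZ0 : 0 <= Z + z.
  by rewrite addr_ge0// sumr_ge0.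
have h4 : Z + z <= 4 * K by lra.
apply: le_trans (ler_pM dZ0 sZ0 dZ1 h4) _.
by rewrite le_eqVlt; apply/orP; left; apply/eqP; ring.
Qed.

Lemma gcvgS (u : nat -> R[i]) l : gcvg r u l -> gcvg r (fun m => u m.+1) l.
Proof.
move=> [C hC]; exists C => m; apply: le_trans (hC m.+1) _.
rewrite ler_wpM2l ?(gcvg_const_ge0 hC)// ler_wiXn2l// ltW//.
Qed.
End DoubleSum.

Section JacobiTerms.
Variables (F : fieldType) (s p : F).
Hypotheses (s0 : s != 0) (sp : s ^+ 2 = p).

(** The terms p^(i^2) x^(2 i) and p^(j (j + 1)) x^(2 j + 1) of the two theta
    series of base p^2 into which the double series separates. *)
Definition phi_term (x : F) (i : int) := jterm p (- (p * x ^+ 2)) i.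
Definition psi_term (x : F) (j : int) := x * jterm p (- (p ^+ 2 * x ^+ 2)) j.

Let n1 : (-1 : F) != 0. Proof. by rewrite oppr_eq0 oner_neq0. Qed.

Lemma sign_sqr (k : int) : (-1) ^ k * (-1) ^ k = 1 :> F.
Proof. by rewrite -expfzMl mulN1r opprK exp1rz. Qed.

Lemma pE (k : int) : p ^ k = s ^ (2 * k).
Proof. by rewrite -sp exprnP exprz_exp. Qed.

Lemma phi_termE x (i : int) : phi_term x i = s ^ (2 * i * i) * x ^ (2 * i).
Proof.
rewrite /phi_term /jterm -(mulN1r (p * _)) (expfzMl (-1)) (expfzMl p) (exprnP x) exprz_exp.
have -> : s ^ (2 * i * i) = p ^ (i * (i - 1)) * p ^ i.
  by rewrite !pE -expfzDr//; congr (s ^ _); ring.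
transitivity ((-1) ^ i * (-1) ^ i * (p ^ (i * (i - 1)) * p ^ i * x ^ (2 * i))).
  by ring.
by rewrite sign_sqr mul1r.
Qed.

Lemma psi_termE y (j : int) : y != 0 ->
  psi_term y j = s ^ (2 * j * (j + 1)) * y ^ (2 * j + 1).
Proof.
move=> y0; rewrite /psi_term /jterm -(mulN1r (_ * y ^+ 2)) (expfzMl (-1)).
rewrite (expfzMl (p ^+ 2)) (exprnP y) exprz_exp.
have -> : s ^ (2 * j * (j + 1)) = p ^ (j * (j - 1)) * (p ^+ 2) ^ j.
  by rewrite exprnP exprz_exp !pE -expfzDr//; congr (s ^ _); ring.
rewrite (expfzDr _ _ y0) expr1z.
transitivity ((-1) ^ j * (-1) ^ j *
   (p ^ (j * (j - 1)) * (p ^+ 2) ^ j * (y ^ (2 * j) * y))).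
  by ring.
by rewrite sign_sqr mul1r.
Qed.

Lemma exprz_mul_div (x y : F) (k l : int) : x != 0 -> y != 0 ->
  (x * y) ^ k * (x / y) ^ l = x ^ (k + l) * y ^ (k - l).
Proof.
by move=> x0 y0; rewrite !expfzMl exprz_inv !expfzDr//; ring.
Qed.

Lemma jterm_mul x y (k l : int) : x != 0 -> y != 0 ->
  jterm s (x * y) k * jterm s (x / y) l =
  (-1) ^ (k + l) * s ^ (k * (k - 1) + l * (l - 1)) * (x ^ (k + l) * y ^ (k - l)).
Proof.
move=> x0 y0; rewrite -exprz_mul_div// (expfzDr _ _ n1) (expfzDr _ _ s0) /jterm.
by ring.
Qed.

Lemma jterm_odd x y (i j : int) : x != 0 -> y != 0 ->
  jterm s (x * y) (i + j + 1) * jterm s (x / y) (i - j) =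
  - x * (phi_term x i * psi_term y j).
Proof.
move=> x0 y0; rewrite jterm_mul// phi_termE psi_termE//.
have -> : i + j + 1 + (i - j) = i + i + 1 by ring.
have -> : i + j + 1 - (i - j) = 2 * j + 1 by ring.
have -> : (i + j + 1) * (i + j + 1 - 1) + (i - j) * (i - j - 1) =
  2 * i * i + 2 * j * (j + 1) by ring.
rewrite !(expfzDr _ _ n1) sign_sqr mul1r expr1z (expfzDr _ _ s0).
have -> : 2 * i = i + i by ring.
by rewrite !(expfzDr _ _ x0) expr1z; ring.
Qed.

Lemma jterm_even x y (i j : int) : x != 0 -> y != 0 ->
  jterm s (x * y) (j + 1 + i) * jterm s (x / y) (j + 1 - i) =
  x * (psi_term x j * phi_term y i).
Proof.
move=> x0 y0; rewrite jterm_mul// phi_termE psi_termE//.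
have -> : j + 1 + i + (j + 1 - i) = (j + 1) + (j + 1) by ring.
have -> : j + 1 + i - (j + 1 - i) = 2 * i by ring.
have -> : (j + 1 + i) * (j + 1 + i - 1) + (j + 1 - i) * (j + 1 - i - 1) =
  2 * i * i + 2 * j * (j + 1) by ring.
rewrite (expfzDr _ _ n1) sign_sqr mul1r (expfzDr _ _ s0).
have -> : 2 * j + 1 = j + j + 1 by ring.
by rewrite !(expfzDr _ _ x0) expr1z; ring.
Qed.

(** On the diamond the truncated double series factors exactly. *)
Lemma zsum_diamond m x y : x != 0 -> y != 0 ->
  \sum_(e <- diamond m) jterm s (x * y) e.1 * jterm s (x / y) e.2 =
  x * (zsum m (psi_term x) * zsum m (phi_term y)
       - zsum m (phi_term x) * zsum m (psi_term y)).
Proof.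
move=> x0 y0; rewrite /diamond big_cat !big_map.
rewrite (sum_zbox m (fun i j => jterm s (x * y) (i + j + 1) * jterm s (x / y) (i - j))).
rewrite (sum_zbox m (fun i j =>
  jterm s (x * y) (j + 1 + i) * jterm s (x / y) (j + 1 - i))).
rewrite /= mulrBr addrC; congr (_ + _).
  rewrite [zsum m (psi_term x) * _]mulrC /zsum !mulr_suml mulr_sumr.
  apply: eq_bigr => i _; rewrite !mulr_sumr; apply: eq_bigr => j _.
  by rewrite jterm_even//; ring.
rewrite -[X in _ = X]mulNr /zsum mulr_suml mulr_sumr; apply: eq_bigr => i _.
rewrite !mulr_sumr; apply: eq_bigr => j _.
by rewrite jterm_odd//; ring.
Qed.

Lemma diamond_combine (c X Y D : F) :
  c * X * (c * Y) + c * c * (D - X * Y) = c * c * D.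
Proof. by ring. Qed.

(** The relation is the Pluecker relation among the 2 x 2 minors of the four
    points t, A / t, t / c, t / u; the square root t of u v symmetrizes the
    parameters. *)
Lemma rank2_addition (th Phi Psi : F -> F) C :
  (forall x y, x != 0 -> y != 0 ->
    th (x * y) * th (x / y) = C * x * (Psi x * Phi y - Phi x * Psi y)) ->
  forall c u v A t, c != 0 -> u != 0 -> v != 0 -> A != 0 -> t * t = u * v ->
  th (c / u) * th (v / c) * th (u * v / A) * th A =
  th c * th (u * v / c) * th (A / u) * th (v / A)
  + v / A * th (A * c / (u * v)) * th (A / c) * th u * th v.
Proof.
move=> hC c u v A t c0 u0 v0 A0 tt.
have t0 : t != 0.
  by apply: contraTneq (mulf_neq0 u0 v0) => t0; rewrite -tt t0 mul0r eqxx.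
have nz (x : F) : x != 0 -> t / x != 0 by move=> x0; rewrite mulf_neq0 ?invr_eq0.
have nz' (x : F) : x != 0 -> x / t != 0 by move=> x0; rewrite mulf_neq0 ?invr_eq0.
have vE : v = t * t / u by rewrite tt mulrC mulKf.
have e1 := hC _ _ t0 (nz' _ A0).
have e2 := hC _ _ (nz _ u0) (nz _ c0).
have e3 := hC _ _ t0 (nz _ c0).
have e4 := hC _ _ (nz _ u0) (nz' _ A0).
have e5 := hC _ _ (nz' _ A0) (nz _ c0).
have e6 := hC _ _ t0 (nz _ u0).
have a1 : t * (A / t) = A by field.
have a2 : t / (A / t) = u * v / A by rewrite -tt; field; rewrite t0 A0.
have a3 : t / u * (t / c) = v / c by rewrite vE; field; rewrite u0 c0.
have a4 : t / u / (t / c) = c / u by field; rewrite u0 c0 t0.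
have a5 : t * (t / c) = u * v / c by rewrite -tt; field.
have a6 : t / (t / c) = c by field; rewrite c0 t0.
have a7 : t / u * (A / t) = A / u by field; rewrite u0 t0.
have a8 : t / u / (A / t) = v / A by rewrite vE; field; rewrite u0 t0 A0.
have a9 : A / t * (t / c) = A / c by field; rewrite c0 t0.
have a10 : A / t / (t / c) = A * c / (u * v) by rewrite -tt; field; rewrite c0 t0.
have a11 : t * (t / u) = v by rewrite vE mulrA.
have a12 : t / (t / u) = u by field; rewrite u0 t0.
rewrite a1 a2 in e1; rewrite a3 a4 in e2; rewrite a5 a6 in e3.
rewrite a7 a8 in e4; rewrite a9 a10 in e5; rewrite a11 a12 in e6.
transitivity ((th A * th (u * v / A)) * (th (v / c) * th (c / u))).
  by ring.
rewrite e1 e2.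
transitivity ((th (u * v / c) * th c) * (th (A / u) * th (v / A))
  + v / A * ((th (A / c) * th (A * c / (u * v))) * (th v * th u)));
  last by ring.
rewrite e3 e4 e5 e6 vE.
by field; rewrite t0 u0 A0.
Qed.
End JacobiTerms.

Section Addition.
Variables (R : realType) (p : R[i]).
Hypotheses (p0 : p != 0) (p1 : cmod p < 1).
Let r := cmod p.
Let r0 : 0 < r. Proof. by rewrite cmod_gt0. Qed.
Let r0' := ltW r0.
Let s := sqrtc p.
Let sp : s ^+ 2 = p. Proof. exact: sqr_sqrtc. Qed.
Let s0 : s != 0. Proof. by rewrite sqrtc_eq0. Qed.

Lemma jterm_root_bound (a : R[i]) : a != 0 ->
  exists D, forall k : int, cmod (jterm s a k) <= D * r ^+ `|k|%N.
Proof.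
move=> a0; have [D hD] := jterm_bound p0 p1 sp a0; exists D => k.
have D0 : 0 <= D.
  by have := le_trans (cmod_ge0 _) (hD 0); rewrite absz0 muln0 expr0 mulr1.
apply: le_trans (hD k) _; rewrite ler_wpM2l// ler_wiXn2l ?(ltW p1)//.
by rewrite mul2n -addnn leq_addr.
Qed.

Lemma jterm_base_bound (a : R[i]) : a != 0 ->
  exists D, forall k : int, cmod (jterm p a k) <= D * r ^+ `|k|%N.
Proof.
move=> a0.
have p20 : p ^+ 2 != 0 by rewrite expf_neq0.
have p21 : cmod (p ^+ 2) < 1 by rewrite cmodX exprn_ilt1.
have [D hD] := jterm_bound p20 p21 erefl a0; exists D => k.
have D0 : 0 <= D.
  by have := le_trans (cmod_ge0 _) (hD 0); rewrite absz0 muln0 expr0 mulr1.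
apply: le_trans (hD k) _; rewrite ler_wpM2l// cmodX -exprM.
rewrite ler_wiXn2l ?(ltW p1)//.
by rewrite mulnA leq_pmull.
Qed.

Lemma phi_gcvg x : x != 0 -> exists l, gcvg r (fun m => zsum m (phi_term p x)) l.
Proof.
move=> x0; have a0 : - (p * x ^+ 2) != 0 by rewrite oppr_eq0 mulf_neq0// expf_neq0.
have [D hD] := jterm_base_bound a0; exact: (zsum_gcvg r0 p1 hD).
Qed.

Lemma psi_gcvg x : x != 0 -> exists l, gcvg r (fun m => zsum m (psi_term p x)) l.
Proof.
move=> x0; have a0 : - (p ^+ 2 * x ^+ 2) != 0.
  by rewrite oppr_eq0 mulf_neq0// expf_neq0.
have [D hD] := jterm_base_bound a0; apply: (zsum_gcvg r0 p1 (D := cmod x * D)) => k.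
by rewrite /psi_term cmodM -mulrA ler_wpM2l// cmod_ge0.
Qed.

Definition Phi x := limn ((fun m => zsum m (phi_term p x)) : nat -> R[i]^o).
Definition Psi x := limn ((fun m => zsum m (psi_term p x)) : nat -> R[i]^o).

(** The square truncation of the double series converges to the left side by
    [triple_product]; the diamond truncation has the same limit and factors
    by [zsum_diamond]. *)
Lemma theta_rank2 : exists c, forall x y, x != 0 -> y != 0 ->
  theta p (x * y) * theta p (x / y) = c * x * (Psi x * Phi y - Phi x * Psi y).
Proof.
have [c c0 hc] := triple_product p0 p1 sp.
exists (c * c) => x y x0 y0.
have xy0 : x * y != 0 by rewrite mulf_neq0.
have xy1 : x / y != 0 by rewrite mulf_neq0 ?invr_eq0.
pose h k l := jterm s (x * y) k * jterm s (x / y) l.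
have [D hD] := jterm_root_bound xy0; have [E hE] := jterm_root_bound xy1.
have hh k l : cmod (h k l) <= D * E * r ^+ (`|k| + `|l|).
  rewrite cmodM exprD mulrACA; apply: ler_pM; rewrite ?cmod_ge0//.
have hd := diamond_gcvg r0 p1 hh.
have hb := gcvgM r0' p1 (hc _ xy0) (hc _ xy1).
have hdiam : gcvg r (fun m => c * c * \sum_(e <- diamond m.+1) h e.1 e.2)
    (theta p (x * y) * theta p (x / y)).
  have := gcvgD hb (gcvgZ r0' p1 (c * c) hd); rewrite mulr0 addr0.
  apply: gcvg_ext => m; rewrite (sum_zbox m h).
  have -> : zsum m (fun k => zsum m (h k)) = zsum m (jterm s (x * y)) * zsum m (jterm s (x / y)).
    by rewrite /zsum mulr_suml; apply: eq_bigr => i _; rewrite mulr_sumr.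
  exact: diamond_combine.
have gPhi z : z != 0 -> gcvg r (fun m => zsum m.+1 (phi_term p z)) (Phi z).
  move=> z0; have [l hl] := phi_gcvg z0.
  apply: (gcvgS r0 p1 (u := fun m => zsum m (phi_term p z))).
  by rewrite /Phi (gcvg_lim r0' p1 hl).
have gPsi z : z != 0 -> gcvg r (fun m => zsum m.+1 (psi_term p z)) (Psi z).
  move=> z0; have [l hl] := psi_gcvg z0.
  apply: (gcvgS r0 p1 (u := fun m => zsum m (psi_term p z))).
  by rewrite /Psi (gcvg_lim r0' p1 hl).
apply: (gcvg_uniq r0' p1 hdiam).
have := gcvgZ r0' p1 (c * c * x) (gcvgB r0' p1
   (gcvgM r0' p1 (gPsi _ x0) (gPhi _ y0)) (gcvgM r0' p1 (gPhi _ x0) (gPsi _ y0))).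
apply: gcvg_ext => m; rewrite -mulrA; congr (_ * _).
exact: (esym (zsum_diamond s0 sp m.+1 x0 y0)).
Qed.

Lemma theta_addition c u v A : c != 0 -> u != 0 -> v != 0 -> A != 0 ->
  theta p (c / u) * theta p (v / c) * theta p (u * v / A) * theta p A =
  theta p c * theta p (u * v / c) * theta p (A / u) * theta p (v / A)
  + v / A * theta p (A * c / (u * v)) * theta p (A / c) * theta p u * theta p v.
Proof.
move=> c0 u0 v0 A0; have [C hC] := theta_rank2.
apply: (rank2_addition hC c0 u0 v0 A0 (t := sqrtc (u * v))).
by rewrite -expr2 sqr_sqrtc.
Qed.

End Addition.

(** At p = 0 the triple product is not available, but theta is elementary. *)
Lemma theta0 (R : realType) (a : R[i]) : theta 0 a = 1 - a.
Proof.
have c0 : cmod (0 : R[i]) < 1 by rewrite cmod0 ltr01.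
apply: (gcvg_uniq (cmod_ge0 0) c0 (theta_gcvg c0 a)); exists (cmod a) => -[|m].
  by rewrite /thetap big_ord0 opprB addrC subrK expr0 mulr1.
rewrite /thetap big_ord_recl big1 => [|i _].
  by rewrite expr0 mulr1 expr1 mul0r subr0 !mulr1 subrr cmod0 expr0n mulr0.
by rewrite /= !exprS !mul0r mulr0 subr0 mul1r.
Qed.

Theorem theta_like_theta (R : realType) (p : R[i]) : `|p| < 1 -> theta_like (theta p).
Proof.
move=> p1'; have p1 : cmod p < 1 by rewrite -ltcR -cmodE.
have [->|p0] := eqVneq p 0.
  split=> [x x0|c u v A c0 u0 v0 A0|e e0].
  - by rewrite !theta0; field.
  - by rewrite !theta0; field; rewrite ?c0 ?u0 ?v0 ?A0.
  - rewrite theta0 => /eqP; rewrite subr_eq0 => /eqP <-.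
    exists 1; first exact: oner_neq0.
    by exists 0 => x _; rewrite expr0z !mul1r.
split; [exact: thetaV|exact: theta_addition|exact: theta_quasi].
Qed.

(** * Bailey pairs *)

Section Bridge.
Variables (R : realType) (n : nat) (q p : R[i]) (x : 'I_n -> R[i]).
Hypothesis H : theta_like (theta p).
Hypothesis nq : q != 0.

(** Box sums over different N are brought to the common index type
    {ffun 'I_n -> 'I_M.+1}, so that nested ones can be exchanged. *)
Lemma box_sumE M (N : multi n) (G : multi n -> R[i]) :
  (forall r, (N r <= M)%N) ->
  box_sum N G = \sum_(k : {ffun 'I_n -> 'I_M.+1} | [forall r, (k r <= N r)%N])
    G [ffun r => nat_of_ord (k r)].
Proof.
move=> NM; rewrite /box_sum.
have le r (i : 'I_(N r).+1) : (i < M.+1)%N.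
  by apply: leq_trans (ltn_ord i) _; rewrite ltnS.
pose h (k : {ffun 'I_n -> 'I_M.+1}) : {dffun forall r : 'I_n, 'I_(N r).+1} :=
  [ffun r => inord (k r)].
pose h' (j : {dffun forall r : 'I_n, 'I_(N r).+1}) : {ffun 'I_n -> 'I_M.+1} :=
  [ffun r => Ordinal (le r (j r))].
rewrite (reindex_onto h' h)/=; last first.
  move=> k /forallP kN; apply/ffunP => r; apply/val_inj; rewrite !ffunE /= inordK//.
  by rewrite ltnS.
apply: eq_big => [j|j _].
  symmetry; apply/andP; split.
    by apply/forallP => r; rewrite ffunE /= -ltnS.
  by apply/eqP/ffunP => r; apply/val_inj; rewrite !ffunE /= inordK.
by congr G; apply/ffunP => r; rewrite !ffunE.
Qed.

Lemma qpfactE a m : qpfact q p a m%:Z = tfact (theta p) q a m.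
Proof. by []. Qed.

Lemma wt_ge (k : multi n) r : (k r <= wt k)%N.
Proof. by rewrite /wt (bigD1 r)//= leq_addr. Qed.

Lemma xdenomE (k j : multi n) : (forall r, (j r <= k r)%N) ->
  \prod_(r < n) \prod_(s < n)
       qpfact q p (q ^ (1 + (j r)%:Z - (j s)%:Z) * x r / x s)
                  ((k r)%:Z - (j r)%:Z) = xdenom (theta p) q x k j.
Proof.
move=> jk; apply: eq_bigr => r _; apply: eq_bigr => s _.
by rewrite subzn// qpfactE.
Qed.

Lemma B2E (k j : multi n) a b : (forall r, (j r <= k r)%N) ->
  B2 q p x k j a b =
  tfact (theta p) q b (wt k + wt j)
  * (\prod_(r < n) tfact (theta p) q (b * q ^+ (wt k - k r) / (a * x r)) (k r - j r))
  / (xdenom (theta p) q x k j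
     * \prod_(r < n) tfact (theta p) q (a * x r * q) (k r + wt j)).
Proof.
move=> jk; rewrite /B2 xdenomE//; congr (_ * _ / _).
by apply: eq_bigr => r _; rewrite !subzn ?wt_ge.
Qed.

Lemma beta_bailey_term (N k j : multi n) a b r1 r2 :
  (forall r, (j r <= k r)%N) -> (forall r, (k r <= N r)%N) ->
  qpfact q p (b * r2 / a) (wt N)%:Z / qpfact q p (a * q / r2) (wt N)%:Z
  * (\prod_(r < n)
      (qpfact q p (b * r1 * q ^ ((wt N)%:Z - (N r)%:Z) / (a * x r)) (N r)%:Z
       / qpfact q p (a * x r * q / r1) (N r)%:Z))
  * (qpfact q p r1 (wt k)%:Z / qpfact q p (b * r2 / a) (wt k)%:Z
      * (\prod_(r < n)
          (qpfact q p (r2 * x r) (k r)%:Z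
           * qpfact q p (b * r1 * q ^+ wt N / (a * x r))
                        ((wt k)%:Z - (k r)%:Z)
           / qpfact q p (b * r1 * q ^ ((wt N)%:Z - (N r)%:Z) / (a * x r))
                        (wt k)%:Z))
      * (theta p (b * r1 * r2 * q ^+ (2 * wt k) / (a * q))
         / theta p (b * r1 * r2 / (a * q)))
      * (qpfact q p b (wt N + wt k)%N%:Z
         / qpfact q p (b * r1 * r2 / a) (wt N + wt k)%N%:Z)
      * (qpfact q p (a * q / (r1 * r2)) ((wt N)%:Z - (wt k)%:Z)
         / \prod_(r < n) \prod_(s < n)
             qpfact q p (q ^ (1 + (k r)%:Z - (k s)%:Z) * x r / x s)
                        ((N r)%:Z - (k r)%:Z))
      * (a * q / (r1 * r2)) ^+ wt k)
  * B2 q p x k j a (b * r1 * r2 / (a * q)) =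
  bailey_term (theta p) q x a b r1 r2 j N k.
Proof.
move=> jk kN.
rewrite (B2E _ _ jk).
rewrite (xdenomE kN).
have le : (wt k <= wt N)%N by apply: leq_sum => r _.
rewrite (subzn le).
have -> : \prod_(r < n)
      (qpfact q p (b * r1 * q ^ ((wt N)%:Z - (N r)%:Z) / (a * x r)) (N r)%:Z
       / qpfact q p (a * x r * q / r1) (N r)%:Z) =
   \prod_(r < n)
      (tfact (theta p) q (b * r1 * q ^+ (wt N - N r) / (a * x r)) (N r)
       / tfact (theta p) q (a * x r * q / r1) (N r)).
  by apply: eq_bigr => r _; rewrite subzn ?wt_ge.
have -> : \prod_(r < n)
          (qpfact q p (r2 * x r) (k r)%:Z
           * qpfact q p (b * r1 * q ^+ wt N / (a * x r))
                        ((wt k)%:Z - (k r)%:Z)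
           / qpfact q p (b * r1 * q ^ ((wt N)%:Z - (N r)%:Z) / (a * x r))
                        (wt k)%:Z) =
  \prod_(r < n)
          (tfact (theta p) q (r2 * x r) (k r)
           * tfact (theta p) q (b * r1 * q ^+ wt N / (a * x r)) (wt k - k r)
           / tfact (theta p) q (b * r1 * q ^+ (wt N - N r) / (a * x r)) (wt k)).
  by apply: eq_bigr => r _; rewrite !subzn ?wt_ge.
rewrite !qpfactE.
reflexivity.
Qed.

Lemma alpha_bailey_total (alpha : multi n -> R[i] -> R[i] -> R[i])
   (N j : multi n) a b r1 r2 : (forall r, (j r <= N r)%N) ->
  B2 q p x N j a b * alpha' q p x r1 r2 alpha j a b =
  bailey_total (theta p) q x a b r1 r2 j N * alpha j a (b * r1 * r2 / (a * q)).
Proof. by move=> jN; rewrite B2E// /alpha' /bailey_total mulrA. Qed.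

(** The genericity assumption speaks of whole factorials; choosing the two
    multi-indices suitably isolates each single theta factor. *)
Lemma generic_theta_neq0 r s (i : int) : generic_x q p x -> (r != s) || (0 < i) ->
  theta p (q ^ i * x r / x s) != 0.
Proof.
move=> [nx ge].
have [<-{s}|rs _] := eqVneq r s.
  case: i => // -[//|i] _.
  have le0 s : ([ffun=> 0%N] s <= ([ffun=> i.+1] : multi n) s)%N by rewrite ffunE.
  have := ge [ffun=> i.+1] [ffun=> 0%N] le0 r r.
  rewrite !ffunE subr0 addr0 subr0 => h.
  have : theta p (q ^ 1 * x r / x r * q ^+ i) != 0.
    apply: contraNneq h => h; rewrite qpfactE /tfact big_ord_recr /= h mulr0.
    by [].
  have -> // : q ^ i.+1%:Z * x r / x r = q ^ 1 * x r / x r * q ^+ i.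
  by rewrite -exprnP exprS expr1z; field; rewrite nx.
have ex : exists j : multi n, (j r)%:Z - (j s)%:Z = i - 1.
  case: (i - 1) => m.
    exists [ffun t => if t == r then m else 0%N].
    by rewrite !ffunE eqxx eq_sym (negbTE rs) subr0.
  exists [ffun t => if t == s then m.+1 else 0%N].
  by rewrite !ffunE eqxx (negbTE rs) sub0r NegzE.
have [j ij] := ex.
have jk t : (j t <= ([ffun t => (j t).+1] : multi n) t)%N by rewrite ffunE.
have := ge [ffun t => (j t).+1] j jk r s; rewrite ffunE subzn// subSnn qpfactE /tfact big_ord1 expr0 mulr1.
by rewrite -addrA ij addrCA subrr addr0.
Qed.

(** Substitute the relation for beta at b', exchange the sums over k and j,
    and apply [sum_bailey_term] to the coefficient of alpha_j. *)
Theorem WP_Bailey_step (r1 r2 : R[i])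
    (alpha beta : multi n -> R[i] -> R[i] -> R[i])
    (dom : R[i] -> R[i] -> Prop) : (1 <= n)%N ->
  r1 != 0 -> r2 != 0 -> generic_x q p x ->
  WP_Bailey_pair (fun a b => generic_B2 q p x a b /\ dom a b)
    (B2 q p x) alpha beta ->
  WP_Bailey_pair
    (fun a b => [/\ generic_B2 q p x a b, generic_rho q p x r1 r2 a b
                  & dom a (b * r1 * r2 / (a * q))])
    (B2 q p x) (alpha' q p x r1 r2 alpha) (beta' q p x r1 r2 beta).
Proof.
move=> n0 nr1 nr2 gx WP N a b [[na nb gB] [gT gR] gd].
set b' := b * r1 * r2 / (a * q) in gT gd *.
have nb' : b' != 0 by rewrite !mulf_neq0 ?invr_eq0 ?mulf_neq0.
have Hb k : beta k a b' = box_sum k (fun j => B2 q p x k j a b' * alpha j a b').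
  by apply: WP.
pose M := wt N.
have NM r : (N r <= M)%N by exact: wt_ge.
pose toM (k : {ffun 'I_n -> 'I_M.+1}) : multi n := [ffun r => nat_of_ord (k r)].
have toME k r : toM k r = k r by rewrite ffunE.
have wtM k : wt (toM k) = (\sum_(r < n) k r)%N by apply: eq_bigr => r _.
rewrite /beta' !(@box_sumE M)// mulr_sumr.
under eq_bigr => k /forallP kN.
  rewrite Hb (@box_sumE M); last by move=> r; rewrite ffunE -ltnS.
  rewrite !mulr_sumr.
  over.
rewrite (exchange_big_dep (fun j : {ffun 'I_n -> 'I_M.+1} =>
   [forall r, (j r <= N r)%N])); last first.
  move=> k j /forallP kN /forallP jk; apply/forallP => r.
  by have := jk r; rewrite ffunE => /leq_trans; apply.
apply: eq_bigr => j /forallP jN.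
have jN' r : (toM j r <= N r)%N by rewrite toME.
rewrite alpha_bailey_total// -/b'.
(* Since n >= 1, every size occurs; thus the nonvanishing of the factorials
   for all multi-indices gives that of theta (b' q^i) for all i. *)
have rank1 m : exists k : multi n, wt k = m.
  exists [ffun r => if r == Ordinal n0 then m else 0%N].
  rewrite /wt (bigD1 (Ordinal n0))//= ffunE eqxx big1 ?addn0// => r /negbTE nr.
  by rewrite ffunE nr.
have wt0 : wt ([ffun=> 0%N] : multi n) = 0%N.
  by rewrite /wt big1// => r _; rewrite ffunE.
have Tb i : theta p (b' * q ^+ i) != 0.
  case: i => [|i]; first by rewrite expr0 mulr1.
  have [k wk] := rank1 i.+1.
  have [_ _ _ _] := gR k [ffun=> 0%N] (fun r => ltac:(by rewrite ffunE)).
  rewrite wt0 addn0 wk qpfactE tfactSr mulf_eq0 negb_or => /andP[_].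
  have -> // : b * r1 * r2 / a * q ^+ i = b' * q ^+ i.+1.
  by rewrite exprS /b'; field; rewrite na nq.
have nx := gx.1.
have ndx r s (i : int) := @generic_theta_neq0 r s i gx.
have h1 r i : theta p (a * x r * q * q ^+ i) != 0.
  have le0 s : ([ffun=> 0%N] s <= ([ffun=> i.+1] : multi n) s)%N by rewrite ffunE.
  have := gB _ _ le0 r; rewrite ffunE qpfactE.
  by rewrite wt0 addn0 tfactSr mulf_eq0 negb_or => /andP[].
have [h3 h2 _ _ _] := gR N N (fun r => leqnn (N r)).
have gk (k : 'I_n -> nat) : (forall r, (k r <= N r)%N) ->
    qpfact q p (b * r2 / a) (\sum_(r < n) k r)%N%:Z != 0 /\
    forall r, qpfact q p (b * r1 * q ^+ (wt N - N r) / (a * x r))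
      (\sum_(r < n) k r)%N%:Z != 0.
  move=> kN; have kN' r : (([ffun r => k r] : multi n) r <= N r)%N by rewrite ffunE.
  have [_ _ h4 h5 _] := gR N [ffun r => k r] kN'.
  have ek : wt ([ffun r => k r] : multi n) = (\sum_(r < n) k r)%N.
    by apply: eq_bigr => r _; rewrite ffunE.
  rewrite ek in h4 h5; split=> // r; have := h5 r.
  by rewrite subzn ?wt_ge.
have S := @sum_bailey_term _ (theta p) H q nq n M x nx ndx a b r1 r2 (toM j) N
  na nb nr1 nr2 jN' NM h1 h2 h3 (fun k kN => (gk k kN).1)
  (fun k r kN => (gk k kN).2 r) Tb.
rewrite -S mulr_suml; apply: eq_big => [k|k /andP[/forallP kN /forallP jk]].
  apply/andP/forallP => [[/forallP kN /forallP jk] r|jkN].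
    by rewrite kN toME andbT; have := jk r; rewrite toME.
  split; apply/forallP => r; have := jkN r; rewrite toME => /andP[] //.
  by rewrite ffunE.
rewrite [in RHS](_ : (fun r => nat_of_ord (k r)) = toM k); last first.
  by apply/funext => r; rewrite toME.
rewrite -(@beta_bailey_term N (toM k) (toM j)).
- by rewrite -/b' !mulrA.
- by move=> r; rewrite toME.
- by move=> r; rewrite toME.
Qed.

End Bridge.

Unset Implicit Arguments.
Set Strict Implicit.
Set Printing Implicit Defensive.

Theorem theorem5p4 (R : realType) (n : nat) (q p : R[i]) (x : 'I_n -> R[i])
    (rho1 rho2 : R[i])
    (alpha beta : multi n -> R[i] -> R[i] -> R[i])
    (dom : R[i] -> R[i] -> Prop) :
  (1 <= n)%N ->
  q != 0 -> `|p| < 1 ->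
  rho1 != 0 -> rho2 != 0 ->
  generic_x q p x ->
  WP_Bailey_pair (fun a b => generic_B2 q p x a b /\ dom a b)
    (B2 q p x) alpha beta ->
  WP_Bailey_pair
    (fun a b => [/\ generic_B2 q p x a b, generic_rho q p x rho1 rho2 a b
                  & dom a (b * rho1 * rho2 / (a * q))])
    (B2 q p x) (alpha' q p x rho1 rho2 alpha) (beta' q p x rho1 rho2 beta).
Proof.
move=> n1 nq p1 nr1 nr2 gx; apply: WP_Bailey_step => //.
exact: theta_like_theta.
Qed.
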